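(* Let $\mathcal{L}$ be a real line arrangement in $\mathbb{CP}^2$ with exactly $t\ge1$ multiple points $P_1,\dots,P_t$, all lying on the same line $L\in\mathcal{L}$, and such that every line of $\mathcal{L}$ passes through at least one of the points $P_i$. Let $k_i+1$ be the multiplicity of $P_i$ for $1\le i\le t$. Then $$\pi_1(\mathbb{CP}^2-\mathcal{L})\cong\bigoplus_{i=1}^t\mathbb{F}^{k_i}.$$
   Context: A real line arrangement is a finite union of distinct projective lines in $\mathbb{CP}^2$, each of which can be defined by a linear equation with real coefficients; $\mathcal{L}$ denotes both the set of lines and their union. A multiple point is a point where more than two lines of the arrangement meet; the multiplicity of a point is the number of lines of the arrangement passing through it. $\mathbb{F}^k$ denotes the free group on $k$ generators, and $\oplus$ denotes the direct product of groups. *)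

(* Defs.v *)
From HB Require Import structures.
From Stdlib Require Import Relation_Operators.
From mathcomp Require Import all_boot all_order all_algebra finmap.
From mathcomp Require Import generic_quotient complex lra.
From mathcomp Require Import mathcomp_extra boolp classical_sets functions.
From mathcomp Require Import cardinality set_interval reals topology normedtype.
From mathcomp Require Import homotopy.

Set Implicit Arguments.
Unset Strict Implicit.
Unset Printing Implicit Defensive.

Import Order.TTheory GRing.Theory Num.Theory.
Import numFieldNormedType.Exports.

Local Open Scope classical_set_scope.
Local Open Scope ring_scope.
Local Open Scope quotient_scope.

Definition group_isomorphic (G H : groupType) : Prop :=
  exists f : {multiplicative G -> H}, bijective f.

Section GroupProd.
Context {I : Type} (G : I -> groupType).

Definition group_prod : Type := forall i, G i.

HB.instance Definition _ := Choice.copy group_prod (forall i, G i).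

Let pmul (f g : group_prod) : group_prod := fun i => (f i * g i)%g.
Let pone : group_prod := fun i => 1%g.
Let pinv (f : group_prod) : group_prod := fun i => (f i)^-1%g.

Fact group_prod_mulgA : associative pmul.
Proof.
by move=> f g h; apply: functional_extensionality_dep => i; exact: mulgA.
Qed.

Fact group_prod_mul1g : left_id pone pmul.
Proof. by move=> f; apply: functional_extensionality_dep => i; exact: mul1g. Qed.

Fact group_prod_mulg1 : right_id pone pmul.
Proof. by move=> f; apply: functional_extensionality_dep => i; exact: mulg1. Qed.

Fact group_prod_mulVg : left_inverse pone pinv pmul.
Proof. by move=> f; apply: functional_extensionality_dep => i; exact: mulVg. Qed.

Fact group_prod_mulgV : right_inverse pone pinv pmul.
Proof. by move=> f; apply: functional_extensionality_dep => i; exact: mulgV. Qed.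

HB.instance Definition _ := isGroup.Build group_prod group_prod_mulgA
  group_prod_mul1g group_prod_mulg1 group_prod_mulVg group_prod_mulgV.

End GroupProd.

(* A letter (x, true) stands for the generator x and (x, false) for its       *)
(* inverse; the free group is the quotient of the monoid of words by the      *)
(* congruence generated by the cancellation of adjacent inverse letters.      *)
Section FreeGroup.
Context (X : choiceType).

Definition word := seq (X * bool).

Variant cancels : word -> word -> Prop :=
  Cancels u x b v : cancels (u ++ (x, b) :: (x, ~~ b) :: v) (u ++ v).

Definition word_equiv : word -> word -> Prop :=
  clos_refl_sym_trans word cancels.

Let word_rel (u v : word) : bool := `[< word_equiv u v >].

Fact word_rel_refl : reflexive word_rel.
Proof. by move=> u; apply/asboolP; exact: rst_refl. Qed.

Fact word_rel_sym : symmetric word_rel.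
Proof. by move=> u v; apply/asboolP/asboolP; exact: rst_sym. Qed.

Fact word_rel_trans : transitive word_rel.
Proof.
by move=> v u w /asboolP uv /asboolP vw; apply/asboolP; exact: rst_trans vw.
Qed.

Definition word_eqrel := EquivRel word_rel word_rel_refl word_rel_sym
  word_rel_trans.

Definition free_group : Type := {eq_quot word_eqrel}.

HB.instance Definition _ := Choice.on free_group.
HB.instance Definition _ := Quotient.on free_group.

Definition inv_word (u : word) : word := rev [seq (a.1, ~~ a.2) | a <- u].

Let fmul (a b : free_group) : free_group := \pi_free_group (repr a ++ repr b).
Let fone : free_group := \pi_free_group [::].
Let finv (a : free_group) : free_group := \pi_free_group (inv_word (repr a)).

Lemma pi_wordP (u v : word) :
  \pi_free_group u = \pi_free_group v <-> word_equiv u v.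
Proof.
by split=> [/eqmodP/asboolP //|uv]; apply/eqmodP/asboolP.
Qed.

Let repr_word (u : word) : word_equiv (repr (\pi_free_group u)) u.
Proof. by apply/pi_wordP; rewrite reprK. Qed.

Lemma word_equiv_catl (w u v : word) :
  word_equiv u v -> word_equiv (w ++ u) (w ++ v).
Proof.
elim=> [_ _ [a x b c]|a|a b _|a b c _ h _]; last exact: rst_trans h.
- by apply: rst_step; rewrite !catA.
- exact: rst_refl.
- exact: rst_sym.
Qed.

Lemma word_equiv_catr (w u v : word) :
  word_equiv u v -> word_equiv (u ++ w) (v ++ w).
Proof.
elim=> [_ _ [a x b c]|a|a b _|a b c _ h _]; last exact: rst_trans h.
- by apply: rst_step; rewrite -!catA /=.
- exact: rst_refl.
- exact: rst_sym.
Qed.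

Lemma word_equiv_cat (u u' v v' : word) : word_equiv u u' ->
  word_equiv v v' -> word_equiv (u ++ v) (u' ++ v').
Proof.
move=> uu' vv'; apply: rst_trans (word_equiv_catl u' vv').
exact: word_equiv_catr.
Qed.

Lemma inv_wordK : involutive inv_word.
Proof.
move=> u; rewrite /inv_word map_rev revK -map_comp map_id_in // => -[x b] _ /=.
by rewrite negbK.
Qed.

Lemma word_mulVg (u : word) : word_equiv (inv_word u ++ u) [::].
Proof.
elim: u => [|[x b] u ih]; first exact: rst_refl.
apply: rst_trans ih; rewrite /inv_word /= rev_cons cat_rcons.
by apply: rst_step; have := Cancels (inv_word u) x (~~ b) u; rewrite negbK.
Qed.

Lemma word_mulgV (u : word) : word_equiv (u ++ inv_word u) [::].
Proof. by have := word_mulVg (inv_word u); rewrite inv_wordK. Qed.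

Fact free_group_mulgA : associative fmul.
Proof.
move=> a b c; apply/pi_wordP.
apply: (rst_trans _ _ _ _ _ (word_equiv_catl (repr a) (repr_word _))).
rewrite catA; apply: rst_sym; apply: word_equiv_catr; exact: repr_word.
Qed.

Fact free_group_mul1g : left_id fone fmul.
Proof.
move=> a; rewrite -[RHS]reprK; apply/pi_wordP.
exact: (word_equiv_catr (repr a) (repr_word [::])).
Qed.

Fact free_group_mulg1 : right_id fone fmul.
Proof.
move=> a; rewrite -[RHS]reprK; apply/pi_wordP.
rewrite -[X in word_equiv _ X]cats0; apply: word_equiv_catl; exact: repr_word.
Qed.

Fact free_group_mulVg : left_inverse fone finv fmul.
Proof.
move=> a; apply/pi_wordP; apply: rst_trans (word_mulVg (repr a)).
apply: word_equiv_catr; exact: repr_word.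
Qed.

Fact free_group_mulgV : right_inverse fone finv fmul.
Proof.
move=> a; apply/pi_wordP; apply: rst_trans (word_mulgV (repr a)).
apply: word_equiv_catl; exact: repr_word.
Qed.

HB.instance Definition _ := isGroup.Build free_group free_group_mulgA
  free_group_mul1g free_group_mulg1 free_group_mulVg free_group_mulgV.

Lemma free_group_mulE (u v : word) :
  (\pi_free_group u * \pi_free_group v)%g = \pi_free_group (u ++ v).
Proof. by apply/pi_wordP/word_equiv_cat; exact: repr_word. Qed.

End FreeGroup.

Section UnitInterval.
Context (R : realType).

Definition unit_itv : Type := set_type (`[0, 1]%classic : set R).

HB.instance Definition _ := Topological.on unit_itv.

Fact clamp_subproof (t : R) :
  Num.max 0 (Num.min 1 t) \in (`[0, 1]%classic : set R).
Proof.
rewrite inE /= in_itv /= le_max lexx /= ge_max ler01 /=.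
by rewrite ge_min lexx.
Qed.

(* The retraction of R onto [0, 1]. *)
Definition to_unit_itv (t : R) : unit_itv :=
  exist (fun x => x \in (`[0, 1]%classic : set R)) _ (clamp_subproof t).

Definition of_unit_itv (t : unit_itv) : R := set_val t.

Lemma to_unit_itvK t : 0 <= t <= 1 -> of_unit_itv (to_unit_itv t) = t.
Proof.
move=> /andP[t0 t1]; rewrite /of_unit_itv set_valE /=.
by rewrite (min_idPr t1) (max_idPr t0).
Qed.

Lemma unit_itvP (t : unit_itv) : 0 <= of_unit_itv t <= 1.
Proof.
by case: t => t /=; rewrite /of_unit_itv set_valE /= inE /= in_itv.
Qed.

Lemma of_unit_itvK : cancel of_unit_itv to_unit_itv.
Proof.
move=> t; apply/val_inj; rewrite -set_valE.
exact: to_unit_itvK (unit_itvP t).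
Qed.

Fact unit_itv_neq : to_unit_itv 0 != to_unit_itv 1.
Proof.
apply/eqP => /(congr1 of_unit_itv); rewrite !to_unit_itvK ?lexx ?ler01 //.
by apply/eqP; rewrite eq_sym oner_eq0.
Qed.

HB.instance Definition _ := isBiPointed.Build unit_itv unit_itv_neq.

Lemma of_zero : of_unit_itv zero = 0.
Proof. by rewrite to_unit_itvK // lexx ler01. Qed.

Lemma of_one : of_unit_itv one = 1.
Proof. by rewrite to_unit_itvK // lexx ler01. Qed.

Lemma continuous_of_unit_itv : continuous of_unit_itv.
Proof. exact: initial_continuous. Qed.

Lemma continuous_to_unit_itv : continuous to_unit_itv.
Proof.
apply/continuous_comp_initial => t /=.
rewrite set_valE.
apply: (@continuous_max _ _ (cst 0) (fun t : R => Num.min 1 t)).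
  exact: cst_continuous.
by apply: (@continuous_min _ _ (cst 1) id); [exact: cst_continuous|exact: id].
Qed.

End UnitInterval.

Section Continuity.
Context {R : realType} {X Y Z : topologicalType}.

Lemma cont_cst (y : Y) : continuous (fun _ : X => y).
Proof. by move=> t; exact: cvg_cst. Qed.

Lemma cont_comp (f : X -> Y) (g : Y -> Z) :
  continuous f -> continuous g -> continuous (fun t => g (f t)).
Proof. by move=> cf cg t; apply: continuous_comp; [exact: cf|exact: cg]. Qed.

Lemma cont_pair (f : X -> Y) (g : X -> Z) :
  continuous f -> continuous g -> continuous (fun t => (f t, g t)).
Proof. by move=> cf cg t; apply: cvg_pair; [exact: cf|exact: cg]. Qed.

Lemma cont_fst : continuous (@fst X Y).
Proof. by move=> t; exact: cvg_fst. Qed.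

Lemma cont_snd : continuous (@snd X Y).
Proof. by move=> t; exact: cvg_snd. Qed.

Variables f g : X -> R.
Hypotheses (cf : continuous f) (cg : continuous g).

Lemma cont_add : continuous (fun t => f t + g t).
Proof. by move=> t; apply: cvgD; [exact: cf|exact: cg]. Qed.

Lemma cont_sub : continuous (fun t => f t - g t).
Proof. by move=> t; apply: cvgB; [exact: cf|exact: cg]. Qed.

Lemma cont_mul : continuous (fun t => f t * g t).
Proof. by move=> t; apply: cvgM; [exact: cf|exact: cg]. Qed.

Lemma cont_min : continuous (fun t => Num.min (f t) (g t)).
Proof. by move=> t; apply: continuous_min; [exact: cf|exact: cg]. Qed.

Lemma cont_max : continuous (fun t => Num.max (f t) (g t)).
Proof. by move=> t; apply: continuous_max; [exact: cf|exact: cg]. Qed.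

End Continuity.

Section Pasting.
Context {R : realType} {X T : topologicalType}.

Lemma continuous_if_le (g : X -> R) (c : R) (f1 f2 : X -> T) :
  continuous g -> continuous f1 -> continuous f2 ->
  (forall x, g x = c -> f1 x = f2 x) ->
  continuous (fun x => if g x <= c then f1 x else f2 x).
Proof.
move=> cg c1 c2 e; set f := fun x => _.
have cA : closed [set x | g x <= c].
  exact: (continuous_closedP g).1 cg _ (@closed_le _ c).
have cB : closed [set x | c <= g x].
  exact: (continuous_closedP g).1 cg _ (@closed_ge _ c).
have AB : [set x | g x <= c] `|` [set x | c <= g x] = setT.
  by rewrite -subTset => x _ /=; exact/orP/le_total.
apply/(continuous_subspace_setT f); rewrite -AB.
apply: withinU_continuous => //.
- apply: (@subspace_eq_continuous _ _ _ f1); last exact: continuous_subspaceT.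
  move=> x; rewrite inE /= => xc.
  by have : f1 x = f x by rewrite /f xc.
- apply: (@subspace_eq_continuous _ _ _ f2); last exact: continuous_subspaceT.
  move=> x; rewrite inE /= => cx.
  suff : f2 x = f x by [].
  rewrite /f; case: ifP => // xc.
  by rewrite e //; apply/eqP; rewrite eq_le xc cx.
Qed.

End Pasting.

Section PathHomotopy.
Context {R : realType} {T : topologicalType} (x y : T).
Local Notation I := (unit_itv R).
Local Notation path := {path I from x to y}.

Definition path_homotopic (p q : path) : Prop :=
  exists H : I * I -> T, [/\ continuous H,
    forall t, H (zero, t) = p t, forall t, H (one, t) = q t,
    forall s, H (s, zero) = x & forall s, H (s, one) = y].

Lemma path_homotopic_reparam (p q r : path) (a b : I -> R) :
  continuous a -> continuous b ->
  (forall t, q t = p (to_unit_itv (a t))) ->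
  (forall t, r t = p (to_unit_itv (b t))) ->
  a zero = b zero -> a one = b one -> path_homotopic q r.
Proof.
move=> ca cb qE rE ab0 ab1.
pose g (u : I * I) : R :=
  (1 - of_unit_itv u.1) * a u.2 + of_unit_itv u.1 * b u.2.
have cu : continuous (fun u : I * I => of_unit_itv u.1).
  by apply: cont_comp; [exact: cont_fst|exact: continuous_of_unit_itv].
have cg : continuous g.
  apply: cont_add; apply: cont_mul => //.
  - by apply: cont_sub => //; exact: cont_cst.
  - by apply: cont_comp => //; exact: cont_snd.
  - by apply: cont_comp => //; exact: cont_snd.
exists (p \o @to_unit_itv R \o g); split.
- apply: (cont_comp cg); apply: cont_comp; last exact: cts_fun.
  exact: continuous_to_unit_itv.
- by move=> t; rewrite /g /= of_zero subr0 mul1r mul0r addr0 -qE.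
- by move=> t; rewrite /g /= of_one subrr mul1r mul0r add0r -rE.
- by move=> s; rewrite /g /= -ab0 -mulrDl subrK mul1r -qE path_zero.
- by move=> s; rewrite /g /= -ab1 -mulrDl subrK mul1r -qE path_one.
Qed.

Lemma path_homotopic_refl (p : path) : path_homotopic p p.
Proof.
have E t : p t = p (to_unit_itv (of_unit_itv t)) by rewrite of_unit_itvK.
by apply: (path_homotopic_reparam (a := @of_unit_itv R)
  (b := @of_unit_itv R) _ _ E E) => //; exact: continuous_of_unit_itv.
Qed.

Lemma path_homotopic_sym (p q : path) :
  path_homotopic p q -> path_homotopic q p.
Proof.
move=> [H [cH H0 H1 Hx Hy]].
pose h (u : I * I) : I * I := (to_unit_itv (1 - of_unit_itv u.1), u.2).
exists (H \o h); split.
- apply: cont_comp cH; apply: cont_pair; last exact: cont_snd.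
  apply: cont_comp; last exact: continuous_to_unit_itv.
  apply: cont_sub; first exact: cont_cst.
  by apply: cont_comp; [exact: cont_fst|exact: continuous_of_unit_itv].
- by move=> t; rewrite /h /= of_zero subr0 H1.
- by move=> t; rewrite /h /= of_one subrr H0.
- by move=> s; exact: Hx.
- by move=> s; exact: Hy.
Qed.

Lemma path_homotopic_trans (q p r : path) :
  path_homotopic p q -> path_homotopic q r -> path_homotopic p r.
Proof.
move=> [H [cH H0 H1 Hx Hy]] [K [cK K0 K1 Kx Ky]].
pose h (c : R) (u : I * I) : I * I :=
  (to_unit_itv (2 * of_unit_itv u.1 - c), u.2).
have cu : continuous (fun u : I * I => of_unit_itv u.1).
  by apply: cont_comp; [exact: cont_fst|exact: continuous_of_unit_itv].
have ch c : continuous (h c).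
  apply: cont_pair; last exact: cont_snd.
  apply: cont_comp; last exact: continuous_to_unit_itv.
  apply: cont_sub; last exact: cont_cst.
  by apply: cont_mul => //; exact: cont_cst.
exists (fun u => if of_unit_itv u.1 <= 2^-1 then H (h 0 u) else K (h 1 u)).
split.
- apply: continuous_if_le => // [u|u|u E].
  + exact: cont_comp (ch 0) cH u.
  + exact: cont_comp (ch 1) cK u.
  + by rewrite /h E mulfV ?pnatr_eq0 // subr0 subrr H1 K0.
- by move=> t; rewrite /h /= of_zero invr_ge0 ler0n mulr0 subr0 H0.
- move=> t; rewrite /h /= of_one ifF; last by apply/negbTE; rewrite -ltNge; lra.
  by rewrite mulr1 (_ : 2 - 1 = 1 :> R) ?K1 //; lra.
- by move=> s; rewrite /h /= Hx Kx; case: ifP.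
- by move=> s; rewrite /h /= Hy Ky; case: ifP.
Qed.

End PathHomotopy.

Section PathOperations.
Context {R : realType} {T : topologicalType}.
Local Notation I := (unit_itv R).

Definition cat_fun (p q : I -> T) (t : I) : T :=
  if of_unit_itv t <= 2^-1 then p (to_unit_itv (2 * of_unit_itv t))
  else q (to_unit_itv (2 * of_unit_itv t - 1)).

Section Cat.
Context (x y z : T) (p : {path I from x to y}) (q : {path I from y to z}).

Fact cat_fun_continuous : continuous (cat_fun p q).
Proof.
have cu : continuous (@of_unit_itv R) := @continuous_of_unit_itv R.
have c2 : continuous (fun t : I => 2 * of_unit_itv t).
  by apply: cont_mul => //; exact: cont_cst.
apply: continuous_if_le => [//|||t E].
- apply: (cont_comp (f := fun t => to_unit_itv (2 * of_unit_itv t)));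
    last exact: cts_fun.
  by apply: cont_comp; last exact: continuous_to_unit_itv.
- apply: (cont_comp (f := fun t => to_unit_itv (2 * of_unit_itv t - 1)));
    last exact: cts_fun.
  apply: cont_comp; last exact: continuous_to_unit_itv.
  by apply: cont_sub => //; exact: cont_cst.
- by rewrite E mulfV ?pnatr_eq0 // subrr path_one path_zero.
Qed.

Fact cat_fun_zero : cat_fun p q zero = x.
Proof. by rewrite /cat_fun of_zero invr_ge0 ler0n mulr0 path_zero. Qed.

Fact cat_fun_one : cat_fun p q one = z.
Proof.
rewrite /cat_fun of_one ifF; last by apply/negbTE; rewrite -ltNge; lra.
by rewrite mulr1 (_ : 2 - 1 = 1 :> R) ?path_one //; lra.
Qed.

Definition cat_path : {path I from x to z} :=
  mk_path cat_fun_continuous cat_fun_zero cat_fun_one.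

End Cat.

Section Rev.
Context (x y : T) (p : {path I from x to y}).

Definition rev_fun (t : I) : T := p (to_unit_itv (1 - of_unit_itv t)).

Fact rev_fun_continuous : continuous rev_fun.
Proof.
apply: (cont_comp (f := fun t => to_unit_itv (1 - of_unit_itv t)));
  last exact: cts_fun.
apply: cont_comp; last exact: continuous_to_unit_itv.
by apply: cont_sub; [exact: cont_cst|exact: continuous_of_unit_itv].
Qed.

Fact rev_fun_zero : rev_fun zero = y.
Proof. by rewrite /rev_fun of_zero subr0 path_one. Qed.

Fact rev_fun_one : rev_fun one = x.
Proof. by rewrite /rev_fun of_one subrr path_zero. Qed.

Definition rev_path : {path I from y to x} :=
  mk_path rev_fun_continuous rev_fun_zero rev_fun_one.

End Rev.

Definition cst_path (x : T) : {path I from x to x} := cst x.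

End PathOperations.

Arguments cst_path R {T} x.

Section FundamentalGroup.
Context (R : realType) {T : topologicalType} (x : T).
Local Notation I := (unit_itv R).

Definition loop : Type := {path I from x to x}.

HB.instance Definition _ := Choice.on loop.

Let loop_rel (p q : loop) : bool := `[< path_homotopic p q >].

Fact loop_rel_refl : reflexive loop_rel.
Proof. by move=> p; apply/asboolP; exact: path_homotopic_refl. Qed.

Fact loop_rel_sym : symmetric loop_rel.
Proof. by move=> p q; apply/asboolP/asboolP; exact: path_homotopic_sym. Qed.

Fact loop_rel_trans : transitive loop_rel.
Proof.
move=> q p r /asboolP pq /asboolP qr; apply/asboolP.
exact: path_homotopic_trans qr.
Qed.

Definition loop_eqrel := EquivRel loop_rel loop_rel_refl loop_rel_sym
  loop_rel_trans.

Definition fundamental_group : Type := {eq_quot loop_eqrel}.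
Local Notation pi1 := fundamental_group.

HB.instance Definition _ := Choice.on fundamental_group.
HB.instance Definition _ := Quotient.on fundamental_group.

Let lmul (a b : pi1) : pi1 := \pi_fundamental_group (cat_path (repr a) (repr b)).
Let lone : pi1 := \pi_fundamental_group (cst_path R x).
Let linv (a : pi1) : pi1 := \pi_fundamental_group (rev_path (repr a)).

Lemma pi_loopP (p q : loop) :
  \pi_fundamental_group p = \pi_fundamental_group q <-> path_homotopic p q.
Proof. by split=> [/eqmodP/asboolP //|pq]; apply/eqmodP/asboolP. Qed.

Let repr_loop (p : loop) : path_homotopic (repr (\pi_fundamental_group p)) p.
Proof. by apply/pi_loopP; rewrite reprK. Qed.

Lemma cat_path_homotopic (p p' q q' : loop) : path_homotopic p p' ->
  path_homotopic q q' -> path_homotopic (cat_path p q) (cat_path p' q').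
Proof.
move=> [H [cH H0 H1 Hx Hy]] [K [cK K0 K1 Kx Ky]].
pose h (c : R) (u : I * I) : I * I :=
  (u.1, to_unit_itv (2 * of_unit_itv u.2 - c)).
have cu : continuous (fun u : I * I => of_unit_itv u.2).
  by apply: cont_comp; [exact: cont_snd|exact: continuous_of_unit_itv].
have ch c : continuous (h c).
  apply: cont_pair; first exact: cont_fst.
  apply: cont_comp; last exact: continuous_to_unit_itv.
  apply: cont_sub; last exact: cont_cst.
  by apply: cont_mul => //; exact: cont_cst.
exists (fun u => if of_unit_itv u.2 <= 2^-1 then H (h 0 u) else K (h 1 u)).
split.
- apply: continuous_if_le => // [u|u|u E].
  + exact: cont_comp (ch 0) cH u.
  + exact: cont_comp (ch 1) cK u.
  + by rewrite /h E mulfV ?pnatr_eq0 // subr0 subrr Hy Kx.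
- by move=> t; rewrite /h /= H0 K0 subr0.
- by move=> t; rewrite /h /= H1 K1 subr0.
- by move=> s; rewrite /h /= of_zero invr_ge0 ler0n mulr0 subr0 Hx.
- move=> s; rewrite /h /= of_one ifF; last by apply/negbTE; rewrite -ltNge; lra.
  by rewrite mulr1 (_ : 2 - 1 = 1 :> R) ?Ky //; lra.
Qed.

Let cst_loop_reparam (p : loop) t : cst_path R x t = p (to_unit_itv (cst 0 t)).
Proof. by rewrite path_zero. Qed.

Let id_loop_reparam (p : loop) t : p t = p (to_unit_itv (of_unit_itv t)).
Proof. by rewrite of_unit_itvK. Qed.

Lemma cat_pathA (p q r : loop) :
  path_homotopic (cat_path p (cat_path q r)) (cat_path (cat_path p q) r).
Proof.
pose w := cat_path p (cat_path q r).
pose b (t : I) : R := let u := of_unit_itv t in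
  Num.min (2 * u) (Num.min (u + 4^-1) ((u + 1) / 2)).
have cu : continuous (@of_unit_itv R) := @continuous_of_unit_itv R.
have cb : continuous b.
  apply: cont_min.
    by apply: cont_mul; [exact: cont_cst|exact: cu].
  apply: cont_min.
    by apply: cont_add; [exact: cu|exact: cont_cst].
  apply: cont_mul; last exact: cont_cst.
  by apply: cont_add; [exact: cu|exact: cont_cst].
apply: (path_homotopic_reparam (p := w) cu cb (id_loop_reparam w)).
- move=> t; rewrite /w /cat_path /= /mk_path /cat_fun /b /=.
  have := unit_itvP t; set u := of_unit_itv t => uI.
  have [u2|u2] := leP u 2^-1.
    rewrite to_unit_itvK; last by lra.
    have [u4|u4] := leP (2 * u) 2^-1.
      rewrite min_l; last by rewrite le_min; apply/andP; split; lra.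
      by rewrite to_unit_itvK ?u4 //; lra.
    rewrite min_r; last by rewrite ge_min; apply/orP; left; lra.
    rewrite min_l; last by lra.
    rewrite to_unit_itvK; last by lra.
    rewrite ifF; last by apply/negbTE; rewrite -ltNge; lra.
    rewrite to_unit_itvK; last by lra.
    rewrite ifT; last by lra.
    by congr (q (to_unit_itv _)); lra.
  rewrite min_r; last by rewrite ge_min; apply/orP; right; lra.
  rewrite min_r; last by lra.
  rewrite to_unit_itvK; last by lra.
  rewrite ifF; last by apply/negbTE; rewrite -ltNge; lra.
  rewrite to_unit_itvK; last by lra.
  rewrite ifF; last by apply/negbTE; rewrite -ltNge; lra.
  by congr (r (to_unit_itv _)); lra.
- by rewrite /b /cst of_zero mulr0 !add0r min_l// le_min; apply/andP; split; lra.
- by rewrite /b /cst of_one min_r ?min_r //; lra.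
Qed.

Lemma cat_path1l (p : loop) : path_homotopic p (cat_path (cst_path R x) p).
Proof.
pose b (t : I) : R := Num.max 0 (2 * of_unit_itv t - 1).
have cu : continuous (@of_unit_itv R) := @continuous_of_unit_itv R.
have cb : continuous b.
  apply: cont_max; first exact: cont_cst.
  apply: cont_sub; last exact: cont_cst.
  by apply: cont_mul; [exact: cont_cst|exact: cu].
apply: (path_homotopic_reparam cu cb (id_loop_reparam p)).
- move=> t; rewrite /cat_path /= /mk_path /cat_fun /b /=.
  case: ifP => [tle|/negbT]; last rewrite -ltNge => tgt.
    by rewrite max_l ?path_zero //; lra.
  by rewrite max_r //; lra.
- by rewrite /b /cst of_zero max_l /=; lra.
- by rewrite /b /cst of_one max_r /=; lra.
Qed.

Lemma cat_path1r (p : loop) : path_homotopic p (cat_path p (cst_path R x)).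
Proof.
pose b (t : I) : R := Num.min 1 (2 * of_unit_itv t).
have cu : continuous (@of_unit_itv R) := @continuous_of_unit_itv R.
have cb : continuous b.
  apply: cont_min; first exact: cont_cst.
  by apply: cont_mul; [exact: cont_cst|exact: cu].
apply: (path_homotopic_reparam cu cb (id_loop_reparam p)).
- move=> t; rewrite /cat_path /= /mk_path /cat_fun /b /=.
  case: ifP => [tle|/negbT]; last rewrite -ltNge => tgt.
    by rewrite min_r //; lra.
  by rewrite min_l ?path_one //; lra.
- by rewrite /b /cst of_zero min_r //; lra.
- by rewrite /b /cst of_one min_l /=; lra.
Qed.

Lemma cat_path_rev (p : loop) :
  path_homotopic (cst_path R x) (cat_path p (rev_path p)).
Proof.
pose b (t : I) : R := Num.min (2 * of_unit_itv t) (2 - 2 * of_unit_itv t).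
have cu : continuous (@of_unit_itv R) := @continuous_of_unit_itv R.
have cb : continuous b.
  apply: cont_min.
    by apply: cont_mul; [exact: cont_cst|exact: cu].
  apply: cont_sub; first exact: cont_cst.
  by apply: cont_mul; [exact: cont_cst|exact: cu].
apply: (path_homotopic_reparam (a := cst 0) _ cb (cst_loop_reparam p)).
- exact: cont_cst.
- move=> t; rewrite /cat_path /= /mk_path /cat_fun /b /=.
  case: ifP => [tle|/negbT]; last rewrite -ltNge => tgt.
    by rewrite min_l //; lra.
  rewrite /rev_path /mk_path /rev_fun min_r; last by lra.
  have tI := unit_itvP t; rewrite to_unit_itvK; last by lra.
  by rewrite (_ : 1 - (2 * of_unit_itv t - 1) = 2 - 2 * of_unit_itv t) //; lra.
- by rewrite /b /cst of_zero min_l /=; lra.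
- by rewrite /b /cst of_one min_r /=; lra.
Qed.

Lemma rev_path_cat (p : loop) :
  path_homotopic (cst_path R x) (cat_path (rev_path p) p).
Proof.
pose b (t : I) : R :=
  Num.max (1 - 2 * of_unit_itv t) (2 * of_unit_itv t - 1).
have cu : continuous (@of_unit_itv R) := @continuous_of_unit_itv R.
have cb : continuous b.
  apply: cont_max.
    apply: cont_sub; first exact: cont_cst.
    by apply: cont_mul; [exact: cont_cst|exact: cu].
  apply: cont_sub; last exact: cont_cst.
  by apply: cont_mul; [exact: cont_cst|exact: cu].
apply: (path_homotopic_reparam (p := p) (a := cst 1) _ cb).
- exact: cont_cst.
- by move=> t; rewrite path_one.
- move=> t; rewrite /cat_path /= /mk_path /cat_fun /b /=.
  case: ifP => [tle|/negbT]; last rewrite -ltNge => tgt.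
    rewrite /rev_path /mk_path /rev_fun max_l; last by lra.
    by rewrite to_unit_itvK //; have := unit_itvP t; lra.
  by rewrite max_r //; lra.
- by rewrite /b /cst of_zero max_l /=; lra.
- by rewrite /b /cst of_one max_r /=; lra.
Qed.

Let refl := @path_homotopic_refl R T x x.
Let sym (p q : loop) := @path_homotopic_sym R T x x p q.
Let trans (q p r : loop) := @path_homotopic_trans R T x x q p r.

Fact fundamental_group_mulgA : associative lmul.
Proof.
move=> a b c; apply/pi_loopP.
apply: (trans (q := cat_path (repr a) (cat_path (repr b) (repr c)))).
  by apply: cat_path_homotopic; [exact: refl|exact: repr_loop].
apply: (trans (cat_pathA _ _ _)); apply: sym.
by apply: cat_path_homotopic; [exact: repr_loop|exact: refl].
Qed.

Fact fundamental_group_mul1g : left_id lone lmul.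
Proof.
move=> a; rewrite -[RHS]reprK; apply/pi_loopP/sym.
apply: (trans (cat_path1l _)); apply: sym.
by apply: cat_path_homotopic; [exact: repr_loop|exact: refl].
Qed.

Fact fundamental_group_mulg1 : right_id lone lmul.
Proof.
move=> a; rewrite -[RHS]reprK; apply/pi_loopP/sym.
apply: (trans (cat_path1r _)); apply: sym.
by apply: cat_path_homotopic; [exact: refl|exact: repr_loop].
Qed.

Fact fundamental_group_mulVg : left_inverse lone linv lmul.
Proof.
move=> a; apply/pi_loopP/sym.
apply: (trans (rev_path_cat (repr a))); apply: sym.
by apply: cat_path_homotopic; [exact: repr_loop|exact: refl].
Qed.

Fact fundamental_group_mulgV : right_inverse lone linv lmul.
Proof.
move=> a; apply/pi_loopP/sym.
apply: (trans (cat_path_rev (repr a))); apply: sym.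
by apply: cat_path_homotopic; [exact: refl|exact: repr_loop].
Qed.

HB.instance Definition _ := isGroup.Build fundamental_group
  fundamental_group_mulgA fundamental_group_mul1g fundamental_group_mulg1
  fundamental_group_mulVg fundamental_group_mulgV.

Lemma fundamental_group_mulE (p q : loop) :
  (\pi_fundamental_group p * \pi_fundamental_group q)%g =
  \pi_fundamental_group (cat_path p q).
Proof. by apply/pi_loopP/cat_path_homotopic; exact: repr_loop. Qed.

End FundamentalGroup.

Arguments fundamental_group R {T} x.

Section ProjectiveSpace.
Context (K : numFieldType) (n : nat).

Definition nonzero_vec : set 'rV[K]_n.+1 := [set v | v != 0].

Let proportional (v w : nonzero_vec) : bool :=
  `[< exists2 c : K, c != 0 & set_val w = c *: set_val v >].

Fact proportional_refl : reflexive proportional.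
Proof. by move=> v; apply/asboolP; exists 1; rewrite ?oner_eq0 ?scale1r. Qed.

Fact proportional_sym : symmetric proportional.
Proof.
by move=> v w; apply/asboolP/asboolP => -[c c0 ->]; exists c^-1;
  rewrite ?invr_eq0 // scalerA mulVf // scale1r.
Qed.

Fact proportional_trans : transitive proportional.
Proof.
move=> w v z /asboolP[c c0 wE] /asboolP[d d0 zE]; apply/asboolP.
by exists (d * c); [rewrite mulf_neq0|rewrite zE wE scalerA].
Qed.

Definition proportional_eqrel := EquivRel proportional proportional_refl
  proportional_sym proportional_trans.

Definition projective_space : Type := {eq_quot proportional_eqrel}.

HB.instance Definition _ := Topological.copy projective_space
  (quotient_topology {eq_quot proportional_eqrel}).
HB.instance Definition _ := Quotient.on projective_space.

Lemma pi_vecP (v w : nonzero_vec) :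
  \pi_projective_space v = \pi_projective_space w <->
  exists2 c : K, c != 0 & set_val w = c *: set_val v.
Proof. by split=> [/eqmodP/asboolP //|vw]; apply/eqmodP/asboolP. Qed.

(* The zero locus of the linear form with coefficients a; a genuine           *)
(* hyperplane only when a != 0.                                               *)
Definition hyperplane (a : 'rV[K]_n.+1) : set projective_space :=
  [set p | exists2 v : nonzero_vec, \pi_projective_space v = p &
    \sum_i a 0 i * set_val v 0 i = 0].

Lemma hyperplaneP (a : 'rV[K]_n.+1) (v : nonzero_vec) :
  hyperplane a (\pi_projective_space v) <->
  \sum_i a 0 i * set_val v 0 i = 0.
Proof.
split=> [[w /pi_vecP[c c0 ->] wE]|vE]; last by exists v.
transitivity (c * \sum_i a 0 i * set_val w 0 i); last by rewrite wE mulr0.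
by rewrite mulr_sumr; apply: eq_bigr => i _; rewrite mxE mulrCA.
Qed.

End ProjectiveSpace.

Arguments nonzero_vec : clear implicits.

Definition CP2 (R : realType) : topologicalType := projective_space R[i] 2.

Section Arrangement.
Context {R : realType}.

Definition real_line (l : set (CP2 R)) : Prop :=
  exists2 a : 'rV[R]_3, a != 0 & l = hyperplane (map_mx (real_complex R) a).

Definition real_line_arrangement (L : set (set (CP2 R))) : Prop :=
  finite_set L /\ L `<=` real_line.

Definition arrangement_union (L : set (set (CP2 R))) : set (CP2 R) :=
  \bigcup_(l in L) l.

Definition multiplicity (L : set (set (CP2 R))) (p : CP2 R) : nat :=
  #|` fset_set [set l | L l /\ l p]|.

Definition multiple_points (L : set (set (CP2 R))) : set (CP2 R) :=
  [set p | (2 < multiplicity L p)%N].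

End Arrangement.

(* Main.v *)
From HB Require Import structures.
From mathcomp Require Import all_boot all_order all_algebra finmap.
From mathcomp Require Import generic_quotient complex zify ring lra.
From mathcomp Require Import mathcomp_extra boolp classical_sets functions.
From mathcomp Require Import cardinality set_interval reals topology normedtype.
From mathcomp Require Import homotopy.
Require Import Defs.

(* Removing the common line L leaves t classes of parallel affine real lines in
   C^2 such that no point lies on lines of three classes.  Writing a point of
   C^2 as x + iy with x, y in R^2, the directions of the classes cut the y-plane
   into 2t sectors; for each sector, the points such that y is on the sector's
   side of every class having a line through x form an open set that is
   contractible (push y far into the sector, then contract linearly), and these
   sets cover the complement.  They all contain the real points off the lines.
   Hence the fundamental group is generated by loops that pass from one set to
   the next through a given real chamber and come back through a base chamber.
   Such a loop depends only on the slab of the chamber in the class separating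
   the two sectors, and going once around the sectors at a fixed chamber is
   trivial.  Comparing the four chambers around each double point, these
   relations force the loops of distinct classes to commute, so the group is a
   quotient of the product of the free groups; the holonomies of the coordinates
   transverse to the classes, computed with locally constant gauges, invert the
   quotient map. *)

Set Implicit Arguments.
Unset Strict Implicit.
Unset Printing Implicit Defensive.

Import Order.TTheory GRing.Theory Num.Theory.
Import numFieldNormedType.Exports.

Local Open Scope classical_set_scope.
Local Open Scope ring_scope.
Local Open Scope quotient_scope.

(** * The fundamental groupoid *)

Section Groupoid.
Context {R : realType} {T : topologicalType}.
Local Notation I := (unit_itv R).
Local Notation path x y := {path I from x to y}.

(** No presentation is computed and no van Kampen theorem is applied. The relations are never shown
    to be complete: they only have to make the product of free groups map onto the fundamental
    group, and injectivity comes from a left inverse. Taking the gauge of a class with values in the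
    free group itself avoids computing the fundamental group of a punctured line.

    The hypotheses enter as follows. Every line meets some P_i, so each affine line falls into one
    of t classes. Three lines of distinct classes through one affine point would give a multiple
    point off L; its absence lets the four chambers around a double point differ in two slab numbers
    only. The class of P_i has k_i lines, as L is not counted, hence k_i + 1 slabs; the slab of the
    base chamber yields the trivial loop, which leaves k_i generators. Real coefficients give two
    linear orders: of the slopes, hence the cyclic order of the sectors, and of the lines of a
    class, hence the numbering of the slabs.

    Loops are cut at points other than the base point, so the calculations take place in the
    fundamental groupoid. *)

Lemma convex_homotopic (g : R * R -> T) (a b : I -> R * R) (x y : T)
    (p q : path x y) :
  continuous g -> continuous a -> continuous b ->
  a zero = b zero -> a one = b one ->
  (forall t, p t = g (a t)) -> (forall t, q t = g (b t)) ->
  path_homotopic p q.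
Proof.
move=> cg ca cb ab0 ab1 pE qE.
pose c (u v : R) (s : R) := (1 - s) * u + s * v.
have cc (f f' : I -> R) : continuous f -> continuous f' ->
    continuous (fun u : I * I => c (f u.2) (f' u.2) (of_unit_itv u.1)).
  move=> cf cf'.
  have cu : continuous (fun u : I * I => of_unit_itv u.1).
    by apply: cont_comp; [exact: cont_fst|exact: continuous_of_unit_itv].
  apply: cont_add; apply: cont_mul => //.
  - by apply: cont_sub => //; exact: cont_cst.
  - by apply: cont_comp; [exact: cont_snd|].
  - by apply: cont_comp; [exact: cont_snd|].
have c0 u v : c u v 0 = u by rewrite /c; ring.
have c1 u v : c u v 1 = v by rewrite /c; ring.
have cuu u s : c u u s = u by rewrite /c; ring.
(* The linear homotopy from [a] to [b] in the plane, carried to [T] by [g]. *)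
exists (fun u => g (c (a u.2).1 (b u.2).1 (of_unit_itv u.1),
  c (a u.2).2 (b u.2).2 (of_unit_itv u.1))); split=> [|t|t|s|s] /=.
- apply: cont_comp cg; apply: cont_pair.
  + apply: (cc (fun t => (a t).1) (fun t => (b t).1));
    by apply: cont_comp => //; exact: cont_fst.
  + apply: (cc (fun t => (a t).2) (fun t => (b t).2));
    by apply: cont_comp => //; exact: cont_snd.
- by rewrite of_zero !c0 -surjective_pairing.
- by rewrite of_one !c1 -surjective_pairing.
- by rewrite ab0 !cuu -surjective_pairing -qE path_zero.
- by rewrite ab1 !cuu -surjective_pairing -qE path_one.
Qed.

Lemma cat_path_congr (x y z : T) (p p' : path x y) (q q' : path y z) :
  path_homotopic p p' -> path_homotopic q q' ->
  path_homotopic (cat_path p q) (cat_path p' q').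
Proof.
move=> [H [cH H0 H1 Hx Hy]] [K [cK K0 K1 Kx Ky]].
have cu : continuous (fun u : I * I => of_unit_itv u.2).
  by apply: cont_comp; [exact: cont_snd|exact: continuous_of_unit_itv].
pose h (c : R) (u : I * I) : I * I :=
  (u.1, to_unit_itv (2 * of_unit_itv u.2 - c)).
have ch c : continuous (h c).
  apply: cont_pair; first exact: cont_fst.
  apply: cont_comp; last exact: continuous_to_unit_itv.
  apply: cont_sub; last exact: cont_cst.
  by apply: cont_mul => //; exact: cont_cst.
have clamp0 : to_unit_itv (2 * 0 - 0 : R) = zero by rewrite mulr0 subr0.
have clamp1 : to_unit_itv (2 * 1 - 1 : R) = one by congr to_unit_itv; ring.
exists (fun u => if of_unit_itv u.2 <= 2^-1 then H (h 0 u) else K (h 1 u)).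
split=> [|t|t|s|s].
- apply: continuous_if_le => // [u|u|u E].
  + exact: cont_comp (ch 0) cH u.
  + exact: cont_comp (ch 1) cK u.
  + by rewrite /h E mulfV ?pnatr_eq0 // subr0 subrr Hy Kx.
- by rewrite /h /= H0 K0 subr0.
- by rewrite /h /= H1 K1 subr0.
- by rewrite /h /= of_zero invr_ge0 ler0n clamp0 Hx.
- rewrite /h /= of_one ifF; last by apply/negbTE; rewrite -ltNge; lra.
  by rewrite clamp1 Ky.
Qed.

Lemma cat_pathE (x y z : T) (p : path x y) (q : path y z) t :
  cat_path p q t = if of_unit_itv t <= 2^-1
    then p (to_unit_itv (2 * of_unit_itv t))
    else q (to_unit_itv (2 * of_unit_itv t - 1)).
Proof. by []. Qed.

Lemma rev_pathE (x y : T) (p : path x y) t :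
  rev_path p t = p (to_unit_itv (1 - of_unit_itv t)).
Proof. by []. Qed.

Definition path_eqb (x y : T) (p q : path x y) : bool :=
  `[< path_homotopic p q >].

Fact path_eqb_refl x y : reflexive (@path_eqb x y).
Proof. by move=> p; apply/asboolP; exact: path_homotopic_refl. Qed.

Fact path_eqb_sym x y : symmetric (@path_eqb x y).
Proof. by move=> p q; apply/asboolP/asboolP; exact: path_homotopic_sym. Qed.

Fact path_eqb_trans x y : transitive (@path_eqb x y).
Proof.
move=> q p r /asboolP pq /asboolP qr; apply/asboolP.
exact: path_homotopic_trans qr.
Qed.

Definition path_eqrel x y := EquivRel (@path_eqb x y) (@path_eqb_refl x y)
  (@path_eqb_sym x y) (@path_eqb_trans x y).

Definition hom (x y : T) : Type := {eq_quot path_eqrel x y}.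

HB.instance Definition _ x y := Choice.on (hom x y).
HB.instance Definition _ x y := Quotient.on (hom x y).

Definition pcl (x y : T) (p : path x y) : hom x y := \pi_(hom x y) p.

Lemma pclP x y (p q : path x y) : pcl p = pcl q <-> path_homotopic p q.
Proof. by split=> [/eqmodP/asboolP //|pq]; apply/eqmodP/asboolP. Qed.

Lemma pcl_repr x y (a : hom x y) : pcl (repr a) = a.
Proof. exact: reprK. Qed.

Lemma pcl_eq1 x y (p q : path x y) : p =1 q -> pcl p = pcl q.
Proof. by move=> /path_eqP ->. Qed.

Definition comp x y z (a : hom x y) (b : hom y z) : hom x z :=
  pcl (cat_path (repr a) (repr b)).

Definition inv x y (a : hom x y) : hom y x := pcl (rev_path (repr a)).

Local Notation "a ** b" := (comp a b) (at level 40, left associativity).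

Lemma comp_pcl x y z (p : path x y) (q : path y z) :
  pcl p ** pcl q = pcl (cat_path p q).
Proof. by apply/pclP/cat_path_congr; apply/pclP; rewrite pcl_repr. Qed.

(** * Segments of a map of the line, and the groupoid laws *)

Section Segment.
Variables (g : R -> T) (cg : continuous g) (a b : R) (x y : T).
Hypotheses (ga : g a = x) (gb : g b = y).

Definition seg_fun (t : I) : T := g (a + (b - a) * of_unit_itv t).

Fact seg_fun_continuous : continuous seg_fun.
Proof.
apply: (cont_comp (g := g)) => //.
apply: cont_add; first exact: cont_cst.
by apply: cont_mul; [exact: cont_cst|exact: continuous_of_unit_itv].
Qed.

Fact seg_fun_zero : seg_fun zero = x.
Proof. by rewrite /seg_fun of_zero mulr0 addr0. Qed.

Fact seg_fun_one : seg_fun one = y.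
Proof. by rewrite /seg_fun of_one mulr1 addrCA subrr addr0. Qed.

Definition seg : path x y :=
  mk_path seg_fun_continuous seg_fun_zero seg_fun_one.

Lemma segE t : seg t = g (a + (b - a) * of_unit_itv t).
Proof. by []. Qed.

End Segment.

(** Both sides are images of paths in the line with the same ends, and the line is convex. No order
    on [a], [b], [c] is assumed, so units, inverses and associativity are all instances. *)
Lemma seg_comp (g : R -> T) (cg : continuous g) a b c (x y z : T)
    (ga : g a = x) (gb : g b = y) (gc : g c = z) :
  pcl (seg cg ga gb) ** pcl (seg cg gb gc) = pcl (seg cg ga gc).
Proof.
rewrite comp_pcl; apply/pclP.
have cu := @continuous_of_unit_itv R.
pose k (t : I) : R := if of_unit_itv t <= 2^-1
  then a + (b - a) * (2 * of_unit_itv t) else b + (c - b) * (2 * of_unit_itv t -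
    1).
have ck : continuous k.
  have c2 : continuous (fun t : I => 2 * of_unit_itv t).
    by apply: cont_mul => //; exact: cont_cst.
  apply: continuous_if_le => // [||t ->]; last by field.
  - apply: cont_add; first exact: cont_cst.
    by apply: cont_mul => //; exact: cont_cst.
  - apply: cont_add; first exact: cont_cst.
    apply: cont_mul; first exact: cont_cst.
    by apply: cont_sub => //; exact: cont_cst.
apply: (@convex_homotopic (g \o fst) (fun t => (k t, 0))
  (fun t => (a + (c - a) * of_unit_itv t, 0))) => //.
- by apply: cont_comp => //; exact: cont_fst.
- by apply: cont_pair => //; exact: cont_cst.
- apply: cont_pair; last exact: cont_cst.
  apply: cont_add; first exact: cont_cst.
  by apply: cont_mul => //; exact: cont_cst.
- by rewrite /k of_zero invr_ge0 ler0n; congr pair; ring.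
- rewrite /k of_one ifF; last by apply/negbTE; rewrite -ltNge; lra.
  by congr pair; ring.
- move=> t; rewrite cat_pathE /k /=; have tI := unit_itvP t.
  by case: ifP => [tle|/negbT]; last rewrite -ltNge => tgt;
    rewrite segE to_unit_itvK //; lra.
Qed.

(** Constant outside the unit interval, since [to_unit_itv] clamps. *)
Definition ext x y (p : path x y) (t : R) : T := p (to_unit_itv t).

Lemma ext_continuous x y (p : path x y) : continuous (ext p).
Proof.
by apply: cont_comp; [exact: continuous_to_unit_itv|exact: cts_fun].
Qed.

Arguments ext_continuous {x y} p.

Lemma ext0 x y (p : path x y) : ext p 0 = x.
Proof. by rewrite /ext path_zero. Qed.

Lemma ext1 x y (p : path x y) : ext p 1 = y.
Proof. by rewrite /ext path_one. Qed.

Lemma seg_ext x y (p : path x y) :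
  pcl p = pcl (seg (ext_continuous p) (ext0 p) (ext1 p)).
Proof.
by apply: pcl_eq1 => t; rewrite segE /ext subr0 add0r mul1r of_unit_itvK.
Qed.

Lemma seg_cst (g : R -> T) (cg : continuous g) a x (ga ga' : g a = x) :
  pcl (seg cg ga ga') = pcl (cst_path R x).
Proof. by apply: pcl_eq1 => t; rewrite segE subrr mul0r addr0 ga. Qed.

Lemma comp1p x y (a : hom x y) : pcl (cst_path R x) ** a = a.
Proof.
rewrite -(pcl_repr a) (seg_ext (repr a)).
by rewrite -(seg_cst (ext_continuous (repr a)) (ext0 _) (ext0 _)) seg_comp.
Qed.

Lemma compp1 x y (a : hom x y) : a ** pcl (cst_path R y) = a.
Proof.
rewrite -(pcl_repr a) (seg_ext (repr a)).
by rewrite -(seg_cst (ext_continuous (repr a)) (ext1 _) (ext1 _)) seg_comp.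
Qed.

Lemma inv_pcl x y (p : path x y) :
  pcl (rev_path p) = pcl (seg (ext_continuous p) (ext1 p) (ext0 p)).
Proof.
apply: pcl_eq1 => t; by rewrite segE sub0r mulN1r rev_pathE.
Qed.

Lemma comppV x y (a : hom x y) : a ** inv a = pcl (cst_path R x).
Proof.
by rewrite -{1}(pcl_repr a) /inv inv_pcl (seg_ext (repr a)) seg_comp seg_cst.
Qed.

Lemma compVp x y (a : hom x y) : inv a ** a = pcl (cst_path R y).
Proof.
by rewrite -{2}(pcl_repr a) /inv inv_pcl (seg_ext (repr a)) seg_comp seg_cst.
Qed.

Lemma compA x y z w (a : hom x y) (b : hom y z) (c : hom z w) :
  a ** (b ** c) = a ** b ** c.
Proof.
rewrite -(pcl_repr a) -(pcl_repr b) -(pcl_repr c).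
set p := repr a; set q := repr b; set r := repr c.
(* One map runs through the three paths on [0, 3], so both bracketings become its segment from 0 to
   3. *)
pose g (t : R) := if t <= 1 then ext p t
  else if t <= 2 then ext q (t - 1) else ext r (t - 2).
have cs (k : R) : continuous (fun t : R => t - k).
  by apply: cont_sub; [move=> ?; exact: cvg_id|exact: cont_cst].
have cid : continuous (id : R -> R) by move=> ?; exact: cvg_id.
have cg : continuous g.
  apply: continuous_if_le => // [||t ->].
  - exact: ext_continuous.
  - apply: continuous_if_le => // [||t ->].
    + by apply: (cont_comp (cs 1)); exact: ext_continuous.
    + by apply: (cont_comp (cs 2)); exact: ext_continuous.
    + by rewrite (_ : 2 - 1 = 1) ?subrr ?ext0 ?ext1 //; lra.
  - by rewrite ext1 ifT ?subrr ?ext0 //; lra.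
have g0 : g 0 = x by rewrite /g ler01 ext0.
have g1 : g 1 = y by rewrite /g lexx ext1.
have g2 : g 2 = z.
  rewrite /g ifF; last by apply/negbTE; rewrite -ltNge; lra.
  by rewrite lexx (_ : 2 - 1 = 1) ?ext1 //; lra.
have g3 : g 3 = w.
  rewrite /g ifF; last by apply/negbTE; rewrite -ltNge; lra.
  rewrite ifF; last by apply/negbTE; rewrite -ltNge; lra.
  by rewrite (_ : 3 - 2 = 1) ?ext1 //; lra.
have -> : pcl p = pcl (seg cg g0 g1).
  apply: pcl_eq1 => t; rewrite segE /g subr0 add0r mul1r /ext of_unit_itvK.
  by case/andP: (unit_itvP t) => _ ->.
have -> : pcl q = pcl (seg cg g1 g2).
  apply: pcl_eq1 => t; rewrite segE /g (_ : 2 - 1 = 1); last lra.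
  have tI := unit_itvP t; rewrite mul1r; case: ifP => [t1|_].
    have t0 : of_unit_itv t = 0 by lra.
    rewrite t0 addr0 ext1; have := of_unit_itvK t; rewrite t0 => <-.
    by rewrite -/(ext q 0) ext0.
  by rewrite ifT ?(addrC 1) ?addrK /ext ?of_unit_itvK //; lra.
have -> : pcl r = pcl (seg cg g2 g3).
  apply: pcl_eq1 => t; rewrite segE /g (_ : 3 - 2 = 1); last lra.
  have tI := unit_itvP t; rewrite mul1r ifF; last first.
    by apply/negbTE; rewrite -ltNge; lra.
  case: ifP => [t1|_].
    have t0 : of_unit_itv t = 0 by lra.
    rewrite t0 addr0 (_ : 2 - 1 = 1) ?ext1; last lra.
    by have := of_unit_itvK t; rewrite t0 => <-; rewrite -/(ext r 0) ext0.
  by rewrite (addrC 2) addrK /ext of_unit_itvK.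
by rewrite !seg_comp.
Qed.

Lemma comp_inv x y z (a : hom x y) (b : hom y z) :
  inv (a ** b) = inv b ** inv a.
Proof.
rewrite -[RHS]comp1p -(compVp (a ** b)) -2!compA (compA b) (comppV b) comp1p.
by rewrite comppV compp1.
Qed.

(** The two ways around the boundary of the unit square have the same ends and are homotopic by
    convexity of the plane. *)
Lemma square_comp (H : R * R -> T) (x y z w : T) (p : path x y) (q : path z w)
    (l : path x z) (r : path y w) :
  continuous H ->
  (forall t, p t = H (0, of_unit_itv t)) ->
  (forall t, q t = H (1, of_unit_itv t)) ->
  (forall t, l t = H (of_unit_itv t, 0)) ->
  (forall t, r t = H (of_unit_itv t, 1)) ->
  pcl p ** pcl r = pcl l ** pcl q.
Proof.
move=> cH pE qE lE rE; rewrite !comp_pcl; apply/pclP.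
have cu := @continuous_of_unit_itv R.
pose u (t : I) : R := Num.min 1 (2 * of_unit_itv t).
pose v (t : I) : R := Num.max 0 (2 * of_unit_itv t - 1).
have c2 : continuous (fun t : I => 2 * of_unit_itv t).
  by apply: cont_mul => //; exact: cont_cst.
have cU : continuous u by apply: cont_min => //; exact: cont_cst.
have cV : continuous v.
  apply: cont_max; first exact: cont_cst.
  by apply: cont_sub => //; exact: cont_cst.
have u0 : u zero = 0 by rewrite /u of_zero mulr0 min_r //; lra.
have u1 : u one = 1 by rewrite /u of_one min_l //; lra.
have v0 : v zero = 0 by rewrite /v of_zero mulr0 max_l //; lra.
have v1 : v one = 1 by rewrite /v of_one max_r //; lra.
apply: (@convex_homotopic H (fun t => (v t, u t)) (fun t => (u t, v t))) => //.
- by apply: cont_pair.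
- by apply: cont_pair.
- by rewrite u0 v0.
- by rewrite u1 v1.
- move=> t; rewrite cat_pathE /u /v; have tI := unit_itvP t.
  case: ifP => [tle|/negbT]; last rewrite -ltNge => tgt.
    by rewrite pE to_unit_itvK ?max_l ?min_r //; lra.
  by rewrite rE to_unit_itvK ?max_r ?min_l //; lra.
- move=> t; rewrite cat_pathE /u /v; have tI := unit_itvP t.
  case: ifP => [tle|/negbT]; last rewrite -ltNge => tgt.
    by rewrite lE to_unit_itvK ?max_l ?min_r //; lra.
  by rewrite qE to_unit_itvK ?max_r ?min_l //; lra.
Qed.

End Groupoid.

Arguments ext_continuous {R T x y} p.

Notation "a ** b" := (comp a b) (at level 40, left associativity).

(** * Parallel transport of locally constant gauges *)

(** Stands in for compactness of the interval: instead of choosing a subdivision, a property of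
    subintervals that can be concatenated is checked on short ones. *)
Lemma cousin {R : realType} (Q : R -> R -> Prop) (a b : R) : a <= b ->
  (forall x y z, a <= x -> x <= y -> y <= z -> z <= b ->
    Q x y -> Q y z -> Q x z) ->
  (forall t, a <= t -> t <= b -> exists2 e, 0 < e &
    forall x y, a <= x -> x <= y -> y <= b -> t - e < x -> y < t + e ->
      Q x y) ->
  Q a b.
Proof.
move=> ab Qcat Qloc; pose A := [set t | a <= t <= b /\ Q a t].
have Aa : A a.
  split; first by rewrite lexx.
  have [e e0] := Qloc a (lexx a) ab; apply => //; rewrite ?lexx //; lra.
have supA : has_sup A.
  by split; [exists a|exists b => t [/andP[]]].
have as_ : a <= sup A by apply: ub_le_sup => //; case: supA.
have sb : sup A <= b by apply: ge_sup; [exists a|move=> t [/andP[]]].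
have [e e0 eQ] := Qloc _ as_ sb.
have [u Au ue] := sup_adherent e0 supA.
have us : u <= sup A by apply: ub_le_sup => //; case: supA.
have [/andP[au ub] Qau] := Au.
(* This point lies beyond the supremum unless it is [b]; as it belongs to [A], it must be [b]. *)
pose c := Num.min b (sup A + e / 2).
have uc : u <= c by rewrite le_min ub /=; lra.
have cb : c <= b by rewrite ge_min lexx.
have ce : c <= sup A + e / 2 by rewrite ge_min lexx orbT.
have Quc : Q u c by apply: eQ => //; lra.
have Qac := Qcat _ _ _ (lexx a) au uc cb Qau Quc.
have Ac : A c by split => //; rewrite cb andbT; lra.
have cs : c <= sup A by apply: ub_le_sup => //; case: supA.
by have <- : c = b by move: cs; rewrite /c; case: (leP b (sup A + e / 2)) => //;
  lra.
Qed.

Lemma near_itv {R : realType} (P : set R) (t : R) : nbhs t P ->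
  exists2 e, 0 < e & forall x, t - e < x -> x < t + e -> P x.
Proof.
move=> /nbhs_ballP[e e0 eP]; exists e => // x xt tx; apply: eP.
by rewrite /ball /= ltr_norml; lra.
Qed.

Section LocalSystem.
Context {R : realType} {T : topologicalType} {G : groupType} {Lab : Type}.
Variables (U : Lab -> set T) (kap : Lab -> T -> G).
Hypothesis U_open : forall l, open (U l).
Hypothesis U_cover : forall y, exists l, U l y.
Hypothesis kap_loc : forall l m y, U l y -> U m y ->
  \forall z \near y, ((kap l z)^-1 * kap m z = (kap l y)^-1 * kap m y)%g.
Implicit Types p q : R -> T.

(* [kap l] plays the role of a parallel section over [U l], so [hol p a b g]
   says that [g] is the transport along [p] from [a] to [b]. *)
Inductive hol p : R -> R -> G -> Prop :=
| hol_in l a b : a <= b -> (forall t, a <= t -> t <= b -> U l (p t)) ->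
    hol p a b (kap l (p a) * (kap l (p b))^-1)%g
| hol_cat a b c g h : hol p a b g -> hol p b c h -> hol p a c (g * h)%g.

Lemma hol_le p a b g : hol p a b g -> a <= b.
Proof. by elim=> // {}a {}b c _ _ _ ab _ bc; exact: le_trans bc. Qed.

Lemma U_near p l t : continuous p -> U l (p t) ->
  exists2 e, 0 < e & forall x, t - e < x -> x < t + e -> U l (p x).
Proof.
move=> cp Ut; apply: near_itv; apply: (cp t).
by apply: open_nbhs_nbhs; split; [exact: U_open|].
Qed.

(** Along [p] the transition element from [l] to [m] is locally constant on an interval, hence
    constant. *)
Lemma kap_cst p l m a b : continuous p -> a <= b ->
  (forall t, a <= t -> t <= b -> U l (p t)) ->
  (forall t, a <= t -> t <= b -> U m (p t)) ->
  ((kap l (p a))^-1 * kap m (p a) = (kap l (p b))^-1 * kap m (p b))%g.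
Proof.
move=> cp ab Ul Um.
apply: (@cousin _ (fun x y =>
  ((kap l (p x))^-1 * kap m (p x) = (kap l (p y))^-1 * kap m (p y))%g)) => //.
  by move=> x y z _ _ _ _ ->.
move=> t at_ tb.
have := kap_loc (Ul _ at_ tb) (Um _ at_ tb) => /(cp t)/near_itv[e e0 eE].
by exists e => // x y ax xy yb tx yt; rewrite !eE //; lra.
Qed.

(** Each piece of a derivation may use its own label; constancy of the transition elements rewrites
    every piece with [l], and the inner factors cancel. *)
Lemma hol_inE p l a b g : continuous p -> hol p a b g ->
  (forall t, a <= t -> t <= b -> U l (p t)) ->
  g = (kap l (p a) * (kap l (p b))^-1)%g.
Proof.
move=> cp; elim=> [m {}a {}b ab Um|{}a {}b c {}g h gab IHg hbc IHh] Ul.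
  have := kap_cst cp ab Um Ul.
  by move=> /(congr1 (fun u => kap m (p a) * u * (kap l (p b))^-1)%g);
    rewrite mulgA mulgV mul1g -!mulgA mulgV mulg1.
have ab := hol_le gab; have bc := hol_le hbc.
rewrite IHg => [|t ta tb]; last by apply: Ul => //; lra.
rewrite IHh => [|t ta tb]; last by apply: Ul => //; lra.
by rewrite -mulgA mulKg.
Qed.

Lemma hol_split p a b c g : hol p a c g -> a <= b -> b <= c ->
  exists g1 g2, [/\ hol p a b g1, hol p b c g2 & g = (g1 * g2)%g].
Proof.
move=> h; elim: h b =>
  [l {}a {}c ac Ul|{}a u {}c {}g h gau IHg huc IHh] b ab bc.
  exists (kap l (p a) * (kap l (p b))^-1)%g, (kap l (p b) * (kap l (p c))^-1)%g.
  split; last by rewrite -mulgA mulKg.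
  - by apply: hol_in => // t ta tb; apply: Ul => //; lra.
  - by apply: hol_in => // t ta tb; apply: Ul => //; lra.
have [bu|ub] := leP b u.
  have [g1 [g2 [h1 h2 ->]]] := IHg _ ab bu.
  by exists g1, (g2 * h)%g; split; [|exact: hol_cat huc|rewrite mulgA].
have [g1 [g2 [h1 h2 ->]]] := IHh _ (ltW ub) bc.
by exists (g * g1)%g, g2; split; [exact: hol_cat h1| |rewrite mulgA].
Qed.

(** The second derivation is split at the cut points of the first, which leaves pieces lying in one
    set. *)
Lemma hol_uniq p a b g h : continuous p -> hol p a b g -> hol p a b h -> g = h.
Proof.
move=> cp hg; elim: hg h =>
  [l {}a {}b ab Ul|{}a {}b c {}g g' hg IHg hg' IHg'] h.
  by move=> hh; rewrite (hol_inE cp hh Ul).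
move=> hh; have [h1 [h2 [/IHg -> /IHg' -> ->]]] // :=
  hol_split hh (hol_le hg) (hol_le hg').
Qed.

Lemma hol_ex p a b : continuous p -> a <= b -> exists g, hol p a b g.
Proof.
move=> cp ab; apply: (cousin (Q := fun x y => exists g, hol p x y g)) => //.
  by move=> x y z _ _ _ _ [g hg] [h hh]; exists (g * h)%g; exact: hol_cat hh.
move=> t _ _; have [l Ut] := U_cover (p t).
have [e e0 eU] := U_near cp Ut; exists e => // x y _ xy _ tx yt.
by eexists; apply: (hol_in (l := l)) => // u xu uy; apply: eU; lra.
Qed.

Lemma hol_reparam p q (m n a b : R) g : 0 < m -> hol p a b g ->
  (forall t, a <= t -> t <= b -> q (m * t + n) = p t) ->
  hol q (m * a + n) (m * b + n) g.
Proof.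
move=> m0; elim=> [l {}a {}b ab Ul|{}a {}b c {}g g' hg IHg hg' IHg'] E.
  rewrite -(E a) // -(E b) //; apply: hol_in => [|t ta tb].
    by rewrite lerD2r ler_pM2l.
  have -> : t = m * ((t - n) / m) + n by field; exact: lt0r_neq0.
  have ma : a <= (t - n) / m by rewrite ler_pdivlMr //; lra.
  have mb : (t - n) / m <= b by rewrite ler_pdivrMr //; lra.
  by rewrite E //; exact: Ul.
have := hol_le hg; have := hol_le hg' => bc ab.
by apply: (hol_cat (b := m * b + n)); [apply: IHg|apply: IHg'] => t ta tb;
  apply: E => //; lra.
Qed.

(** Homotopy invariance, locally in the homotopy parameter: nearby rows are covered by the same
    chain of sets, and the transition elements at the cut points do not vary. *)
Lemma hol_row_loc (H : R * R -> T) (s0 : R) (x y : T) : continuous H ->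
  (forall s, H (s, 0) = x) -> (forall s, H (s, 1) = y) ->
  exists2 e, 0 < e & exists g, forall s, s0 - e < s -> s < s0 + e ->
    hol (fun t => H (s, t)) 0 1 g.
Proof.
move=> cH Hx Hy.
(* The inner cut points move with [s]. Keeping the gauges at both ends explicit isolates a middle
   factor [g] independent of [s]; at 0 and 1 the ends are fixed, and so is the whole product. *)
pose Q a b := exists2 e, 0 < e & exists g l m, forall s, s0 - e < s ->
  s < s0 + e ->
  [/\ U l (H (s, a)), U m (H (s, b)) &
  hol (fun t => H (s, t)) a b (kap l (H (s, a)) * g * (kap m (H (s, b)))^-1)%g].
suff [e e0 [g [l [m E]]]] : Q 0 1.
  exists e => //; exists (kap l x * g * (kap m y)^-1)%g => s s1 s2.
  by have [_ _] := E s s1 s2; rewrite Hx Hy.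
apply: cousin => //.
  move=> a b c _ ab bc _ [e e0 [g [l [m E]]]] [f f0 [h [l' [m' F]]]].
  have cb : continuous (fun s => H (s, b)).
    apply: (cont_comp _ cH); apply: cont_pair; last exact: cont_cst.
    by move=> ?; exact: cvg_id.
  have s0e : s0 - e < s0 < s0 + e by lra.
  have s0f : s0 - f < s0 < s0 + f by lra.
  case/andP: s0e => /E{}/[apply] -[_ Um _].
  case/andP: s0f => /F{}/[apply] -[Ul' _ _].
  (* The transition element [k] at the common cut point is constant for [s] near [s0], and joins the
     middle factor. *)
  have := kap_loc Um Ul' => /(cb s0)/near_itv[d d0 D].
  set k := ((kap m _)^-1 * _)%g in D.
  exists (Num.min d (Num.min e f)); first by rewrite !lt_min d0 e0.
  exists (g * k * h)%g, l, m' => s s1 s2.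
  have [de ee fe] : [/\ Num.min d (Num.min e f) <= d,
     Num.min d (Num.min e f) <= e & Num.min d (Num.min e f) <= f].
    by rewrite !ge_min !lexx !orbT.
  have [||U1 U2 hg] := E s; [lra|lra|].
  have [||U3 U4 hh] := F s; [lra|lra|].
  split => //; rewrite -(D s); [|lra|lra].
  have := hol_cat hg hh; congr (hol _ _ _ _); by rewrite !mulgA.
move=> t _ _; have [l Ut] := U_cover (H (s0, t)).
have : nbhs (s0, t) (H @^-1` U l).
  by apply: cH; apply: open_nbhs_nbhs; split; [exact: U_open|].
case=> -[A B] /= [/near_itv[e e0 eA] /near_itv[f f0 fB] AB].
exists f => // a b _ ab _ ta bt; exists e => //; exists 1%g, l, l => s s1 s2.
have UH u : a <= u -> u <= b -> U l (H (s, u)).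
  move=> au ub; apply: (AB (s, u)); split => /=; first exact: eA.
  by apply: fB; lra.
split; [exact: UH|exact: UH|].
by rewrite mulg1; exact: (@hol_in (fun t => H (s, t))).
Qed.

Local Notation path x y := {path (unit_itv R) from x to y}.

Lemma hol_homotopic x y (p q : path x y) g : path_homotopic p q ->
  hol (ext p) 0 1 g -> hol (ext q) 0 1 g.
Proof.
move=> [K [cK K0 K1 Kx Ky]] hp.
pose H (u : R * R) := K (to_unit_itv u.1, to_unit_itv u.2).
have cH : continuous H.
  apply: (cont_comp _ cK); apply: cont_pair.
  - by apply: cont_comp; [exact: cont_fst|exact: continuous_to_unit_itv].
  - by apply: cont_comp; [exact: cont_snd|exact: continuous_to_unit_itv].
have c1 s : continuous (fun t => H (s, t)).
  apply: (cont_comp _ cH); apply: cont_pair; first exact: cont_cst.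
  by move=> ?; exact: cvg_id.
have Hp : ext p = fun t => H (0, t) by apply/funext => t; rewrite /H K0.
have Hq : ext q = fun t => H (1, t) by apply/funext => t; rewrite /H K1.
rewrite Hq; rewrite Hp in hp.
(* Here the interval is the range of the homotopy parameter; an implication between rows is what
   concatenates. *)
apply: (@cousin _ (fun s s' => hol (fun t => H (s, t)) 0 1 g ->
  hol (fun t => H (s', t)) 0 1 g) 0 1) => //.
  by move=> s1 s2 s3 _ _ _ _ h1 h2 /h1/h2.
move=> s0 _ _; have [||e e0 [h E]] := @hol_row_loc H s0 x y cH.
- by move=> s; exact: Kx.
- by move=> s; exact: Ky.
exists e => // s s' _ ss' _ s1 s2 hs.
rewrite (hol_uniq (c1 s) hs (E s _ _)); [|lra|lra].
by apply: E; lra.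
Qed.

(** By [hol_ex] and [hol_uniq] exactly one such [g] exists, so the default 1 does not interfere. *)
Definition transport x y (a : @hom R T x y) : G :=
  xget 1%g [set g | hol (ext (repr a)) 0 1 g].

Lemma transportE x y (p : path x y) g :
  hol (ext p) 0 1 g -> transport (pcl p) = g.
Proof.
move=> hg; rewrite /transport; set r := repr _.
have pr : path_homotopic p r by apply/pclP; rewrite /r pcl_repr.
have hr := hol_homotopic pr hg.
by case: xgetP => [h _ /= hh|/(_ g)//];
  exact: (hol_uniq (ext_continuous r) hh hr).
Qed.

Lemma transport_in x y (p : path x y) l : (forall t, U l (p t)) ->
  transport (pcl p) = (kap l x * (kap l y)^-1)%g.
Proof.
move=> Up; apply: transportE.
by have := @hol_in (ext p) l 0 1 ler01; rewrite ext0 ext1; apply=> t _ _;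
  exact: Up.
Qed.

Lemma transportM x y z (a : @hom R T x y) (b : hom y z) :
  transport (a ** b) = (transport a * transport b)%g.
Proof.
rewrite -(pcl_repr a) -(pcl_repr b) comp_pcl.
move: (repr a) (repr b) => p q.
have [g hg] := hol_ex (ext_continuous p) (@ler01 R).
have [h hh] := hol_ex (ext_continuous q) (@ler01 R).
rewrite (transportE hg) (transportE hh); apply: transportE.
apply: (@hol_cat _ 0 2^-1).
- have := @hol_reparam (ext p) (ext (cat_path p q)) 2^-1 0 0 1 g.
  rewrite mulr0 mulr1 !addr0; apply; rewrite ?invr_gt0 // => t t0 t1.
  rewrite /ext cat_pathE to_unit_itvK; last lra.
  by rewrite ifT; [congr (p (to_unit_itv _)); field|lra].
- have := @hol_reparam (ext q) (ext (cat_path p q)) 2^-1 2^-1 0 1 h.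
  rewrite mulr0 mulr1 add0r (_ : 2^-1 + 2^-1 = 1); last by field.
  apply; rewrite ?invr_gt0 // => t t0 t1; rewrite /ext cat_pathE to_unit_itvK;
    last lra.
  case: ifP => tle; last by congr (q (to_unit_itv _)); field.
  have -> : t = 0 by lra.
  rewrite mulr0 add0r mulfV ?pnatr_eq0 // -/(ext p 1) ext1.
  by rewrite -/(ext q 0) ext0.
Qed.

Lemma transport1 x : transport (pcl (cst_path R x)) = 1%g.
Proof.
by apply: (@mulgI _ (transport (pcl (cst_path R x))));
  rewrite -transportM comp1p mulg1.
Qed.

Lemma transportV x y (a : @hom R T x y) : transport (inv a) = (transport
  a)^-1%g.
Proof. by apply: (@mulgI _ (transport a));
  rewrite -transportM comppV transport1 mulgV. Qed.

End LocalSystem.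

(** * Invariance and generation of the fundamental group *)

Lemma group_isomorphicP (G H : groupType) (f : G -> H) :
  {morph f : x y / (x * y)%g} -> bijective f -> group_isomorphic G H.
Proof.
move=> fM bf; pose fMul := isMultiplicative.Build G H f fM.
by pose F : {multiplicative G -> H} := HB.pack f fMul; exists F.
Qed.

Lemma group_isomorphic_trans (G H K : groupType) :
  group_isomorphic G H -> group_isomorphic H K -> group_isomorphic G K.
Proof.
move=> [f bf] [g bg]; apply: (@group_isomorphicP _ _ (g \o f)).
  by move=> x y /=; rewrite !gmulfM.
exact: bij_comp.
Qed.

Section Pi1.
Context {R : realType} {T : topologicalType} (x : T).
Local Notation pi1 := (fundamental_group R x).
Local Notation path x y := {path (unit_itv R) from x to y}.

(** The fundamental group and the endomorphisms in the groupoid are distinct quotient types for the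
    same relation; this map and the next identify them. *)
Definition pi1_hom (a : hom x x) : pi1 := \pi_(fundamental_group R x) (repr a).
Definition hom_pi1 (g : pi1) : hom x x := pcl (repr g : path x x).

Lemma pi1_pcl (p : path x x) : pi1_hom (pcl p) = \pi_(fundamental_group R x) p.
Proof. by apply/pi_loopP/pclP; rewrite pcl_repr. Qed.

Lemma pi1_homK : cancel pi1_hom hom_pi1.
Proof.
move=> a; rewrite -[RHS]pcl_repr; apply/pclP/pi_loopP.
by rewrite reprK.
Qed.

Lemma hom_pi1K : cancel hom_pi1 pi1_hom.
Proof. by move=> g; rewrite /hom_pi1 pi1_pcl reprK. Qed.

Lemma pi1_homM (a b : hom x x) : (pi1_hom a * pi1_hom b)%g = pi1_hom (a ** b).
Proof.
rewrite -(pcl_repr a) -(pcl_repr b) comp_pcl !pi1_pcl.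
exact: fundamental_group_mulE.
Qed.

Lemma hom_pi1M (a b : pi1) : hom_pi1 (a * b)%g = hom_pi1 a ** hom_pi1 b.
Proof. by rewrite -[LHS]pi1_homK hom_pi1K -[RHS]pi1_homK -pi1_homM !hom_pi1K.
  Qed.

Lemma pi1_hom1 : pi1_hom (pcl (cst_path R x)) = 1%g.
Proof.
by apply: (@mulgI _ (pi1_hom (pcl (cst_path R x))));
  rewrite pi1_homM comp1p mulg1.
Qed.

End Pi1.

Section Pi1Invariance.
Context {R : realType} {X Y : topologicalType}.
Local Notation path x y := {path (unit_itv R) from x to y}.

Section MapPath.
Variables (f : X -> Y) (cf : continuous f) (x y : X) (x' y' : Y).
Hypotheses (fx : f x = x') (fy : f y = y').
Variable p : path x y.

Fact map_path_continuous : continuous (f \o p).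
Proof. by apply: cont_comp cf; exact: cts_fun. Qed.

Fact map_path_zero : (f \o p) zero = x'.
Proof. by rewrite /= path_zero. Qed.

Fact map_path_one : (f \o p) one = y'.
Proof. by rewrite /= path_one. Qed.

Definition map_path : path x' y' :=
  mk_path map_path_continuous map_path_zero map_path_one.

Lemma map_pathE t : map_path t = f (p t).
Proof. by []. Qed.

End MapPath.

Lemma map_homotopic (f : X -> Y) (x y : X) (x' y' : Y) (p q : path x y)
    (p' q' : path x' y') : continuous f ->
  (forall t, p' t = f (p t)) -> (forall t, q' t = f (q t)) ->
  path_homotopic p q -> path_homotopic p' q'.
Proof.
move=> cf pE qE [H [cH H0 H1 Hx Hy]]; exists (f \o H); split.
- exact: cont_comp cf.
- by move=> t; rewrite /= H0 -pE.
- by move=> t; rewrite /= H1 -qE.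
- by move=> s; rewrite /= Hx -(@path_zero _ _ _ _ p') pE path_zero.
- by move=> s; rewrite /= Hy -(@path_one _ _ _ _ p') pE path_one.
Qed.

End Pi1Invariance.

(** Conjugation by [c] builds a change of base point into the invariance under homeomorphisms; with
    identity maps it is a change of base point alone. *)
Lemma pi1_homeo {R : realType} (X Y : topologicalType) (f : X -> Y)
    (g : Y -> X) (x : X) (y : Y) (c : {path (unit_itv R) from f x to y}) :
  continuous f -> continuous g -> cancel f g -> cancel g f ->
  group_isomorphic (fundamental_group R x) (fundamental_group R y).
Proof.
move=> cf cg fK gK.
pose hf (a : @hom R X x x) : @hom R Y (f x) (f x) :=
  pcl (map_path cf (erefl (f x)) (erefl (f x)) (repr a)).
have hfE (p : {path (unit_itv R) from x to x}) : hf (pcl p) = pcl (map_path cf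
  (erefl (f x)) (erefl (f x)) p).
  apply/pclP; apply: (map_homotopic cf) => // ; by apply/pclP; rewrite pcl_repr.
have hfM a b : hf (a ** b) = hf a ** hf b.
  rewrite -(pcl_repr a) -(pcl_repr b) comp_pcl !hfE comp_pcl.
  by apply: pcl_eq1 => t; rewrite map_pathE !cat_pathE; case: ifP.
pose F (a : fundamental_group R x) :=
  pi1_hom (inv (pcl c) ** hf (hom_pi1 a) ** pcl c).
apply: (@group_isomorphicP _ _ F).
  move=> a b; rewrite /F pi1_homM hom_pi1M hfM !compA.
  by rewrite -(compA _ _ (inv (pcl c))) comppV compp1.
rewrite -setTT_bijective; split => //.
- move=> a b _ _ /(can_inj (@pi1_homK R Y y)) E.
  apply: (can_inj (@hom_pi1K R X x)).
  have {E} : hf (hom_pi1 a) = hf (hom_pi1 b).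
    have conjK (u : @hom R Y (f x) (f x)) :
        pcl c ** (inv (pcl c) ** u ** pcl c) ** inv (pcl c) = u.
      by rewrite !compA comppV comp1p -compA comppV compp1.
    by rewrite -[LHS]conjK E conjK.
  rewrite !hfE => /pclP E; apply/pclP; apply: (map_homotopic cg) E => t.
  + by rewrite map_pathE fK.
  + by rewrite map_pathE fK.
- move=> b _; pose q := repr (pcl c ** hom_pi1 b ** inv (pcl c)).
  exists (pi1_hom (pcl (map_path cg (fK x) (fK x) q))) => //.
  rewrite /F pi1_homK hfE.
  have -> : pcl (map_path cf (erefl (f x)) (erefl (f x))
      (map_path cg (fK x) (fK x) q)) = pcl q.
    by apply: pcl_eq1 => t; rewrite !map_pathE gK.
  rewrite /q pcl_repr !compA compVp comp1p -compA compVp compp1.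
  exact: hom_pi1K.
Qed.

(** * Loops through pairs of sets of a cover *)

Section Edges.
Context {R : realType} {T : topologicalType} {Lab : Type}.
Variables (x0 : T) (U : Lab -> set T).
Local Notation path x y := {path (unit_itv R) from x to y}.
Hypothesis U_open : forall l, open (U l).
Hypothesis U_cover : forall y, exists l, U l y.
Hypothesis U_base : forall l, U l x0.
Hypothesis U_conn : forall l y, U l y ->
  exists p : path x0 y, forall t, U l (p t).
Hypothesis U_simply : forall l y (p q : path x0 y),
  (forall t, U l (p t)) -> (forall t, U l (q t)) -> pcl p = pcl q.

(* Independent of [p] and [q] when [y] lies in both sets, by [edgeE]; the
   junk value 1 otherwise. *)
Definition edge (l m : Lab) (y : T) : fundamental_group R x0 :=
  xget 1%g [set g | exists p q : path x0 y, [/\ forall t, U l (p t),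
    forall t, U m (q t) & g = pi1_hom (pcl p ** inv (pcl q))]].

Lemma edgeE l m y (p q : path x0 y) :
  (forall t, U l (p t)) -> (forall t, U m (q t)) ->
  edge l m y = pi1_hom (pcl p ** inv (pcl q)).
Proof.
move=> Up Uq; rewrite /edge; case: xgetP => [g _ [p' [q' [Up' Uq' ->]]]|].
  by rewrite (U_simply Up' Up) (U_simply Uq' Uq).
by move=> /(_ (pi1_hom (pcl p ** inv (pcl q))))[]; exists p, q.
Qed.

Lemma edgeM l m n y : U l y -> U m y -> U n y ->
  (edge l m y * edge m n y)%g = edge l n y.
Proof.
move=> /U_conn[p Up] /U_conn[q Uq] /U_conn[r Ur].
rewrite (edgeE Up Uq) (edgeE Uq Ur) (edgeE Up Ur) pi1_homM compA.
by rewrite -(compA (pcl p)) compVp compp1.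
Qed.

Lemma edge_base l m : edge l m x0 = 1%g.
Proof.
rewrite (@edgeE l m x0 (cst_path R x0) (cst_path R x0)) => [|t|t].
- by rewrite comppV pi1_hom1.
- exact: U_base.
- exact: U_base.
Qed.

Lemma cat_path_in (V : set T) x y z (p : path x y) (q : path y z) :
  (forall t, V (p t)) -> (forall t, V (q t)) -> forall t, V (cat_path p q t).
Proof. by move=> Vp Vq t; rewrite cat_pathE; case: ifP. Qed.

(** Both legs may be prolonged by [r], which then cancels in the middle. *)
Lemma edge_path l m y z (r : path y z) : (forall t, U l (r t)) ->
  (forall t, U m (r t)) -> edge l m y = edge l m z.
Proof.
move=> Ul Um.
have /U_conn[p Up] : U l y by rewrite -(@path_zero _ _ _ _ r).
have /U_conn[q Uq] : U m y by rewrite -(@path_zero _ _ _ _ r).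
rewrite (edgeE Up Uq) (edgeE (cat_path_in Up Ul) (cat_path_in Uq Um)).
by rewrite -!comp_pcl comp_inv compA -(compA (pcl p)) comppV compp1.
Qed.

(** A leg [h] inside [U n] to the start of the piece, and its prolongation along the piece, are the
    legs inserted between [f] and [g]. *)
Lemma seg_edge l m n (p : R -> T) (cp : continuous p) a b y z (pa : p a = y)
    (pb : p b = z) (f : path x0 y) (g : path x0 z) : a <= b ->
  (forall t, a <= t -> t <= b -> U n (p t)) ->
  (forall t, U l (f t)) -> (forall t, U m (g t)) ->
  pi1_hom (pcl f ** pcl (seg cp pa pb) ** inv (pcl g)) =
  (edge l n y * edge n m z)%g.
Proof.
move=> ab Un Uf Ug.
have /U_conn[h Uh] : U n y by rewrite -pa; exact: Un.
have Us t : U n (seg cp pa pb t).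
  have /andP[t0 t1] := unit_itvP t; rewrite segE; apply: Un.
    by rewrite lerDl mulr_ge0 // subr_ge0.
  by rewrite -lerBrDl ler_piMr // subr_ge0.
rewrite (edgeE Uf Uh) (edgeE (cat_path_in Uh Us) Ug) pi1_homM -comp_pcl !compA.
by rewrite -(compA (pcl f) _ (pcl h)) compVp compp1.
Qed.

(** A loop is cut into pieces lying in one set each; legs to the base point inserted at the cuts
    turn every piece into a product of two edges. *)
Theorem pi1_edge_ind (S : set (fundamental_group R x0)) :
  (forall g h, S g -> S h -> S (g * h)%g) ->
  (forall l m y, U l y -> U m y -> S (edge l m y)) ->
  forall g, S g.
Proof.
move=> SM Se g; rewrite -(hom_pi1K g) /hom_pi1; move: (repr g) => p.
pose cp := ext_continuous p.
(* All legs at both ends are allowed, so two adjacent pieces can be given the same leg at their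
   common point. *)
pose Q a b := forall l m y z (pa : ext p a = y) (pb : ext p b = z)
  (f : path x0 y) (h : path x0 z), (forall t, U l (f t)) ->
  (forall t, U m (h t)) ->
  S (pi1_hom (pcl f ** pcl (seg cp pa pb) ** inv (pcl h))).
have : Q 0 1.
  apply: cousin => //.
    move=> a b c _ ab bc _ Qab Qbc l m y z pa pc f h Uf Uh.
    have [n Un] := U_cover (ext p b).
    have [k Uk] := U_conn Un.
    have := SM _ _ (Qab _ _ _ _ pa erefl _ _ Uf Uk)
      (Qbc _ _ _ _ erefl pc _ _ Uk Uh).
    rewrite pi1_homM !compA -(compA _ _ (pcl k)) compVp compp1.
    by rewrite -(compA (pcl f)) seg_comp.
  move=> t _ _; have [n Un] := U_cover (ext p t).
  have [e e0 eU] := U_near U_open cp Un.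
  exists e => // a b _ ab _ ta bt l m y z pa pb f h Uf Uh.
  have U_ab u : a <= u -> u <= b -> U n (ext p u).
    by move=> au ub; apply: eU; lra.
  rewrite (seg_edge cp pa pb ab U_ab Uf Uh); apply: SM; apply: Se.
  - by rewrite -(@path_one _ _ _ _ f).
  - by rewrite -pa; exact: U_ab.
  - by rewrite -pb; exact: U_ab.
  - by rewrite -(@path_one _ _ _ _ h).
have [n _] := U_cover x0.
have Ucst t : U n (cst_path R x0 t) by exact: U_base.
move=> /(_ n n _ _ (ext0 p) (ext1 p) _ _ Ucst Ucst).
by rewrite /cp -seg_ext comp1p -[inv _]comp1p comppV compp1.
Qed.

Lemma transport_edge (G : groupType) (kap : Lab -> T -> G) :
  (forall l m y, U l y -> U m y ->
    \forall z \near y, ((kap l z)^-1 * kap m z = (kap l y)^-1 * kap m y)%g) ->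
  forall l m y, U l y -> U m y ->
  transport U kap (hom_pi1 (edge l m y)) =
    (kap l x0 * (kap l y)^-1 * (kap m y * (kap m x0)^-1))%g.
Proof.
move=> kap_loc l m y /U_conn[p Up] /U_conn[q Uq].
rewrite (edgeE Up Uq) pi1_homK transportM // transportV //.
rewrite (transport_in U_open U_cover kap_loc Up).
by rewrite (transport_in U_open U_cover kap_loc Uq) invgM invgK.
Qed.

End Edges.

(** * Free groups and the relations around double points *)

Section FreeLift.
Context {X : choiceType} {G : groupType}.
Implicit Types (h : X -> G) (u v : word X).

Definition free_gen (x : X) : free_group X := \pi_(free_group X) [:: (x, true)].

Definition word_eval h u : G :=
  \big[*%g/1%g]_(a <- u) (if a.2 then h a.1 else (h a.1)^-1%g).

Lemma word_eval_cat h u v : word_eval h (u ++ v) = (word_eval h u * word_eval h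
  v)%g.
Proof. exact: big_cat. Qed.

Lemma word_eval_equiv h u v : word_equiv u v -> word_eval h u = word_eval h v.
Proof.
elim=> [_ _ [{}u x b {}v]|//|{}u {}v _ -> //|u1 u2 u3 _ -> _ -> //].
rewrite !word_eval_cat /word_eval !big_cons /=; congr (_ * _)%g.
by case: b => /=; rewrite (mulVKg, mulKg).
Qed.

Definition free_lift h (a : free_group X) : G := word_eval h (repr a).

Lemma free_lift_pi h u : free_lift h (\pi_(free_group X) u) = word_eval h u.
Proof. by apply: word_eval_equiv; apply/pi_wordP; rewrite reprK. Qed.

Lemma free_liftM h : {morph free_lift h : a b / (a * b)%g}.
Proof.
move=> a b; rewrite -(reprK a) -(reprK b) free_group_mulE !free_lift_pi.
exact: word_eval_cat.
Qed.

Lemma free_lift_gen h x : free_lift h (free_gen x) = h x.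
Proof. by rewrite free_lift_pi /word_eval big_seq1. Qed.

Lemma free_lift1 h : free_lift h 1%g = 1%g.
Proof. by apply: (@mulgI _ (free_lift h 1%g)); rewrite -free_liftM !mulg1. Qed.

Lemma free_lift_ind h (P : set G) : P 1%g ->
  (forall a b, P a -> P b -> P (a * b)%g) -> (forall a, P a -> P a^-1%g) ->
  (forall x, P (h x)) -> forall a, P (free_lift h a).
Proof.
by move=> P1 PM PV Ph a; apply: big_ind => // -[x b] _ /=; case: b; auto.
Qed.

End FreeLift.

Lemma free_lift_id (X : choiceType) (a : free_group X) :
  free_lift (@free_gen X) a = a.
Proof.
rewrite -(reprK a) free_lift_pi; move: (repr a) => u.
elim: u => [|[x b] u IHu].
  by rewrite /word_eval big_nil.
rewrite /word_eval big_cons -/(word_eval _ u) IHu /=.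
rewrite -[(x, b) :: u]cat1s -free_group_mulE; congr (_ * _)%g.
case: b => //; apply: (@mulgI _ (free_gen x)); rewrite mulgV /free_gen.
rewrite free_group_mulE; apply/esym/pi_wordP.
by apply: Relation_Operators.rst_step; exact: (Cancels [::] x true [::]).
Qed.

Lemma free_lift_comp (X : choiceType) (G H : groupType) (h : X -> G) (f : G ->
  H)
    (a : free_group X) : {morph f : x y / (x * y)%g} ->
  f (free_lift h a) = free_lift (f \o h) a.
Proof.
move=> fM; have f1 : f 1%g = 1%g.
  by apply: (@mulgI _ (f 1%g)); rewrite -fM !mulg1.
rewrite /free_lift /word_eval (big_morph f fM f1);
  apply: eq_bigr => -[x b] _ /=.
by case: b => //; apply: (@mulgI _ (f (h x))); rewrite -fM !mulgV.
Qed.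

(** [x] and [y] conjugate [c] to the same [d], so [x * y^-1] centralizes [c]. *)
Lemma intertwine_commute (G : groupType) (c d x y : G) :
  (c * x = x * d)%g -> (c * y = y * d)%g -> commute c (x * y^-1)%g.
Proof.
move=> cx cy; apply: (@mulIg _ y); rewrite mulgA cx -!mulgA mulVg mulg1 cy.
by rewrite mulKg.
Qed.

Lemma cancel_outer (G : groupType) (m n x y : G) :
  (m^-1 * ((m * x * n) * (m * y * n)^-1) * m = x * y^-1)%g.
Proof. by rewrite !invgM !mulgA mulVg mul1g mulgK mulgVK. Qed.

(** * Commutation forced by the relations of the chambers *)

Section Relations.
Context {G : groupType} (t : nat) (k : nat -> nat) (e f : nat -> nat -> G).
Variable Ch : (nat -> nat) -> Prop.

Definition upd1 (m : nat -> nat) (a p : nat) : nat -> nat :=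
  fun j => if j == a then p else m j.

Lemma upd1_eq m a p : upd1 m a p a = p.
Proof. by rewrite /upd1 eqxx. Qed.

Lemma upd1_neq m a p j : j != a -> upd1 m a p j = m j.
Proof. by rewrite /upd1 => /negbTE ->. Qed.

Local Notation "\prodg_ ( a <= j < b ) F" := (\big[*%g/1%g]_(a <= j < b) F%g)
  (at level 36, F at level 36, a, j, b at level 50).

Hypothesis Ch_le : forall m j, Ch m -> (j < t)%N -> (m j <= k j)%N.
Hypothesis Ch_rel : forall m, Ch m ->
  (\prodg_(0 <= j < t) e j (m j) * \prodg_(0 <= j < t) f j (m j) = 1)%g.
Hypothesis Ch_line : forall a p, (a < t)%N -> (p < k a)%N ->
  exists m, forall x : bool, Ch (upd1 m a (p + x)%N).
Hypothesis Ch_node : forall a b p q, (a < b)%N -> (b < t)%N ->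
  (p < k a)%N -> (q < k b)%N ->
  exists m, forall x y : bool, Ch (upd1 (upd1 m b (q + y)%N) a (p + x)%N).
Hypothesis e0 : forall j, (j < t)%N -> e j 0%N = 1%g.
Hypothesis f0 : forall j, (j < t)%N -> f j 0%N = 1%g.

(** The letters that stand between those of [e a] and [f a] in the relation of a chamber; the slab
    number [m a] does not occur in them. *)
Definition between (m : nat -> nat) (a : nat) : G :=
  (\prodg_(a.+1 <= j < t) e j (m j) * \prodg_(0 <= j < a) f j (m j))%g.

Lemma prod_split (F : nat -> G) a : (a < t)%N ->
  (\prodg_(0 <= j < t) F j =
   \prodg_(0 <= j < a) F j * F a * \prodg_(a.+1 <= j < t) F j)%g.
Proof.
move=> at_; rewrite (@big_cat_nat _ _ _ a) //=; last exact: ltnW.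
by rewrite (big_ltn (m := a)) // mulgA.
Qed.

(** The two relations have the same letters before [e a] and after [f a], and these cancel. *)
Lemma line_rel m a p q : (a < t)%N -> Ch (upd1 m a p) -> Ch (upd1 m a q) ->
  (e a p * between m a * f a p = e a q * between m a * f a q)%g.
Proof.
move=> at_ /Ch_rel + /Ch_rel.
have E (F : nat -> nat -> G) r : (\prodg_(0 <= j < t) F j (upd1 m a r j) =
    \prodg_(0 <= j < a) F j (m j) * F a r * \prodg_(a.+1 <= j < t) F j (m j))%g.
  rewrite (prod_split _ at_); congr (_ * _ * _)%g; last 1 first.
  - by apply: eq_big_nat => j jI; rewrite upd1_neq //; lia.
  - by apply: eq_big_nat => j jI; rewrite upd1_neq //; lia.
  - by rewrite upd1_eq.
rewrite !E => H1 H2; move: (etrans H1 (esym H2)).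
by rewrite -!mulgA => /mulgI; rewrite /between !mulgA => /mulIg.
Qed.

(* Two adjacent chambers on either side of a line of class [a] compare the
   increments of [e a] and [f a]; doing so on both sides of a line of class [b]
   crossing it yields a commutation relation. *)
Lemma node_comm a b p q : (a < b)%N -> (b < t)%N -> (p < k a)%N ->
  (q < k b)%N ->
  (forall j u v, (a < j)%N -> (j < b)%N -> (u <= k a)%N -> (v <= k j)%N ->
     commute (e a u) (e j v)) ->
  commute ((e a p.+1)^-1 * e a p)%g (e b q.+1 * (e b q)^-1)%g.
Proof.
move=> ab bt pk qk IH; have [m mCh] := Ch_node ab bt pk qk.
have at_ := ltn_trans ab bt.
set c := ((e a p.+1)^-1 * e a p)%g.
(* Conjugation by the middle word turns the increment [c] of [e a] into that of [f a], which is the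
   same on both sides of the line of class [b]. *)
have step (y : bool) : (c * between (upd1 m b (q + y)) a =
    between (upd1 m b (q + y)) a * (f a p.+1 * (f a p)^-1))%g.
  have := line_rel at_ (mCh false y) (mCh true y); rewrite addn0 addn1.
  move: (between _ _) => B E; rewrite /c; apply: (@mulgI _ (e a p.+1));
    rewrite !mulgA mulgV mul1g.
  by apply: (@mulIg _ (f a p)); rewrite E -!mulgA mulVg mulg1.
(* The middle word splits around its only letter of class [b]: [M] holds the classes strictly
   between [a] and [b], which commute with class [a] by [IH], and [N] cancels in the quotient of the
   two words. *)
pose M := (\prodg_(a.+1 <= j < b) e j (m j))%g.
pose N := (\prodg_(b.+1 <= j < t) e j (m j) * \prodg_(0 <= j < a) f j (m j))%g.
have QE (y : bool) : between (upd1 m b (q + y)) a = (M * e b (q + y) * N)%g.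
  rewrite /between (@big_cat_nat _ _ _ b) //=; last exact: ltnW.
  rewrite (big_ltn (m := b)) // upd1_eq -!mulgA.
  congr (_ * (_ * (_ * _)))%g;
    by apply: eq_big_nat => j jI; rewrite upd1_neq //; lia.
have cM : commute c M.
  rewrite /M big_nat; apply: commute_prod => j /andP[aj jb].
  have jk : (m j <= k j)%N.
    have := Ch_le (j := j) (mCh false false).
    by rewrite !upd1_neq; [apply; lia|lia|lia].
  apply/commute_sym/commuteM; last by apply: commute_sym; apply: IH => //; lia.
  by apply: commuteV; apply: commute_sym; apply: IH.
have := step false; have := step true; rewrite !QE addn0 addn1.
set A1 := (M * e b q.+1 * N)%g; set A0 := (M * e b q * N)%g => E1 E0.
have cA : commute c (A1 * A0^-1)%g.
  exact: intertwine_commute E1 E0.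
have -> : (e b q.+1 * (e b q)^-1 = M^-1 * (A1 * A0^-1) * M)%g.
  by rewrite cancel_outer.
by apply: commuteM => //; apply: commuteM => //; apply: commuteV.
Qed.

(** Strong induction on [b] supplies the commutation with the classes between [a] and [b]. The
    increments commute by [node_comm], and telescope from slab 0, where the letters are trivial. *)
Lemma commute_classes a b p q : (a < b)%N -> (b < t)%N ->
  (p <= k a)%N -> (q <= k b)%N -> commute (e a p) (e b q).
Proof.
elim/ltn_ind: b p q => b IHb p q ab bt pk qk.
have step u v : (u < k a)%N -> (v < k b)%N ->
    commute ((e a u.+1)^-1 * e a u)%g (e b v.+1 * (e b v)^-1)%g.
  move=> uk vk; apply: node_comm => // j u' v' aj jb uk' vk'.
  by apply: IHb => //; exact: ltn_trans bt.
have stepq v : (v < k b)%N -> commute (e a p) (e b v.+1 * (e b v)^-1)%g.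
  move=> vk; elim: p pk => [_|p IHp pk].
    by rewrite e0 ?(ltn_trans ab) //; apply/commute_sym/commute1.
  have -> : e a p.+1 = (e a p * ((e a p.+1)^-1 * e a p)^-1)%g.
    by rewrite invgM invgK mulVKg.
  apply/commute_sym/commuteM; first by apply/commute_sym/IHp/ltnW.
  by apply/commuteV/commute_sym/step.
elim: q qk => [_|q IHq qk]; first by rewrite e0 //; exact: commute1.
rewrite -[e b q.+1](mulgVK (e b q)).
by apply: commuteM; [exact: stepq|exact/IHq/ltnW].
Qed.

Lemma commute_classes_neq a b p q : a != b -> (a < t)%N -> (b < t)%N ->
  (p <= k a)%N -> (q <= k b)%N -> commute (e a p) (e b q).
Proof.
rewrite neq_ltn => /orP[ab|ba] at_ bt pk qk; first exact: commute_classes.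
by apply/commute_sym/commute_classes.
Qed.

(** By induction on [a], the letters of [f] in the middle word are inverses of letters of [e] of
    earlier classes, so the whole word commutes with class [a]. Then [e a p * f a p] does not depend
    on the slab, and it is 1 in slab 0. *)
Lemma second_half a p : (a < t)%N -> (p <= k a)%N -> f a p = (e a p)^-1%g.
Proof.
elim/ltn_ind: a p => a IHa p at_; elim: p => [_|p IHp pk].
  by rewrite e0 // f0 // invg1.
have [m mCh] := Ch_line at_ pk.
have mk j : (j < t)%N -> j != a -> (m j <= k j)%N.
  by move=> jt ja; have := Ch_le (mCh false) jt; rewrite upd1_neq.
have cB u : (u <= k a)%N -> commute (e a u) (between m a).
  move=> uk; rewrite /between !big_nat; apply: commuteM.
    apply: commute_prod => j /andP[aj jt]; apply: commute_classes => //.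
    by apply: mk => //; lia.
  apply: commute_prod => j ja; have jt : (j < t)%N by lia.
  have mjk : (m j <= k j)%N by apply: mk => //; lia.
  rewrite IHa //; apply/commuteV/commute_sym/commute_classes => //.
have := line_rel at_ (mCh false) (mCh true); rewrite addn0 addn1.
move: (between m a) cB => B cB.
rewrite cB ?(ltnW pk) // cB // -!mulgA => /mulgI.
rewrite IHp ?(ltnW pk) // mulgV => E.
by apply: (@mulgI _ (e a p.+1)); rewrite -E mulgV.
Qed.

End Relations.

(** * Recognizing a direct product of free groups *)

Lemma prodgM_commute_uniq (I : eqType) (G : groupType) (r : seq I) (F H : I ->
  G) :
  uniq r -> (forall i j, i != j -> commute (F i) (H j)) ->
  (\big[*%g/1]_(i <- r) (F i * H i) =
   \big[*%g/1]_(i <- r) F i * \big[*%g/1]_(i <- r) H i)%g.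
Proof.
move=> + FH; elim: r => [|x r IHr] /=; first by rewrite !big_nil mulg1.
move=> /andP[xr ur]; rewrite !big_cons IHr // -!mulgA; congr (_ * _)%g.
rewrite !mulgA; congr (_ * _)%g; rewrite big_seq_cond.
apply: commute_prod => i /andP[ir _]; apply: commute_sym; apply: FH.
by apply: contraNneq xr => <-.
Qed.

Lemma prodg_only (I : eqType) (G : groupType) (r : seq I) (F : I -> G) (j : I) :
  uniq r -> j \in r -> (forall i, i != j -> F i = 1%g) ->
  \big[*%g/1%g]_(i <- r) F i = F j.
Proof.
move=> + + F1; elim: r => //= x r IHr /andP[xr ur]; rewrite inE big_cons.
have [E _|jx /= jr] := eqVneq j x; last by rewrite IHr // F1 1?eq_sym // mul1g.
rewrite -E in xr *; rewrite big_seq big1 ?mulg1 // => i ir; apply: F1.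
by apply: contraNneq xr => <-.
Qed.

(** The lifts of the free groups commute with each other, so they multiply to a morphism [psi] from
    the product, onto by generation; the [phi j] together form a left inverse of it. *)
Theorem direct_product_decomposition (G : groupType) (t : nat) (k : nat -> nat)
    (e : nat -> nat -> G)
    (phi : forall j : 'I_t, G -> free_group 'I_(k j)) :
  (forall j, {morph phi j : x y / (x * y)%g}) ->
  (forall i j p q, i != j -> (i < t)%N -> (j < t)%N -> (p <= k i)%N ->
     (q <= k j)%N -> commute (e i p) (e j q)) ->
  (forall j, (j < t)%N -> e j 0%N = 1%g) ->
  (forall (i j : 'I_t) (o : 'I_(k i)), i != j -> phi j (e i o.+1) = 1%g) ->
  (forall (j : 'I_t) (o : 'I_(k j)), phi j (e j o.+1) = free_gen o) ->
  (forall S : set G, S 1%g -> (forall g h, S g -> S h -> S (g * h)%g) ->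
     (forall j p, (j < t)%N -> (p <= k j)%N -> S (e j p) /\ S (e j p)^-1%g) ->
     forall g, S g) ->
  group_isomorphic G (group_prod (fun j : 'I_t => free_group 'I_(k j))).
Proof.
move=> phiM ec e0 phi_ne phi_eq gen.
pose psi1 (j : 'I_t) (a : free_group 'I_(k j)) : G :=
  free_lift (fun o : 'I_(k j) => e j o.+1) a.
pose psi (h : group_prod (fun j : 'I_t => free_group 'I_(k j))) : G :=
  \big[*%g/1%g]_(j <- index_enum 'I_t) psi1 j (h j).
have phi1 j : phi j 1%g = 1%g.
  by apply: (@mulgI _ (phi j 1%g)); rewrite -phiM !mulg1.
have psi1c (i j : 'I_t) a b : i != j -> commute (psi1 i a) (psi1 j b).
  move=> ij; apply: (@free_lift_ind _ _ _ (fun u => commute u (psi1 j b))).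
  - by apply/commute_sym/commute1.
  - by move=> u v cu cv; apply/commute_sym/commuteM; exact: commute_sym.
  - by move=> u cu; apply/commute_sym/commuteV/commute_sym.
  move=> o; apply: (@free_lift_ind _ _ _ (commute (e i o.+1))).
  - exact: commute1.
  - by move=> u v cu cv; exact: commuteM.
  - by move=> u cu; exact: commuteV.
  - by move=> o'; apply: ec.
have psiM : {morph psi : x y / (x * y)%g}.
  move=> x y; rewrite /psi -prodgM_commute_uniq ?index_enum_uniq //.
    by apply: eq_bigr => j _; exact: free_liftM.
  by move=> i j ij; exact: psi1c.
have phi_psi1 (i j : 'I_t) a : i != j -> phi j (psi1 i a) = 1%g.
  move=> ij; rewrite free_lift_comp; last exact: phiM.
  apply: (@free_lift_ind _ _ _ (fun u => u = 1%g)) => //.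
  - by move=> u v -> ->; rewrite mulg1.
  - by move=> u ->; rewrite invg1.
  - by move=> o /=; exact: phi_ne.
have phiK : forall (i : 'I_t) (a : free_group 'I_(k i)), phi i (psi1 i a) = a.
  move=> j a; rewrite free_lift_comp; last exact: phiM.
  rewrite -[RHS]free_lift_id; congr free_lift.
  by apply/funext => o /=; exact: phi_eq.
pose Phi (g : G) : group_prod (fun j : 'I_t => free_group 'I_(k j)) :=
  fun j => phi j g.
have psiK : cancel psi Phi.
  move=> h; apply: functional_extensionality_dep => j; rewrite /Phi /psi.
  rewrite (big_morph (phi j) (phiM j) (phi1 j)) (@prodg_only _ _ _ _ j).
  - exact: phiK.
  - exact: index_enum_uniq.
  - exact: mem_index_enum.
  - by move=> i ij; exact: phi_psi1.
have psi_surj : forall g, exists h, g = psi h.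
  have psi1g : psi 1%g = 1%g.
    by rewrite /psi big1 // => j _; exact: free_lift1.
  have psiV h : (psi h)^-1%g = psi h^-1%g.
    by apply: (@mulgI _ (psi h)); rewrite -psiM !mulgV psi1g.
  apply: gen => [|_ _ [h ->] [h' ->]|j p jt pk].
  - by exists 1%g.
  - by exists (h * h')%g; rewrite psiM.
  - suff [h hE] : exists h, e j p = psi h.
      by split; [exists h|exists h^-1%g; rewrite -psiV hE].
    case: p pk => [_|p pk]; first by exists 1%g; rewrite e0 // psi1g.
    pose J := Ordinal jt; pose o : 'I_(k J) := Ordinal pk.
    (* The type of the generator depends on the coordinate; passing through the underlying number
       with [insub] avoids a cast along [i = J]. *)
    pose h : group_prod (fun j : 'I_t => free_group 'I_(k j)) := fun i =>
      if insub (o : nat) is Some o' then if i == J then free_gen o' else 1%g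
        else 1%g.
    exists h; rewrite /psi (@prodg_only _ _ _ _ J).
    + rewrite /h /psi1 eqxx valK; by rewrite free_lift_gen.
    + exact: index_enum_uniq.
    + exact: mem_index_enum.
    + move=> i iJ; rewrite /h /psi1 (negbTE iJ).
      by case: insubP => [? _ _|_]; rewrite free_lift1.
apply: (@group_isomorphicP _ _ Phi) => [x y|].
  by apply: functional_extensionality_dep => j; exact: phiM.
exists psi => // g; have [h ->] := psi_surj g; by rewrite psiK.
Qed.

Lemma group_prod_perm (I : finType) (F : I -> groupType) (s : I -> I) :
  injective s -> group_isomorphic (group_prod F) (group_prod (F \o s)).
Proof.
move=> s_inj; pose f (h : group_prod F) : group_prod (F \o s) :=
  fun i => h (s i).
apply: (@group_isomorphicP _ _ f) => //.
rewrite -setTT_bijective; split => //.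
- move=> x y _ _ E; apply: functional_extensionality_dep => i.
  have [s' sK s'K] := injF_bij s_inj; rewrite -(s'K i).
  exact: (congr1 (fun h => h (s' i)) E).
- move=> h _; have [s' sK s'K] := injF_bij s_inj.
  (* At an index [s i] the cast is along a proof of [s i = s i], hence trivial on a type with
     decidable equality. *)
  exists (fun i => ecast j (F j) (s'K i) (h (s' i))) => //.
  apply: functional_extensionality_dep => i; rewrite /f.
  move: (s'K (s i)); rewrite sK => E; by rewrite (eq_axiomK E).
Qed.

(** * Finiteness and paths in subspaces *)

Section FiniteBounds.
Context {R : realType}.
Implicit Type r : seq R.

Lemma seq_lower_bound r : exists2 d : R, 0 < d & forall x, x \in r -> 0 < x ->
  d <= x.
Proof.
elim: r => [|a r [d d0 dP]]; first by exists 1.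
have [a0|a0] := ltP 0 a; last first.
  exists d => // x; rewrite inE => /orP[/eqP -> |]; [lra|exact: dP].
exists (Num.min a d); first by rewrite lt_min a0.
by move=> x; rewrite inE ge_min => /orP[/eqP -> | /dP xd /xd ->];
  rewrite ?lexx ?orbT.
Qed.

Lemma seq_upper_bound r : exists K : R, forall x, x \in r -> x < K.
Proof.
elim: r => [|a r [K KP]]; first by exists 0.
exists (Num.max (a + 1) K) => x; rewrite inE lt_max => /orP[/eqP -> |/KP ->].
  by rewrite ltrDl ltr01.
by rewrite orbT.
Qed.

Lemma count_lt_nth r p : sorted <%R r -> (p < size r)%N ->
  count (fun c => c < nth 0 r p) r = p.
Proof.
elim: r p => [//|a r IHr] p /= ar.
have ra : all (fun c => a < c) r by apply: order_path_min ar; exact: lt_trans.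
have sr := path_sorted ar.
case: p => [_|p pr] /=.
  rewrite ltxx add0n; apply/eqP; rewrite -leqn0 leqNgt -has_count.
  by apply/hasPn => c /(allP ra) ac; rewrite -leNgt ltW.
have ap : a < nth 0 r p := allP ra _ (mem_nth 0 pr).
by rewrite IHr // ap.
Qed.

(** For [u <= v] the elements below [u] are among those below [v], so equal counts leave none in
    between. *)
Lemma count_lt_eq r (u v : R) : count (fun c => c < u) r = count (fun c =>
  c < v) r ->
  forall c, c \in r -> (c < u) = (c < v).
Proof.
wlog uv : u v / u <= v => [W|].
  have [/W//|/ltW /W H] := leP u v.
  by move=> /esym/H{}H c /H.
move=> E c cr; apply/idP/idP => [cu|cv]; first exact: lt_le_trans uv.
apply: contraT => cu;
  suff : (count (fun c => (c < u)%R) r < count (fun c => (c < v)%R) r)%N.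
  by rewrite E ltnn.
elim: r cr {E} => //= a r IHr; rewrite inE => /orP[/eqP <-|/IHr{}IHr].
  rewrite cv (negbTE cu) add0n add1n ltnS; apply: sub_count => x /= xu.
  exact: lt_le_trans uv.
have au : ((a < u)%R <= (a < v)%R)%N by case: ltP => // /lt_le_trans ->.
by lia.
Qed.

End FiniteBounds.

Lemma near_all (T : Type) (F : set_system T) {FF : Filter F} (I : eqType)
    (r : seq I) (P : I -> T -> Prop) :
  (forall i, i \in r -> \forall z \near F, P i z) ->
  \forall z \near F, forall i, i \in r -> P i z.
Proof.
elim: r => [|a r IHr] H; first by apply: filterE => z i.
have [Ha Hr] : (\forall z \near F, P a z) /\
    (\forall z \near F, forall i, i \in r -> P i z).
  by split; [apply: H; rewrite mem_head|apply: IHr => i ir; apply: H;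
    rewrite inE ir orbT].
by apply: filterS2 Ha Hr => z Pa Pr i; rewrite inE => /orP[/eqP ->|/Pr].
Qed.

Lemma near_side {R : realType} (T : topologicalType) (f : T ->
  R) (z : T) (c : R) :
  continuous f -> f z != c ->
  \forall z' \near z, f z' != c /\ (c < f z') = (c < f z).
Proof.
move=> cf; rewrite neq_lt => /orP[fc|cf'].
  have /filterS : \forall z' \near z, f z' < c by exact: cvgr_lt (cf z) _ fc.
  by apply => z' fz'; rewrite lt_eqF //; split=> //;
    rewrite !ltNge (ltW fc) (ltW fz').
have /filterS : \forall z' \near z, c < f z' by exact: cvgr_gt (cf z) _ cf'.
by apply => z' fz'; rewrite gt_eqF // fz' cf'.
Qed.

Section Subtype.
Context {X Y : topologicalType} (A : set Y).

Definition into (g : X -> Y) (gA : forall x, A (g x)) (x : X) : A :=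
  exist (fun y => y \in A) (g x) (mem_set (gA x)).

Lemma into_continuous g (gA : forall x, A (g x)) :
  continuous g -> continuous (into gA).
Proof. by move=> cg; apply/continuous_comp_initial. Qed.

Lemma val_intoE g (gA : forall x, A (g x)) x : set_val (into gA x) = g x.
Proof. by []. Qed.

End Subtype.

Lemma val_continuous (Y : topologicalType) (A : set Y) :
  continuous (set_val : A -> Y).
Proof. exact: initial_continuous. Qed.

Lemma into_path {R : realType} (Y : topologicalType) (A : set Y)
    (g : R -> Y) (y z : A) : continuous g ->
  (forall t, 0 <= t <= 1 -> A (g t)) -> set_val y = g 0 -> set_val z = g 1 ->
  exists p : {path (unit_itv R) from y to z},
    forall t, set_val (p t) = g (of_unit_itv t).
Proof.
move=> cg gA yE zE.
have gA' (t : unit_itv R) : A (g (of_unit_itv t)) by exact/gA/unit_itvP.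
have cG : continuous (into gA').
  by apply: into_continuous; apply: (cont_comp _ cg);
    exact: continuous_of_unit_itv.
have G0 : into gA' zero = y by apply/val_inj; rewrite /= of_zero -yE.
have G1 : into gA' one = z by apply/val_inj; rewrite /= of_one -zE.
by exists (mk_path cG G0 G1).
Qed.

(** * Classes of parallel lines in the affine plane *)

Section Affine.
Context {R : realType} (t : nat) (s : nat -> R) (r : nat -> seq R).
Local Notation V := (R * R)%type.
Local Notation path x y := {path (unit_itv R) from x to y}.

(** Having real coefficients, the form acts on real and imaginary parts separately: the complex line
    of root [c] is given by [lin j x = c] and [lin j y = 0]. *)
Definition lin (j : nat) (v : V) : R := v.1 + s j * v.2.

(* A point of C^2 is the pair of its real and imaginary parts, two vectors of
   R^2. *)
Definition affine_complement : set (V * V) :=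
  [set z | forall j, (j < t)%N -> lin j z.1 \in r j -> lin j z.2 != 0].

Local Notation A := affine_complement.
Local Notation T := (set_type affine_complement).

(* The lines [lin j = 0] cut R^2 into 2t sectors, numbered cyclically from 0 to
   2t; [pos i j] tells whether [lin j] is positive on the i-th one. *)
Definition pos (i j : nat) : bool := (i <= j)%N || (j + t < i)%N.
Definition sgn (i j : nat) : R := if pos i j then 1 else -1.

Definition sector_nbhd (i : nat) : set (V * V) :=
  [set z | forall j, (j < t)%N -> lin j z.1 \in r j -> 0 < sgn i j * lin j z.2].

Definition cone (i : nat) : set (V * V) :=
  [set z | forall j, (j < t)%N -> 0 < sgn i j * lin j z.2].

Definition U (i : nat) : set T := [set z | sector_nbhd i (set_val z)].

Hypothesis s_inc : forall i j, (i < j)%N -> (j < t)%N -> s i < s j.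
Hypothesis r_sorted : forall j, (j < t)%N -> sorted <%R (r j).
Hypothesis general_position : forall (v : V) i j k,
  (i < j)%N -> (j < k)%N -> (k < t)%N ->
  lin i v \in r i -> lin j v \in r j -> lin k v \in r k -> False.

Lemma sector_sub i : sector_nbhd i `<=` A.
Proof.
move=> z Wz j jt /(Wz j jt); apply: contraTN => /eqP ->.
by rewrite mulr0 ltxx.
Qed.

Lemma cone_sub i : cone i `<=` sector_nbhd i.
Proof. by move=> z Cz j jt _; exact: Cz. Qed.

Lemma lin_continuous (X : topologicalType) (f : X -> V) j :
  continuous f -> continuous (fun x => lin j (f x)).
Proof.
move=> cf; apply: cont_add; first by apply: (cont_comp cf); exact: cont_fst.
apply: cont_mul; first exact: cont_cst.
by apply: (cont_comp cf); exact: cont_snd.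
Qed.

Lemma re_continuous j : continuous (fun z : T => lin j (set_val z).1).
Proof.
apply: lin_continuous; apply: cont_comp; last exact: cont_fst.
exact: val_continuous.
Qed.

Lemma im_continuous j : continuous (fun z : T => lin j (set_val z).2).
Proof.
apply: lin_continuous; apply: cont_comp; last exact: cont_snd.
exact: val_continuous.
Qed.

Lemma U_open i : open (U i).
Proof.
rewrite openE => z Uz.
have : \forall z' \near z, forall j, j \in iota 0 t ->
    forall c, c \in r j -> lin j (set_val z').1 = c ->
    0 < sgn i j * lin j (set_val z').2.
  apply: (near_all (F := nbhs z)) => j; rewrite mem_iota add0n => /andP[_ jt].
  apply: (near_all (F := nbhs z)) => c cr.
  have [E|E] := eqVneq (lin j (set_val z).1) c; last first.
    apply: filterS (near_side (@re_continuous j) E) => z' [/eqP] //.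
  have : 0 < sgn i j * lin j (set_val z).2 by apply: Uz => //; rewrite E.
  have cm : continuous (fun z : T => sgn i j * lin j (set_val z).2).
    by apply: cont_mul; [exact: cont_cst|exact: im_continuous].
  move=> /(cvgr_gt _ (cm z)); exact: filterS.
apply: filterS => z' H j jt cr; apply: (H j _ _ cr) => //.
by rewrite mem_iota add0n.
Qed.

(** * Sectors of the imaginary plane *)

Lemma threshold i : (i <= t)%N -> exists a : R,
  forall j, (j < t)%N -> ((j < i)%N -> s j < a) /\ ((i <= j)%N -> a < s j).
Proof.
have s_le j j' : (j <= j')%N -> (j' < t)%N -> s j <= s j'.
  by rewrite leq_eqVlt => /orP[/eqP -> //|jj' j't]; exact/ltW/s_inc.
case: i => [|i] it.
  exists (s 0%N - 1) => j jt; split=> // _.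
  by have := s_le 0%N j isT jt; lra.
have [it'|it'] := leqP t i.+1.
  exists (s i + 1) => j jt; split; last by lia.
  by move=> ji; have := s_le j i ji it; lra.
have sii := s_inc (ltnSn i) it'.
exists ((s i + s i.+1) / 2) => j jt; split=> [ji|ij].
  by have := s_le j i ltac:(lia) ltac:(lia); lra.
by have := s_le i.+1 j ij jt; lra.
Qed.

(** If [a] separates two consecutive slopes, [lin j] is [s j - a] on (-a, 1) and [a - s j] on (a,
    -1), so its sign changes at the chosen class. *)
Lemma sector_direction i : exists d : V, forall j, (j < t)%N ->
  0 < sgn i j * lin j d.
Proof.
rewrite /sgn /pos /lin.
have [it|ti] := leqP i t.
  have [a aP] := threshold it; exists (- a, 1) => j jt /=.
  have [H1 H2] := aP j jt; have [ij|ji] := leqP i j.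
    by rewrite /=; have := H2 ij; lra.
  rewrite ifF; last by apply/negbTE; lia.
  by have := H1 ji; lra.
(* From 2t on, [pos] is true for every class, as in sector 0; the minimum makes all these indices
   share the threshold [t]. *)
have [a aP] := @threshold (minn (i - t) t) (geq_minr _ _).
exists (a, -1) => j jt /=.
have [H1 H2] := aP j jt; have [ji|ij] := ltnP j (i - t).
  rewrite ifT; last by apply/orP; right; lia.
  by have := H1 ltac:(lia); lra.
rewrite ifF; last by apply/negbTE; lia.
by have := H2 ltac:(lia); lra.
Qed.

(** As the slopes increase, [lin j y] is monotone in [j], in a direction given by the sign of [y.2].
    Its sign changes at most once, at the place found by [neg]. A value 0 occurs only in a class
    without a line through [x], which imposes no condition. *)
Lemma U_cover z : exists i, U i z.
Proof.
case: z => -[x y] zT; have zA := set_mem zT.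
pose neg (b : R) := find (fun j => b * lin j y >= 0) (iota 0 t).
have negP b : 0 <= b * y.2 -> (neg b <= t)%N /\ forall j, (j < t)%N ->
    ((j < neg b)%N -> b * lin j y < 0) /\ ((neg b <= j)%N -> 0 <= b * lin j y).
  move=> by2; have nt : (neg b <= t)%N.
    by rewrite -[X in (_ <= X)%N](size_iota 0 t) find_size.
  split=> // j jt; split=> [jn|nj].
    have := before_find 0%N jn; rewrite nth_iota // add0n => /negbT.
    by rewrite -ltNge.
  have nt' : (neg b < t)%N by lia.
  have : has (fun j => b * lin j y >= 0) (iota 0 t).
    by rewrite has_find size_iota.
  move=> /(nth_find 0%N); rewrite nth_iota // add0n -/(neg b).
  have : s (neg b) <= s j.
    by move: nj; rewrite leq_eqVlt => /orP[/eqP <- //|nj]; exact/ltW/s_inc.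
  rewrite /lin => ss; have : 0 <= (s j - s (neg b)) * (b * y.2).
    by rewrite mulr_ge0 // subr_ge0.
  by lra.
have nz j : (j < t)%N -> lin j x \in r j -> lin j y != 0 by exact: zA.
have [y0|y0] := leP 0 y.2.
  have [|nt H] := negP 1; first by rewrite mul1r.
  exists (neg 1) => j jt xr; have y1 : lin j y != 0 by exact: nz.
  have [H1 H2] := H j jt; rewrite /= /sgn /pos.
  have [nj|jn] := leqP (neg 1) j; rewrite /=.
    by have := H2 nj; rewrite !mul1r le_eqVlt eq_sym (negbTE y1).
  rewrite ifF; last by apply/negbTE; lia.
  by have := H1 jn; lra.
have [|nt H] := negP (-1); first by lra.
exists (t + neg (-1)%R)%N => j jt xr; have y1 : lin j y != 0 by exact: nz.
have [H1 H2] := H j jt; rewrite /= /sgn /pos.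
have [jn|nj] := ltnP j (neg (-1)).
  by rewrite ifT; [have := H1 jn; lra|apply/orP; right; lia].
rewrite ifF; last by apply/negbTE; lia.
by have := H2 nj; rewrite !mulN1r le_eqVlt eq_sym oppr_eq0 (negbTE y1).
Qed.

(* Pushing the imaginary part along [d] by [rho] stays inside the i-th
   neighbourhood and ends in a convex cone: this is what makes the neighbourhood
   contractible. *)
Lemma push_data i : exists (d : V) (rho : V -> R),
  [/\ continuous rho, forall y, 0 <= rho y,
      forall j, (j < t)%N -> 0 < sgn i j * lin j d &
      forall y j, (j < t)%N ->
        0 < sgn i j * lin j (y.1 + rho y * d.1, y.2 + rho y * d.2)].
Proof.
have [d dP] := sector_direction i.
suff /(_ t (leqnn t)) [rho [crho rho0 H]] : forall n, (n <= t)%N ->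
    exists rho : V -> R, [/\ continuous rho, forall y, 0 <= rho y &
    forall y j, (j < n)%N -> `|lin j y| < rho y * (sgn i j * lin j d)].
  exists d, rho; split => // y j jt.
  have -> : sgn i j * lin j (y.1 + rho y * d.1, y.2 + rho y * d.2) =
      sgn i j * lin j y + rho y * (sgn i j * lin j d) by rewrite /lin /=; ring.
  have := H y j jt; rewrite /sgn; case: ifP => _; rewrite ltr_norml; lra.
elim=> [|n IHn] nt.
  by exists (cst 0); split => // ; exact: cont_cst.
have [rho [crho rho0 H]] := IHn (ltnW nt).
(* The new term outweighs [lin n y] in class [n]; being nonnegative, it does no harm in the earlier
   classes, where [d] is on the right side as well. *)
exists (fun y => rho y + ((`|lin n y| + 1) / (sgn i n * lin n d))); split.
- apply: cont_add => //; apply: cont_mul; last exact: cont_cst.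
  apply: cont_add; last exact: cont_cst.
  apply: (@cont_comp _ _ _ (lin n) (fun x => `|x|)).
    by apply: lin_continuous => ?; exact: cvg_id.
  by move=> ?; exact: norm_continuous.
- move=> y; apply: addr_ge0 => //; apply: divr_ge0; last exact/ltW/dP.
  by rewrite addr_ge0.
- move=> y j; rewrite ltnS leq_eqVlt => /orP[/eqP ->|jn]; rewrite mulrDl.
    rewrite divfK ?gt_eqF ?dP //.
    have := mulr_ge0 (rho0 y) (ltW (dP n nt)); lra.
  apply: lt_le_trans (H y j jn) _; rewrite lerDl mulr_ge0 //.
    by rewrite divr_ge0 ?addr_ge0 // ltW // dP.
  by rewrite ltW // dP // (ltn_trans jn).
Qed.

(** * Contracting the sector neighbourhoods *)

Definition dir i : V := projT1 (cid (push_data i)).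
Definition rho i : V -> R := projT1 (cid (projT2 (cid (push_data i)))).

Definition push i (u : R) (z : V * V) : V * V :=
  (z.1, (z.2.1 + u * rho i z.2 * (dir i).1, z.2.2 + u * rho i z.2 * (dir i).2)).

Lemma rhoP i :
  [/\ continuous (rho i), forall y, 0 <= rho i y,
      forall j, (j < t)%N -> 0 < sgn i j * lin j (dir i) &
      forall y j, (j < t)%N -> 0 < sgn i j *
        lin j (y.1 + rho i y * (dir i).1, y.2 + rho i y * (dir i).2)].
Proof. exact: projT2 (cid (projT2 (cid (push_data i)))). Qed.

Lemma push_cone i z : cone i (push i 1 z).
Proof. by move=> j jt; rewrite /push !mul1r; have [_ _ _] := rhoP i; apply. Qed.

Lemma push0 i z : push i 0 z = z.
Proof. by case: z => x [y1 y2]; rewrite /push /= !mul0r !addr0. Qed.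

Lemma lin_push i j u z :
  lin j (push i u z).2 = lin j z.2 + u * rho i z.2 * lin j (dir i).
Proof. by rewrite /lin /=; ring. Qed.

Lemma push_continuous (X : topologicalType) i (u : X -> R) (z : X -> V * V) :
  continuous u -> continuous z -> continuous (fun x => push i (u x) (z x)).
Proof.
move=> cu cz.
have c1 : continuous (fun x => (z x).1) by apply: (cont_comp cz);
  exact: cont_fst.
have c2 : continuous (fun x => (z x).2) by apply: (cont_comp cz);
  exact: cont_snd.
have cr : continuous (fun x => u x * rho i (z x).2).
  apply: cont_mul => //; by apply: (cont_comp c2); have [] := rhoP i.
apply: cont_pair => //; apply: cont_pair; apply: cont_add.
- by apply: (cont_comp c2); exact: cont_fst.
- by apply: cont_mul => //; exact: cont_cst.
- by apply: (cont_comp c2); exact: cont_snd.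
- by apply: cont_mul => //; exact: cont_cst.
Qed.

Lemma sgn_neq i l j : pos i j != pos l j -> sgn i j = - sgn l j.
Proof. by rewrite /sgn; case: (pos i j); case: (pos l j) => // _;
  rewrite opprK. Qed.

Lemma sector_opp i l j z : pos i j != pos l j -> (j < t)%N ->
  sector_nbhd i z -> sector_nbhd l z -> lin j z.1 \notin r j.
Proof.
move=> /sgn_neq E jt Wi Wl; apply/negP => xr.
by have := Wi j jt xr; have := Wl j jt xr; rewrite E; lra.
Qed.

(** Pushing towards sector [i] also preserves the neighbourhood of [l]: where the signs agree the
    point moves further to the right side, and where they differ no line of the class passes through
    the real part. *)
Lemma push_in i l u z : 0 <= u -> sector_nbhd i z -> sector_nbhd l z ->
  sector_nbhd l (push i u z).
Proof.
move=> u0 Wi Wl j jt xr; have [E|E] := eqVneq (pos i j) (pos l j); last first.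
  by rewrite (negbTE (sector_opp E jt Wi Wl)) in xr.
rewrite lin_push mulrDr mulrCA ltr_wpDr //; last exact: Wl.
have [_ rho0 dir0 _] := rhoP i; apply: mulr_ge0; first exact: mulr_ge0.
by rewrite (_ : sgn l j = sgn i j) ?ltW ?dir0 // /sgn E.
Qed.

Definition mix (z z' : V * V) (u : R) : V * V :=
  (((1 - u) * z.1.1 + u * z'.1.1, (1 - u) * z.1.2 + u * z'.1.2),
   ((1 - u) * z.2.1 + u * z'.2.1, (1 - u) * z.2.2 + u * z'.2.2)).

Lemma lin_mix1 j z z' u : lin j (mix z z' u).1 = (1 - u) * lin j z.1 + u * lin j
  z'.1.
Proof. by rewrite /lin /=; ring. Qed.

Lemma lin_mix2 j z z' u : lin j (mix z z' u).2 = (1 - u) * lin j z.2 + u * lin j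
  z'.2.
Proof. by rewrite /lin /=; ring. Qed.

Lemma mix0 z z' : mix z z' 0 = z.
Proof.
by case: z => [[a b] [c d]]; rewrite /mix /= !subr0 !mul1r !mul0r !addr0.
Qed.

Lemma mix1 z z' : mix z z' 1 = z'.
Proof.
by case: z' => [[a b] [c d]]; rewrite /mix /= !subrr !mul1r !mul0r !add0r.
Qed.

Lemma mixzz z u : mix z z u = z.
Proof.
by case: z => [[a b] [c d]]; rewrite /mix /=; congr (_, _); congr (_, _); ring.
Qed.

Lemma mix_continuous (X : topologicalType) (z z' : X -> V * V) (u : X -> R) :
  continuous z -> continuous z' -> continuous u ->
  continuous (fun x => mix (z x) (z' x) (u x)).
Proof.
move=> cz cz' cu.
have c1 (f : X -> V * V) : continuous f -> continuous (fun x => (f x).1).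
  by move=> cf; apply: (cont_comp cf); exact: cont_fst.
have c2 (f : X -> V * V) : continuous f -> continuous (fun x => (f x).2).
  by move=> cf; apply: (cont_comp cf); exact: cont_snd.
have d1 (f : X -> V) : continuous f -> continuous (fun x => (f x).1).
  by move=> cf; apply: (cont_comp cf); exact: cont_fst.
have d2 (f : X -> V) : continuous f -> continuous (fun x => (f x).2).
  by move=> cf; apply: (cont_comp cf); exact: cont_snd.
have cmix (a b : X -> R) : continuous a -> continuous b ->
    continuous (fun x => (1 - u x) * a x + u x * b x).
  move=> ca cb; apply: cont_add; apply: cont_mul => //.
  by apply: cont_sub => //; exact: cont_cst.
by apply: cont_pair; apply: cont_pair; apply: cmix;
  try (apply: d1); try (apply: d2); try exact: c1; try exact: c2.
Qed.

Lemma conv_gt0 (u a b : R) : 0 <= u <= 1 -> 0 < a -> 0 < b ->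
  0 < (1 - u) * a + u * b.
Proof.
move=> u01 a0 b0; have [u1|u1] := ltP u 1.
  by rewrite ltr_pwDl ?mulr_gt0 ?subr_gt0 ?mulr_ge0 ?(ltW b0) //; lra.
have -> : u = 1 by lra.
by rewrite subrr mul0r add0r mul1r.
Qed.

Lemma mix_cone i z z' u : 0 <= u <= 1 -> cone i z -> cone i z' ->
  cone i (mix z z' u).
Proof.
move=> u01 Cz Cz' j jt; rewrite lin_mix2; have := Cz j jt; have := Cz' j jt.
set a := lin j z.2; set b := lin j z'.2; set e := sgn i j => b0 a0.
have -> : e * ((1 - u) * a + u * b) = (1 - u) * (e * a) + u * (e * b) by ring.
exact: conv_gt0.
Qed.

Definition same_side j (y z : V * V) : Prop :=
  forall c, c \in r j -> (c < lin j y.1) = (c < lin j z.1).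

(** Where the signs of [i] and [l] agree the condition is convex; where they differ, the real parts
    of both ends lie in one open slab, so the segment between them meets no line of the class. *)
Lemma mix_in i l z z' u : 0 <= u <= 1 -> cone i z -> cone i z' ->
  sector_nbhd l z -> sector_nbhd l z' ->
  (forall j, (j < t)%N -> pos i j != pos l j -> same_side j z z') ->
  sector_nbhd l (mix z z' u).
Proof.
move=> u01 Cz Cz' Wz Wz' side j jt.
have [E _|E] := eqVneq (pos i j) (pos l j).
  by have := mix_cone u01 Cz Cz' jt; rewrite /sgn E.
have zr := sector_opp E jt (cone_sub Cz) Wz.
have zr' := sector_opp E jt (cone_sub Cz') Wz'.
rewrite lin_mix1; set a := lin j z.1 in zr *; set b := lin j z'.1 in zr' *.
set c := (1 - u) * a + u * b => cr; exfalso.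
have ca : c != a by apply: contraNneq zr => <-.
have cb : c != b by apply: contraNneq zr' => <-.
have := side j jt E c cr; rewrite -/a -/b.
have [ac|ac|E'] := ltgtP a c; last by rewrite E' eqxx in ca.
- have [bc|bc|E'] := ltgtP b c; [|by []|by rewrite E' eqxx in cb].
  have : 0 < (1 - u) * (c - a) + u * (c - b) by apply: conv_gt0; lra.
  by rewrite (_ : _ + _ = 0) ?ltxx // /c; ring.
- have [bc|bc|E'] := ltgtP b c; [by []| |by rewrite E' eqxx in cb].
  have : 0 < (1 - u) * (a - c) + u * (b - c) by apply: conv_gt0; lra.
  by rewrite (_ : _ + _ = 0) ?ltxx // /c; ring.
Qed.

Definition pt (v : V * V) (Av : A v) : T :=
  exist (fun v => v \in A) v (mem_set Av).

Lemma pushed_path i (y : T) : U i y -> exists (y' : T) (p : path y y'),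
  [/\ set_val y' = push i 1 (set_val y),
      forall u, set_val (p u) = push i (of_unit_itv u) (set_val y) &
      forall l, U l y -> U l y' /\ forall u, U l (p u)].
Proof.
move=> Uy.
have in_l l u : U l y -> 0 <= u -> sector_nbhd l (push i u (set_val y)).
  by move=> Ul u0; apply: push_in.
have Ay' : A (push i 1 (set_val y)) by apply/sector_sub/(in_l i).
have cp : continuous (fun u => push i u (set_val y)).
  by apply: push_continuous; [move=> ?; exact: cvg_id|exact: cont_cst].
have [|||p pE] := @into_path R _ A _ y (pt Ay') cp.
- by move=> u /andP[u0 _]; apply/sector_sub/(in_l i).
- by rewrite push0.
- by [].
exists (pt Ay'), p; split=> // l Ul; split; first exact: in_l.
move=> u; rewrite /U /= pE; apply: in_l => //.
by case/andP: (unit_itvP u).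
Qed.

Lemma rev_path_in (W : set T) x y (p : path x y) :
  (forall u, W (p u)) -> forall u, W (rev_path p u).
Proof. by move=> Wp u; rewrite rev_pathE. Qed.

(** Both points are pushed into the cone of [i] and joined there by a segment; each of the three
    pieces stays in both sets. *)
Lemma sector_connect i l (y z : T) : U i y -> U l y -> U i z -> U l z ->
  (forall j, (j < t)%N -> pos i j != pos l j ->
    same_side j (set_val y) (set_val z)) ->
  exists p : path y z, (forall u, U i (p u)) /\ (forall u, U l (p u)).
Proof.
move=> Uiy Uly Uiz Ulz side.
have [y' [p [y'E pE pin]]] := pushed_path Uiy.
have [z' [q [z'E qE qin]]] := pushed_path Uiz.
have [[Uiy' Uip] [Uly' Ulp]] := (pin i Uiy, pin l Uly).
have [[Uiz' Uiq] [Ulz' Ulq]] := (qin i Uiz, qin l Ulz).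
have Cy : cone i (set_val y') by rewrite y'E; exact: push_cone.
have Cz : cone i (set_val z') by rewrite z'E; exact: push_cone.
have side' m : (forall j, (j < t)%N -> pos i j != pos m j ->
  pos i j != pos l j) ->
    forall j, (j < t)%N -> pos i j != pos m j ->
    same_side j (set_val y') (set_val z').
  by move=> ml j jt /(ml j jt)/(side j jt); rewrite y'E z'E.
pose g u := mix (set_val y') (set_val z') u.
have gi u : 0 <= u <= 1 -> sector_nbhd i (g u).
  by move=> u01; apply: (mix_in (i := i)) => //; apply: side' => j _;
    rewrite eqxx.
have gl u : 0 <= u <= 1 -> sector_nbhd l (g u).
  by move=> u01; apply: (mix_in (i := i)) => //; exact: side'.
have cg : continuous g.
  by apply: mix_continuous; [exact: cont_cst|exact: cont_cst|move=> ?;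
    exact: cvg_id].
have [|||h hE] := @into_path R _ A _ y' z' cg.
- by move=> u /gi; exact: sector_sub.
- by rewrite /g mix0.
- by rewrite /g mix1.
exists (cat_path p (cat_path h (rev_path q))); split;
  apply: cat_path_in => //; apply: cat_path_in; try exact: rev_path_in.
- by move=> u; rewrite /U /= hE; exact/gi/unit_itvP.
- by move=> u; rewrite /U /= hE; exact/gl/unit_itvP.
Qed.

Lemma cone_homotopic i (y z : T) (p q : path y z) :
  (forall u, cone i (set_val (p u))) -> (forall u, cone i (set_val (q u))) ->
  path_homotopic p q.
Proof.
move=> Cp Cq.
have HA (u : unit_itv R * unit_itv R) :
    A (mix (set_val (p u.2)) (set_val (q u.2)) (of_unit_itv u.1)).
  by apply/sector_sub/cone_sub/(@mix_cone i); rewrite ?unit_itvP.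
exists (into HA); split.
- apply: into_continuous; apply: mix_continuous.
  + apply: cont_comp; last exact: val_continuous.
    by apply: cont_comp; [exact: cont_snd|exact: cts_fun].
  + apply: cont_comp; last exact: val_continuous.
    by apply: cont_comp; [exact: cont_snd|exact: cts_fun].
  + by apply: cont_comp; [exact: cont_fst|exact: continuous_of_unit_itv].
- by move=> u; apply/val_inj; rewrite /= of_zero mix0.
- by move=> u; apply/val_inj; rewrite /= of_one mix1.
- by move=> u; apply/val_inj; rewrite /= !path_zero mixzz.
- by move=> u; apply/val_inj; rewrite /= !path_one mixzz.
Qed.

(** The push deforms each path into the convex cone, moving its ends along the tracks [l] and [m],
    which are the same for [p] and [q]. *)
Lemma U_simply i (y z : T) (p q : path y z) :
  (forall u, U i (p u)) -> (forall u, U i (q u)) -> pcl p = pcl q.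
Proof.
move=> Up Uq.
have Uy : U i y by rewrite -(@path_zero _ _ _ _ p).
have Uz : U i z by rewrite -(@path_one _ _ _ _ p).
have [y' [l [y'E lE _]]] := pushed_path Uy.
have [z' [m [z'E mE _]]] := pushed_path Uz.
have square (f : path y z) : (forall u, U i (f u)) -> exists g : path y' z',
    (forall u, cone i (set_val (g u))) /\ pcl f ** pcl m = pcl l ** pcl g.
  (* Clamping the parameter defines the square on the whole plane and keeps the amount of push
     nonnegative. *)
  move=> Uf; pose c (u : R) := of_unit_itv (to_unit_itv u).
  have cc : continuous c.
    by apply: cont_comp;
      [exact: continuous_to_unit_itv|exact: continuous_of_unit_itv].
  have HA (u : R * R) : A (push i (c u.1) (set_val (ext f u.2))).
    by apply/sector_sub/push_in;
      [case/andP: (unit_itvP (to_unit_itv u.1))|exact: Uf..].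
  have cf : continuous (fun u : R => set_val (ext f u)).
    by apply: cont_comp; [exact: ext_continuous|exact: val_continuous].
  have cH : continuous (into HA).
    apply/into_continuous/push_continuous; first exact: (cont_comp cont_fst cc).
    exact: (cont_comp cont_snd cf).
  have c0 : c 0 = 0 by rewrite /c to_unit_itvK // lexx ler01.
  have c1 : c 1 = 1 by rewrite /c to_unit_itvK // lexx ler01.
  have g0 : into HA (1, 0) = y' by apply/val_inj; rewrite /= c1 ext0 -y'E.
  have g1 : into HA (1, 1) = z' by apply/val_inj; rewrite /= c1 ext1 -z'E.
  have cg : continuous (fun u : R => into HA (1, u)).
    apply: (cont_comp _ cH); apply: cont_pair; first exact: cont_cst.
    by move=> ?; exact: cvg_id.
  exists (seg cg g0 g1); split.
    move=> u; have := @push_cone i (set_val (ext f (0 + (1 - 0) * of_unit_itv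
      u))).
    by rewrite -[X in push i X]c1.
  apply: (square_comp cH) => u.
  - by apply/val_inj; rewrite /= c0 push0 /ext of_unit_itvK.
  - by rewrite segE subr0 add0r mul1r.
  - by apply/val_inj; rewrite /= /c of_unit_itvK ext0; exact: lE.
  - by apply/val_inj; rewrite /= /c of_unit_itvK ext1; exact: mE.
have [f [Cf fE]] := square p Up; have [g [Cg gE]] := square q Uq.
have fg : pcl f = pcl g by apply/pclP/(@cone_homotopic i).
by rewrite -[LHS]compp1 -(comppV (pcl m)) compA fE fg -gE -compA comppV compp1.
Qed.

(** * Real chambers and their slab numbers *)

Definition regular (y : T) : Prop :=
  forall j, (j < t)%N -> lin j (set_val y).1 \notin r j.

Definition idx (j : nat) (y : T) : nat :=
  count (fun c => c < lin j (set_val y).1) (r j).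

Lemma regular_U y i : regular y -> U i y.
Proof. by move=> ry j jt yr; rewrite (negbTE (ry j jt)) in yr. Qed.

Lemma regular_point (v : V) : (forall j, (j < t)%N -> lin j v \notin r j) ->
  exists2 y : T, regular y & (set_val y).1 = v.
Proof.
move=> vr; have Av : A (v, (0, 0)) by move=> j jt vr';
  rewrite (negbTE (vr j jt)) in vr'.
by exists (pt Av).
Qed.

Lemma all_bound (F : nat -> R -> R) :
  exists K : R, forall j c, (j < t)%N -> c \in r j -> F j c < K.
Proof.
have [K KP] := seq_upper_bound [seq F j c | j <- iota 0 t, c <- r j].
exists K => j c jt cr; apply: KP; apply: allpairs_f_dep => //.
by rewrite mem_iota add0n.
Qed.

(** On the first axis all forms [lin j] coincide, so a point far to the left is below every root of
    every class at once. *)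
Lemma base_point : exists x0 : T, regular x0 /\ forall j, (j < t)%N ->
  idx j x0 = 0%N.
Proof.
have [K KP] := all_bound (fun _ c => - c).
have lK j : lin j (- K, 0) = - K by rewrite /lin mulr0 addr0.
have [j jt|x0 x0r x0E] := @regular_point (- K, 0).
  by rewrite lK; apply/negP => /(KP _ _ jt); rewrite opprK ltxx.
exists x0; split=> // j jt; rewrite /idx x0E lK; apply/eqP.
rewrite -leqn0 leqNgt -has_count; apply/hasPn => c cr.
by rewrite -leNgt; have := KP j c jt cr; lra.
Qed.

(** A short move from [v] along [w] changes the position only with respect to the lines through [v],
    and there the sign of [lin j w] decides. *)
Lemma perturb (v w : V) :
  (forall j, (j < t)%N -> lin j v \in r j -> lin j w != 0) ->
  exists2 y : T, regular y & forall j, (j < t)%N -> idx j y =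
    (count (fun c => (c < lin j v)%R) (r j) + ((lin j v \in r j) && (0 < lin j
      w)%R))%N.
Proof.
move=> vw.
(* The step [d] is bounded by the distances to the roots not attained at [v]; the summand 1 avoids a
   zero denominator and makes the later inequality strict. *)
have [d d0 dP] := seq_lower_bound
  [seq `|c - lin j v| / (1 + `|lin j w|) | j <- iota 0 t, c <- r j].
have small j c : (j < t)%N -> c \in r j -> c != lin j v ->
    d * `|lin j w| < `|c - lin j v|.
  move=> jt cr cv; have w1 : 0 < 1 + `|lin j w| by rewrite ltr_pwDl.
  have := dP (`|c - lin j v| / (1 + `|lin j w|)).
  rewrite divr_gt0 ?normr_gt0 ?subr_eq0 // ler_pdivlMr // => H.
  have : d * (1 + `|lin j w|) <= `|c - lin j v|.
    by apply: H => //; apply: allpairs_f_dep => //; rewrite mem_iota add0n.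
  by lra.
pose u : V := (v.1 + d * w.1, v.2 + d * w.2).
have uE j : lin j u = lin j v + d * lin j w by rewrite /lin /=; ring.
have side j c : (j < t)%N -> c \in r j -> c != lin j u /\
    (c < lin j u) = if c == lin j v then 0 < lin j w else c < lin j v.
  move=> jt cr; rewrite uE; have [cv|cv] := eqVneq c (lin j v).
    have := vw j jt; rewrite -cv => /(_ cr) w0; rewrite ltrDl pmulr_rgt0 //.
    by rewrite -subr_eq0 opprD addrA subrr sub0r oppr_eq0 mulf_neq0 // gt_eqF.
  have H : `|d * lin j w| < `|c - lin j v| by rewrite normrM gtr0_norm // small.
  rewrite ltr_norml in H; have [cl|cl|E] := ltgtP c (lin j v);
    last by rewrite E eqxx in cv.
    rewrite ltr0_norm ?subr_lt0 // in H.
    have lt : c < lin j v + d * lin j w by lra.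
    by rewrite lt lt_eqF.
  rewrite gtr0_norm ?subr_gt0 // in H.
  have lt : lin j v + d * lin j w < c by lra.
  by rewrite gt_eqF // ltNge ltW.
have [j jt|y yr yE] := @regular_point u.
  by apply/negP => ur; have [/eqP] := side j _ jt ur.
exists y => // j jt; rewrite /idx yE.
transitivity (count (predU (fun c => c < lin j v)
    (fun c => (c == lin j v) && (0 < lin j w))) (r j)).
  apply: eq_in_count => c cr /=; have [_ ->] := side j c jt cr.
  have [->|_] := eqVneq c (lin j v); first by rewrite ltxx.
  by rewrite orbF.
have := count_predUI (fun c => c < lin j v) (fun c =>
  (c == lin j v) && (0 < lin j w)) (r j).
have -> : count (predI (fun c => c < lin j v)
    (fun c => (c == lin j v) && (0 < lin j w))) (r j) = 0%N.
  apply/eqP; rewrite -leqn0 leqNgt -has_count; apply/hasPn => c _ /=.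
  by case: eqVneq => [->|_]; rewrite ?ltxx ?andbF.
rewrite addn0 => ->; congr addn; case: (0 < lin j w).
  rewrite andbT; under eq_count do rewrite andbT.
  by rewrite (count_uniq_mem _ (lt_sorted_uniq (r_sorted jt))).
by rewrite andbF; under eq_count do rewrite andbF; rewrite count_pred0.
Qed.

Lemma idx_same_side j (y z : T) : idx j y = idx j z ->
  same_side j (set_val y) (set_val z).
Proof. by move=> E c cr; exact: count_lt_eq E c cr. Qed.

Definition bsign (b : bool) : R := if b then 1 else -1.

Lemma bsign_gt0 b : (0 < bsign b) = b.
Proof. by case: b; rewrite /bsign ?ltr01 // oppr_gt0 ltr10. Qed.

Lemma bsign_neq0 b : bsign b != 0.
Proof. by case: b; rewrite /bsign ?oppr_eq0 oner_eq0. Qed.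

Lemma lin_bsign j b : lin j (bsign b, 0) = bsign b.
Proof. by rewrite /lin mulr0 addr0. Qed.

Definition chamber (m : nat -> nat) : Prop :=
  exists2 y : T, regular y & forall j, (j < t)%N -> m j = idx j y.

Lemma chamber_le m j : chamber m -> (j < t)%N -> (m j <= size (r j))%N.
Proof. by move=> [y _ my] /my ->; exact: count_size. Qed.

Lemma chamber_line a p : (a < t)%N -> (p < size (r a))%N ->
  exists m, forall x : bool, chamber (upd1 m a (p + x)%N).
Proof.
move=> at_ pr; set c := nth 0 (r a) p.
have cr : c \in r a by exact: mem_nth.
(* On the line [lin a = c], parametrized by the second coordinate, these are the parameters of its
   intersections with the other classes; for [j = a] the quotient is the harmless value 0. *)
have [K KP] := all_bound (fun j c' => (c' - c) / (s j - s a)).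
pose v : V := (c - s a * K, K).
have va : lin a v = c by rewrite /lin /=; ring.
have vj j : (j < t)%N -> j != a -> lin j v \notin r j.
  move=> jt ja; apply/negP => vr; have sja : s j - s a != 0.
    have [H|H|E] := ltngtP j a; last by rewrite E eqxx in ja.
      by rewrite subr_eq0 lt_eqF // s_inc.
    by rewrite subr_eq0 gt_eqF // s_inc.
  have := KP j _ jt vr; rewrite (_ : lin j v - c = K * (s j - s a)); last first.
    by rewrite /lin /=; ring.
  by rewrite mulfK // ltxx.
exists (fun j => count (fun c => c < lin j v) (r j)) => x.
have [j jt _|y yr yE] := @perturb v (bsign x, 0).
  by rewrite lin_bsign bsign_neq0.
exists y => // j jt; rewrite yE // lin_bsign bsign_gt0.
have [->|ja] := eqVneq j a;
  first by rewrite upd1_eq va cr count_lt_nth ?r_sorted.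
by rewrite upd1_neq // (negbTE (vj j jt ja)) addn0.
Qed.

Lemma chamber_node a b p q : (a < b)%N -> (b < t)%N ->
  (p < size (r a))%N -> (q < size (r b))%N ->
  exists m, forall x y : bool, chamber (upd1 (upd1 m b (q + y)%N) a (p + x)%N).
Proof.
move=> ab bt pr qr; set c := nth 0 (r a) p; set c' := nth 0 (r b) q.
have cr : c \in r a by exact: mem_nth.
have cr' : c' \in r b by exact: mem_nth.
have sab : s b - s a != 0 by rewrite subr_eq0 gt_eqF // s_inc.
(* The solution of [lin a = u], [lin b = u']: it gives the double point, and with signs for values
   the four directions into the chambers around it. *)
pose pnt (u u' : R) : V :=
  (u - s a * ((u' - u) / (s b - s a)), (u' - u) / (s b - s a)).
have pa u u' : lin a (pnt u u') = u by rewrite /lin /=; ring.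
have pb u u' : lin b (pnt u u') = u' by rewrite /lin /=; field.
set v := pnt c c'.
have vj j : (j < t)%N -> j != a -> j != b -> lin j v \notin r j.
  move=> jt ja jb; apply/negP => vr.
  have va : lin a v \in r a by rewrite pa.
  have vb : lin b v \in r b by rewrite pb.
  have [ja'|aj|E] := ltngtP j a; last by rewrite E eqxx in ja.
    exact: (general_position ja' ab bt vr va vb).
  have [jb'|bj|E] := ltngtP j b; last by rewrite E eqxx in jb.
    exact: (general_position aj jb' bt va vr vb).
  exact: (general_position ab bj jt va vb vr).
have ba : b != a by rewrite gt_eqF.
exists (fun j => count (fun c => c < lin j v) (r j)) => x y.
have [j jt|z zr zE] := @perturb v (pnt (bsign x) (bsign y)).
  have [->|ja] := eqVneq j a; first by rewrite pa bsign_neq0.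
  have [->|jb] := eqVneq j b; first by rewrite pb bsign_neq0.
  by rewrite (negbTE (vj j jt ja jb)).
exists z => // j jt; rewrite zE //.
have [->|ja] := eqVneq j a.
  by rewrite upd1_eq !pa cr bsign_gt0 count_lt_nth ?r_sorted // (ltn_trans ab).
rewrite upd1_neq //; have [->|jb] := eqVneq j b.
  by rewrite upd1_eq !pb cr' bsign_gt0 count_lt_nth ?r_sorted.
by rewrite upd1_neq // (negbTE (vj j jt ja jb)) addn0.
Qed.

Lemma pos_step l j j' : (j < t)%N -> (j' < t)%N ->
  l = j \/ l = (j + t)%N -> j' != j -> pos l j' = pos l.+1 j'.
Proof. by move=> jt j't [->|->] ne; rewrite /pos; lia. Qed.

(** * Generators, relations and holonomy at a base chamber *)

Section BasePoint.
Variable x0 : T.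
Hypothesis x0_regular : regular x0.
Hypothesis x0_idx : forall j, (j < t)%N -> idx j x0 = 0%N.

Local Notation G := (fundamental_group R x0).

Lemma U_base i : U i x0.
Proof. exact: regular_U. Qed.

Lemma U_conn l y : U l y -> exists p : path x0 y, forall u, U l (p u).
Proof.
move=> Uy; have [j _|p [Up _]] := sector_connect (U_base l) (U_base l) Uy Uy.
  by rewrite eqxx.
by exists p.
Qed.

Let U_simp l y := @U_simply l x0 y.

Local Notation E l m y := (@edge R T nat x0 U l m y).

Lemma edge_idx l m y z : U l y -> U m y -> U l z -> U m z ->
  (forall j, (j < t)%N -> pos l j != pos m j -> idx j y = idx j z) ->
  E l m y = E l m z.
Proof.
move=> Uly Umy Ulz Umz H.
have [j jt /(H j jt)|p [Ulp Ump]] := sector_connect Uly Umy Ulz Umz.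
  exact: idx_same_side.
exact: (edge_path U_conn U_simp Ulp Ump).
Qed.

Lemma edge_same l m y : U l y -> U m y ->
  (forall j, (j < t)%N -> pos l j = pos m j) -> E l m y = 1%g.
Proof.
move=> Uly Umy H; rewrite -(edge_base U_base U_simp l m).
apply: edge_idx => //; try exact: U_base.
by move=> j jt; rewrite H // eqxx.
Qed.

(** When [j] is the class separating sectors [l] and [l + 1], any regular point of slab [p] gives
    the same edge; [x0] serves only if the slab has none. *)
Definition chamber_edge (l j p : nat) : G :=
  E l l.+1 (xget x0 [set y | regular y /\ idx j y = p]).

Lemma chamber_edgeE l j y : (j < t)%N -> l = j \/ l = (j + t)%N -> regular y ->
  E l l.+1 y = chamber_edge l j (idx j y).
Proof.
move=> jt lj yr; rewrite /chamber_edge; case: xgetP => [z _ [zr zE]|/(_ y)[]//].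
apply: edge_idx; try exact: regular_U.
move=> j' j't; have [-> //|ne] := eqVneq j' j.
by rewrite (pos_step jt j't lj ne) eqxx.
Qed.

(** The 2t crossings of a full turn form two half turns, each meeting every class once; [half1] and
    [half2] are the [e] and [f] of the abstract relations. *)
Definition half1 (j p : nat) : G := chamber_edge j j p.
Definition half2 (j p : nat) : G := chamber_edge (j + t) j p.

Lemma half1_0 j : (j < t)%N -> half1 j 0 = 1%g.
Proof.
move=> jt; rewrite /half1 -(x0_idx jt) -chamber_edgeE //; last by left.
exact: (edge_base U_base U_simp).
Qed.

Lemma half2_0 j : (j < t)%N -> half2 j 0 = 1%g.
Proof.
move=> jt; rewrite /half2 -(x0_idx jt) -chamber_edgeE //; last by right.
exact: (edge_base U_base U_simp).
Qed.

Lemma edge_prod n y : regular y ->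
  E 0%N n y = \big[*%g/1%g]_(0 <= l < n) E l l.+1 y.
Proof.
move=> yr; elim: n => [|n IHn].
  by rewrite big_geq // edge_same //; exact: regular_U.
rewrite big_nat_recr //= -IHn.
by rewrite (edgeM U_conn U_simp) //; exact: regular_U.
Qed.

(** The product telescopes to the edge from sector 0 to sector 2t, and these two have the same
    signs. *)
Lemma chamber_rel m : chamber m ->
  (\big[*%g/1%g]_(0 <= j < t) half1 j (m j) *
   \big[*%g/1%g]_(0 <= j < t) half2 j (m j) = 1)%g.
Proof.
move=> [y yr my]; transitivity (E 0%N (t + t)%N y); last first.
  apply: edge_same; try exact: regular_U.
  by move=> j jt; rewrite /pos; lia.
rewrite edge_prod // [RHS](@big_cat_nat _ _ _ t) ?leq_addr //=; congr (_ * _)%g.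
  apply: eq_big_nat => j /andP[_ jt].
  by rewrite /half1 my // -chamber_edgeE //; left.
have -> : \big[*%g/1%g]_(t <= l < t + t) E l l.+1 y =
    \big[*%g/1%g]_(0 <= j < t) E (j + t)%N (j + t).+1 y.
  by rewrite -{1}(add0n t) big_addn addnK.
apply: eq_big_nat => j /andP[_ jt].
by rewrite /half2 my // -chamber_edgeE //; right.
Qed.

Lemma half1_commute a b p q : a != b -> (a < t)%N -> (b < t)%N ->
  (p <= size (r a))%N -> (q <= size (r b))%N -> commute (half1 a p) (half1 b q).
Proof.
exact: (commute_classes_neq (k := fun j => size (r j)) chamber_le chamber_rel
  chamber_node half1_0).
Qed.

Lemma half2E a p : (a < t)%N -> (p <= size (r a))%N ->
  half2 a p = (half1 a p)^-1%g.
Proof.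
exact: (second_half (k := fun j => size (r j)) chamber_le chamber_rel
  chamber_line chamber_node half1_0 half2_0).
Qed.

(** A slight shift of the real part changes no slab number in a class separating [l] from [m], since
    no line of such a class passes through it. *)
Lemma regular_near l m y : U l y -> U m y -> exists2 z : T, regular z &
  forall j, (j < t)%N -> pos l j != pos m j -> idx j z = idx j y.
Proof.
move=> Uly Umy; have [j jt _|z zr zE] := @perturb (set_val y).1 (1, 0).
  by rewrite /lin mulr0 addr0 oner_eq0.
exists z => // j jt ne; rewrite zE // /idx.
by rewrite (negbTE (sector_opp ne jt Uly Umy)) addn0.
Qed.

(** An edge may be moved to a regular point, which lies in every [U i]; there it is a quotient of
    products of steps between consecutive sectors. *)
Lemma halves_generate (S : set G) : S 1%g ->
  (forall g h, S g -> S h -> S (g * h)%g) ->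
  (forall j p, (j < t)%N -> (p <= size (r j))%N ->
     S (half1 j p) /\ S (half1 j p)^-1%g) ->
  forall g, S g.
Proof.
move=> S1 SM Sh; apply: (pi1_edge_ind U_open U_cover U_base U_conn U_simp) =>
  //.
(* Labels are arbitrary naturals: the two half turns give the generators and their inverses, and
   from 2t on no sign changes. *)
have step l z : regular z -> S (E l l.+1 z) /\ S (E l l.+1 z)^-1%g.
  move=> zr; have [lt|tl] := ltnP l t.
    rewrite (@chamber_edgeE l l) //; last by left.
    by apply: Sh => //; exact: count_size.
  have [l2t|tl2] := ltnP (l - t) t.
    rewrite (@chamber_edgeE l (l - t)) //; last by right; rewrite subnK.
    rewrite (_ : chamber_edge l _ _ = half2 (l - t) (idx (l - t) z));
      last first.
      by rewrite /half2 subnK.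
    rewrite half2E ?count_size // invgK.
    by have [] := Sh (l - t)%N _ l2t (count_size (fun c =>
      c < lin (l - t) (set_val z).1) _).
  rewrite edge_same ?invg1 //; try exact: regular_U.
  by move=> j jt; rewrite /pos; lia.
have S0 l z : regular z -> S (E 0%N l z) /\ S (E 0%N l z)^-1%g.
  move=> zr; elim: l => [|l [IH1 IH2]].
    by rewrite edge_same ?invg1 //; exact: regular_U.
  have [H1 H2] := step l z zr.
  rewrite -(edgeM U_conn U_simp (m := l)) ?invgM; try exact: regular_U.
  by split; exact: SM.
move=> l m y Uly Umy; have [z zr zE] := regular_near Uly Umy.
rewrite (@edge_idx l m y z) //; try exact: regular_U; last first.
  by move=> j jt ne; rewrite zE.
have -> : E l m z = ((E 0%N l z)^-1 * E 0%N m z)%g.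
  apply: (@mulgI _ (E 0%N l z)); rewrite mulVKg.
  by rewrite (edgeM U_conn U_simp) //; exact: regular_U.
by apply: SM; [have [] := S0 l z zr|have [] := S0 m z zr].
Qed.

(** Slab 0 contains the base chamber and carries no generator, whence the shift by one; numbers
    above [k] give 1. *)
Definition slab_gen (k m : nat) : free_group 'I_k :=
  if m is m'.+1 then oapp (@free_gen 'I_k) 1%g (insub m') else 1%g.

(** A single gauge may jump where the real part crosses a line of class [j]; only the quotients of
    two gauges on overlaps are locally constant, which is what transport requires. *)
Definition gauge (j l : nat) (y : T) : free_group 'I_(size (r j)) :=
  if pos l j then 1%g else slab_gen (size (r j)) (idx j y).

(** If the signs agree the quotient is 1; if not, the real part is on no line of class [j], and its
    slab is locally constant. *)
Lemma gauge_loc j l m y : (j < t)%N -> U l y -> U m y ->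
  \forall z \near y, ((gauge j l z)^-1 * gauge j m z =
                      (gauge j l y)^-1 * gauge j m y)%g.
Proof.
move=> jt Uly Umy; have [E|ne] := eqVneq (pos l j) (pos m j).
  by apply: filterE => z; rewrite /gauge E !mulVg.
have yr := sector_opp ne jt Uly Umy.
have : \forall z \near y, forall c, c \in r j ->
    (c < lin j (set_val z).1) = (c < lin j (set_val y).1).
  apply: (near_all (F := nbhs y)) => c cr.
  have yc : lin j (set_val y).1 != c by apply: contraNneq yr => ->.
  by apply: filterS (near_side (@re_continuous j) yc) => z [].
apply: filterS => z zc; have zE : idx j z = idx j y by exact: eq_in_count.
by rewrite /gauge zE.
Qed.

Definition class_hol (j : 'I_t) (g : G) : free_group 'I_(size (r j)) :=
  transport U (gauge j) (hom_pi1 g).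

Lemma class_holM j : {morph class_hol j : g h / (g * h)%g}.
Proof.
move=> g h; rewrite /class_hol hom_pi1M; apply: transportM.
- exact: U_open.
- exact: U_cover.
- by move=> l m y; apply: gauge_loc.
Qed.

(** The gauges are 1 at the base point, which is in slab 0, and between sectors [i] and [i + 1] only
    the sign of class [i] changes. *)
Lemma class_hol_half1 (i j : 'I_t) p : (p <= size (r i))%N ->
  class_hol j (half1 i p) = if i == j then slab_gen (size (r j)) p else 1%g.
Proof.
move=> pr; have [y yr yE] : exists2 y : T, regular y & idx i y = p.
  case: p pr => [_|p pr]; first by exists x0; rewrite ?x0_idx.
  have [m mC] := chamber_line (ltn_ord i) pr.
  have [y yr my] := mC true; exists y => //.
  by rewrite -my // upd1_eq addn1.
rewrite -yE /half1 -chamber_edgeE //; last by left.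
rewrite /class_hol (transport_edge U_open U_cover U_conn U_simp); last 3 first.
- by move=> l m z; apply: gauge_loc.
- exact: regular_U.
- exact: regular_U.
have g0 l : gauge j l x0 = 1%g by rewrite /gauge x0_idx //; case: ifP.
rewrite !g0 mul1g invg1 mulg1 /gauge; have [<-|ne] := eqVneq i j.
  rewrite {1}/pos leqnn /= invg1 mul1g ifF //; rewrite /pos.
  by have := ltn_ord i; lia.
by rewrite (@pos_step i i j) ?mulVg 1?eq_sym //; left.
Qed.

Lemma affine_pi1_base :
  group_isomorphic G (group_prod (fun j : 'I_t => free_group 'I_(size (r j)))).
Proof.
apply: (@direct_product_decomposition G t (fun j =>
  size (r j)) half1 class_hol).
- exact: class_holM.
- exact: half1_commute.
- exact: half1_0.
- by move=> i j o ij; rewrite class_hol_half1 // (negbTE ij).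
- by move=> j o; rewrite class_hol_half1 // eqxx /= valK.
- exact: halves_generate.
Qed.

End BasePoint.

Theorem affine_pi1 (x : T) : group_isomorphic (fundamental_group R x)
  (group_prod (fun j : 'I_t => free_group 'I_(size (r j)))).
Proof.
have [x0 [x0_regular x0_idx]] := base_point.
apply: group_isomorphic_trans (affine_pi1_base x0_regular x0_idx).
have [i Uix] := U_cover x; have [p _] := U_conn x0_regular Uix.
by apply: (@pi1_homeo _ _ _ id id x x0 (rev_path p)) => // ? ? ?.
Qed.

End Affine.

(** * The affine chart of the projective plane *)

Lemma mx_continuous (K : numFieldType) (X : topologicalType) m n
    (f : X -> 'M[K]_(m, n)) :
  (forall i j, continuous (fun x => f x i j)) -> continuous f.
Proof.
move=> cf x B [P PN PB].
have : \forall y \near x, forall i j, P i j (f y i j).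
  by apply: filter_forall => i; apply: filter_forall => j; exact: cf.
by apply: filterS => y H; apply: PB.
Qed.

(** The two radii live in different fields, as is needed for maps between the reals and the complex
    numbers. *)
Lemma dist_continuous (K L : numFieldType) (f : K -> L) :
  (forall z e, 0 < e -> exists2 d, 0 < d &
     forall w, `|z - w| < d -> `|f z - f w| < e) -> continuous f.
Proof.
move=> H z; apply/(@cvgrPdist_lt L L _ _ (nbhs_filter z)) => e /(H z)[d d0 dP].
by apply/nbhs_ballP; exists d => // w; exact: dP.
Qed.

Section Complex.
Variable R : realType.
Local Notation C := (R[i] : numFieldType).

Lemma Re_continuous : continuous (@complex.Re R : C -> R).
Proof.
apply: (@dist_continuous C R) => z e e0; exists e%:C%C; first by rewrite ltcR.
move=> w zw; rewrite -ltcR; apply: le_lt_trans zw.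
by rewrite -raddfB; exact: normc_ge_Re.
Qed.

Lemma Im_continuous : continuous (@complex.Im R : C -> R).
Proof.
apply: (@dist_continuous C R) => z e e0; exists e%:C%C; first by rewrite ltcR.
move=> w zw; rewrite -ltcR; apply: le_lt_trans zw.
have := normc_ge_Re ((z - w) * 'i%C); rewrite ReiNIm normrN raddfB normrM.
by rewrite (_ : `|'i%C| = 1) ?mulr1 // normc_def /= expr0n expr1n add0r sqrtr1.
Qed.

Lemma real_complex_continuous : continuous (real_complex R : R -> C).
Proof.
apply: (@dist_continuous R C) => z e e0; exists (complex.Re e).
  by move: e0; rewrite ltcE /= => /andP[].
move=> w zw; rewrite -rmorphB /= normc_def /= expr0n addr0 sqrtr_sqr.
by rewrite -(RRe_real (ger0_real (ltW e0))) ltcR.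
Qed.

Lemma complex_continuous (X : topologicalType) (f g : X -> R) :
  continuous f -> continuous g -> continuous (fun x => (f x +i* g x)%C : C).
Proof.
move=> cf cg.
have E x : (f x +i* g x)%C = (f x)%:C%C + 'i%C * (g x)%:C%C by rewrite
  [LHS]complexE.
have -> : (fun x => (f x +i* g x)%C : C) =
    (fun x => (real_complex R (f x) : C) + ('i%C : C) * real_complex R (g x)).
  by apply/funext => x; exact: E.
have crf : continuous (fun x => real_complex R (f x) : C).
  by apply: (cont_comp cf); exact: real_complex_continuous.
have crg : continuous (fun x => real_complex R (g x) : C).
  by apply: (cont_comp cg); exact: real_complex_continuous.
move=> x; apply: (@cvgD C C); first exact: crf.
by apply: (@cvgM C); [exact: cvg_cst|exact: crg].
Qed.

End Complex.

Section FieldContinuity.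
Context {K : numFieldType} {X : topologicalType} (x : X).
Implicit Types f g : X -> K.

Lemma fcont_add f g : {for x, continuous f} -> {for x, continuous g} ->
  {for x, continuous (fun y => f y + g y)}.
Proof. by move=> cf cg; apply: cvgD. Qed.

Lemma fcont_mul f g : {for x, continuous f} -> {for x, continuous g} ->
  {for x, continuous (fun y => f y * g y)}.
Proof. by move=> cf cg; apply: cvgM. Qed.

Lemma fcont_div f g : {for x, continuous f} -> {for x, continuous g} ->
  g x != 0 -> {for x, continuous (fun y => f y / g y)}.
Proof. by move=> cf cg gx; apply: cvgM => //; apply: cvgV. Qed.

Lemma fcont_cst (c : K) : {for x, continuous (fun _ : X => c)}.
Proof. exact: cvg_cst. Qed.

Lemma fcont_neq0 f : {for x, continuous f} -> f x != 0 ->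
  \forall y \near x, f y != 0.
Proof. by move=> cf fx; apply: cvgr_neq0 cf fx. Qed.

End FieldContinuity.

Lemma fcont_sum (K : numFieldType) (X : topologicalType) (I : Type) (r : seq I)
    (F : I -> X -> K) : (forall i, continuous (F i)) ->
  continuous (fun y => \sum_(i <- r) F i y).
Proof.
move=> cF; elim: r => [|i r IHr].
  have -> : (fun y => \sum_(i <- [::]) F i y) = fun=> 0.
    by apply/funext => y; rewrite big_nil.
  by move=> x; exact: fcont_cst.
have -> : (fun y => \sum_(j <- i :: r) F j y) =
    fun y => F i y + \sum_(j <- r) F j y.
  by apply/funext => y; rewrite big_cons.
by move=> x; apply: fcont_add; [exact: cF|exact: IHr].
Qed.

(** * The homeomorphism with the affine plane *)

Section Chart.
Variable R : realType.
Local Notation C := (R[i] : numFieldType).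
Local Notation V := (R * R)%type.
Local Notation "\pr v" := (\pi_(projective_space R[i] 2) v) (at level 10).
Implicit Types (a : 'rV[R]_3) (v w : 'rV[C]_3).

Definition ev a v : C := \sum_i (map_mx (real_complex R) a) 0 i * v 0 i.

Lemma evDl a b v : ev (a + b) v = ev a v + ev b v.
Proof.
by rewrite /ev -big_split; apply: eq_bigr => i _; rewrite !mxE rmorphD mulrDl.
Qed.

Lemma evZl c a v : ev (c *: a) v = (real_complex R c) * ev a v.
Proof.
by rewrite /ev mulr_sumr; apply: eq_bigr => i _; rewrite !mxE rmorphM mulrA.
Qed.

Lemma evZr a c v : ev a (c *: v) = c * ev a v.
Proof. by rewrite /ev mulr_sumr; apply: eq_bigr => i _;
  rewrite !mxE mulrCA. Qed.

Definition real_hyperplane a : set (CP2 R) :=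
  hyperplane (map_mx (real_complex R) a).

Lemma real_hyperplaneP a (w : nonzero_vec R[i] 2) :
  real_hyperplane a (\pr w) <-> ev a (set_val w) = 0.
Proof. exact: hyperplaneP. Qed.

Lemma ev_continuous a : continuous (ev a : 'rV[C]_3 -> C).
Proof.
apply: (@fcont_sum C 'rV[C]_3 'I_3 (index_enum 'I_3)
  (fun i v => (map_mx (real_complex R) a) 0 i * v 0 i)) => i v.
by apply: (@fcont_mul C); [exact: fcont_cst|exact: coord_continuous].
Qed.

Variables (la0 la1 la2 : 'rV[R]_3) (b0 b1 b2 : 'rV[C]_3).
Hypothesis expand : forall v,
  v = ev la0 v *: b0 + ev la1 v *: b1 + ev la2 v *: b2.

Definition mkv (z1 z2 : C) : 'rV[C]_3 := b0 + z1 *: b1 + z2 *: b2.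

Hypothesis ev_mkv0 : forall z1 z2, ev la0 (mkv z1 z2) = 1.
Hypothesis ev_mkv1 : forall z1 z2, ev la1 (mkv z1 z2) = z1.
Hypothesis ev_mkv2 : forall z1 z2, ev la2 (mkv z1 z2) = z2.

Definition split_complex (z1 z2 : C) : V * V :=
  ((complex.Re z1, complex.Re z2), (complex.Im z1, complex.Im z2)).

Definition chart_vec (w : nonzero_vec R[i] 2) : V * V :=
  split_complex (ev la1 (set_val w) / ev la0 (set_val w))
                (ev la2 (set_val w) / ev la0 (set_val w)).

Definition chart (p : CP2 R) : V * V := chart_vec (repr p).

Definition param_vec (z : V * V) : 'rV[C]_3 :=
  mkv (z.1.1 +i* z.2.1)%C (z.1.2 +i* z.2.2)%C.

Lemma param_nonzero z : nonzero_vec R[i] 2 (param_vec z).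
Proof.
apply/eqP => E; have := ev_mkv0 (z.1.1 +i* z.2.1)%C (z.1.2 +i* z.2.2)%C.
rewrite -/(param_vec z) E /ev big1 => [/eqP|i _]; last by rewrite !mxE mulr0.
by rewrite eq_sym oner_eq0.
Qed.

Definition param (z : V * V) : CP2 R := \pr (into param_nonzero z).

Lemma param_continuous : continuous param.
Proof.
have cp : continuous param_vec.
  have c1 : continuous (fun z : V * V => (z.1.1 +i* z.2.1)%C : C).
    apply: complex_continuous.
      by apply: cont_comp; exact: cont_fst.
    by apply: (cont_comp (@cont_snd _ _)); exact: cont_fst.
  have c2 : continuous (fun z : V * V => (z.1.2 +i* z.2.2)%C : C).
    apply: complex_continuous.
      by apply: (cont_comp (@cont_fst _ _)); exact: cont_snd.
    by apply: cont_comp; exact: cont_snd.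
  apply: mx_continuous => i j.
  pose f1 (z : V * V) : C := (z.1.1 +i* z.2.1)%C.
  pose f2 (z : V * V) : C := (z.1.2 +i* z.2.2)%C.
  have -> : (fun z => param_vec z i j) =
      fun z => b0 i j + f1 z * b1 i j + f2 z * b2 i j.
    by apply/funext => z; rewrite !mxE.
  move=> z; apply: (@fcont_add C _ z (fun z => b0 i j + f1 z * b1 i j)
    (fun z => f2 z * b2 i j)).
    apply: (@fcont_add C _ z (fun=> b0 i j) (fun z => f1 z * b1 i j)).
      exact: fcont_cst.
    by apply: (@fcont_mul C _ z f1 (fun=> b1 i j));
      [exact: c1|exact: fcont_cst].
  by apply: (@fcont_mul C _ z f2 (fun=> b2 i j)); [exact: c2|exact: fcont_cst].
have cpi : continuous (fun w : nonzero_vec R[i] 2 => (\pr w : CP2 R)).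
  by apply/continuousP.
have ci := @into_continuous _ _ _ _ param_nonzero cp.
move=> z.
exact: (@continuous_comp _ _ _ (into param_nonzero) _ z (ci z) (cpi _)).
Qed.

Lemma chart_vec_prop (w w' : nonzero_vec R[i] 2) : \pr w = \pr w' ->
  (ev la0 (set_val w) == 0) = (ev la0 (set_val w') == 0) /\ chart_vec w =
    chart_vec w'.
Proof.
move=> /pi_vecP[c c0 E]; have ratio (a b : C) : c * a / (c * b) = a / b.
  by rewrite -mulf_div divff ?mul1r.
rewrite /chart_vec E; split; first by rewrite evZr mulf_eq0 (negbTE c0).
by rewrite !evZr !ratio.
Qed.

Lemma chartK z : chart (param z) = z.
Proof.
rewrite /chart.
have [_ <-] := @chart_vec_prop (into param_nonzero z) (repr (param z)) (esym
  (reprK _)).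
rewrite /chart_vec val_intoE /param_vec ev_mkv0 ev_mkv1 ev_mkv2 !divr1.
by case: z => [[? ?] [? ?]].
Qed.

Lemma paramK p : ~ real_hyperplane la0 p -> param (chart p) = p.
Proof.
rewrite -[p](@reprK _ (projective_space R[i] 2)) => /real_hyperplaneP.
set w := repr p => w0; have {}w0 : ev la0 (set_val w) != 0 by apply/eqP.
have [_ E] := @chart_vec_prop (repr (\pr w)) w (reprK _).
apply/pi_vecP; exists (ev la0 (set_val w)) => //.
rewrite val_intoE /chart E /chart_vec /param_vec /split_complex /=.
rewrite [LHS]expand /mkv !scalerDr !scalerA.
have Ec (z : C) : (complex.Re z +i* complex.Im z)%C = z by case: z.
by rewrite !Ec ![_ * (_ / _)]mulrC !divfK.
Qed.

(** The chart is read on an arbitrary representative. The set [W] of good vectors is invariant under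
    scaling, so it is the preimage of its image and the quotient topology applies. *)
Lemma chart_continuous p : ~ real_hyperplane la0 p -> {for p, continuous chart}.
Proof.
move=> ph B; rewrite nbhsE => -[O [oO Op] OB].
pose W := [set w : nonzero_vec R[i] 2 | ev la0 (set_val w) != 0 /\ O (chart_vec
  w)].
have ce a : continuous (fun w : nonzero_vec R[i] 2 => ev a (set_val w)).
  by apply: cont_comp (@ev_continuous a); exact: val_continuous.
have oW : open W.
  rewrite openE => w [w0 Ow].
  have n0 : \forall w' \near w, ev la0 (set_val w') != 0.
    exact: (@fcont_neq0 C _ w (fun w' : nonzero_vec R[i] 2 =>
      ev la0 (set_val w'))
      (ce la0 w) w0).
  have cr a : {for w, continuous (fun w' : nonzero_vec R[i] 2 =>
      ev a (set_val w') / ev la0 (set_val w') : C)}.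
    exact: (@fcont_div C _ w (fun w' : nonzero_vec R[i] 2 => ev a (set_val w'))
      (fun w' : nonzero_vec R[i] 2 =>
        ev la0 (set_val w')) (ce a w) (ce la0 w) w0).
  have cRe a := continuous_comp (cr a) (@Re_continuous R _).
  have cIm a := continuous_comp (cr a) (@Im_continuous R _).
  have cw : chart_vec @ w --> chart_vec w.
    exact: (cvg_pair (cvg_pair (cRe la1) (cRe la2)) (cvg_pair (cIm la1) (cIm
      la2))).
  have nO : \forall w' \near w, O (chart_vec w').
    by apply: cw; apply: open_nbhs_nbhs.
  by apply: filterS2 n0 nO => w' ? ?.
have WE : \pi_(projective_space R[i] 2) @^-1` [set q | W (repr q)] = W.
  apply/seteqP; split=> w; rewrite /W /= => -[];
  have [E1 E2] := @chart_vec_prop (repr (\pr w)) w (reprK _);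
  by rewrite E1 E2.
have oq : open ([set q | W (repr q)] : set (CP2 R)) by rewrite /open /=
  /quotient_open WE.
suff : nbhs p [set q | W (repr q)] by apply: filterS => q [_ /OB].
apply: open_nbhs_nbhs; split => //; split => //.
apply/eqP => E; apply: ph; rewrite -[p](@reprK _ (projective_space R[i] 2)).
exact/real_hyperplaneP.
Qed.

Lemma chart_pi1 (M : set (CP2 R)) (A : set (V * V)) (x : M) (G : groupType) :
  (forall p, M p -> ~ real_hyperplane la0 p) ->
    (forall z, A z <-> M (param z)) ->
  (forall y : A, group_isomorphic (fundamental_group R y) G) ->
  group_isomorphic (fundamental_group R x) G.
Proof.
move=> Mh AM AG.
have Af (p : M) : A (chart (set_val p)).
  by apply/AM; rewrite paramK; [exact: set_valP|exact/Mh/set_valP].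
have Mg (z : A) : M (param (set_val z)) by apply/AM; exact: set_valP.
apply: group_isomorphic_trans (AG (into Af x)).
apply: (@pi1_homeo _ _ _ (into Af) (into Mg) x (into Af x) (cst_path R _)).
- apply: into_continuous => p.
  apply: (@continuous_comp _ _ _ (set_val : M -> CP2 R) chart).
    exact: val_continuous.
  exact/chart_continuous/Mh/set_valP.
- apply: into_continuous; apply: cont_comp param_continuous.
  exact: val_continuous.
- move=> p; apply/val_inj; rewrite /= -set_valE paramK //.
  exact/Mh/set_valP.
- by move=> z; apply/val_inj; rewrite /= -set_valE chartK.
Qed.

End Chart.

(** * Linear normal form of the arrangement *)

Lemma poly_nonroot (R : realType) (p : {poly R}) : p != 0 ->
  exists x, p.[x] != 0.
Proof.
move=> p0; pose r : seq R := [seq i%:R | i <- iota 0 (size p)].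
have [/allP rr|/allPn[x _ px]] := boolP (all (root p) r); last by exists x.
have ur : uniq r by rewrite map_inj_uniq ?iota_uniq // => i j /eqP;
  rewrite eqr_nat => /eqP.
have := max_poly_roots p0 (introT allP rr) ur.
by rewrite size_map size_iota ltnn.
Qed.

(** On the moment curve (1, x, ..., x^(n-1)) each condition is the nonvanishing of a nonzero
    polynomial in [x]; a nonroot of their product works. *)
Lemma generic_row (R : realType) n (ns : seq 'cV[R]_n) :
  (forall c, c \in ns -> c != 0) ->
  exists v : 'rV[R]_n, forall c, c \in ns -> v *m c != 0.
Proof.
move=> ns0; pose pol (c : 'cV[R]_n) := \sum_(i < n) c i 0 *: 'X^i : {poly R}.
have pol0 c : c \in ns -> pol c != 0.
  move=> /ns0; apply: contraNneq => /polyP E; apply/eqP/colP => i.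
  have := E i; rewrite coef0 coef_sum (bigD1 i) //= coefZ coefXn eqxx mulr1 mxE.
  rewrite big1 ?addr0 // => j ji; rewrite coefZ coefXn.
  by rewrite eq_sym (inj_eq (@ord_inj n)) (negbTE ji) mulr0.
have [x px] : exists x, (\prod_(c <- ns) pol c).[x] != 0.
  by apply: poly_nonroot; rewrite prodf_seq_neq0; apply/allP => c /= /pol0.
exists (\row_i x ^+ i) => c cns; apply: contra_neq px => E.
rewrite horner_prod; apply/eqP; rewrite prodf_seq_eq0; apply/hasP;
  exists c => //=.
have := congr1 (fun A : 'M_1 => A 0 0) E; rewrite !mxE => <-.
rewrite horner_sum; apply/eqP/eq_bigr => i _.
by rewrite mxE hornerZ hornerXn mulrC.
Qed.

(** Geometrically, a common point of the lines with equations [a] and [b]. *)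
Lemma annihilator (R : fieldType) (a b : 'rV[R]_3) :
  exists c : 'cV[R]_3, [/\ c != 0, a *m c = 0 & b *m c = 0].
Proof.
have : cokermx (col_mx a b) != 0.
  rewrite -mxrank_eq0 mxrank_coker -lt0n subn_gt0.
  by rewrite (leq_ltn_trans (rank_leq_row _)).
move=> /eqP K0; have /existsP[j /eqP cj] : [exists j,
  col j (cokermx (col_mx a b)) != 0].
  apply: contra_notT K0; rewrite negb_exists => /forallP H;
    apply/matrixP => i j.
  by have /negPn/eqP/colP/(_ i) := H j; rewrite !mxE.
have := mulmx_coker (col_mx a b) => /(congr1 (col j)).
rewrite col0 colE -mulmxA -colE mul_col_mx -[0]vsubmxK => /eq_col_mx[E1 E2].
exists (col j (cokermx (col_mx a b))); split; first exact/eqP.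
- by rewrite E1; apply/matrixP => ? ?; rewrite !mxE.
- by rewrite E2; apply/matrixP => ? ?; rewrite !mxE.
Qed.

Lemma sum_ord3 (V : nmodType) (F : 'I_3 -> V) :
  \sum_i F i = F 0 + F 1 + F 2%:R.
Proof.
by rewrite !big_ord_recl big_ord0 addr0 addrA; congr (F _ + F _ + F _);
  apply/val_inj.
Qed.

Lemma indep_unitmx (R : fieldType) (a b c : 'rV[R]_3) :
  (forall u0 u1 u2, u0 *: a + u1 *: b + u2 *: c = 0 ->
     [/\ u0 = 0, u1 = 0 & u2 = 0]) ->
  exists2 B : 'M[R]_3, B \in unitmx & [/\ row 0 B = a,
    row 1 B = b & row 2%:R B = c].
Proof.
move=> H; pose B : 'M[R]_3 := \matrix_(i, j) (nth 0 [:: a; b; c] i) 0 j.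
have rB (i : 'I_3) : row i B = nth 0 [:: a; b; c] i.
  by apply/rowP => j; rewrite !mxE.
exists B; last by rewrite !rB.
rewrite -row_free_unit; apply: inj_row_free => v.
rewrite mulmx_sum_row sum_ord3 !rB /= => /H[v0 v1 v2].
apply/rowP => i; rewrite mxE; case: i => -[|[|[|//]]] /= lti.
- by rewrite -[RHS]v0; congr (v _ _); apply/val_inj.
- by rewrite -[RHS]v1; congr (v _ _); apply/val_inj.
- by rewrite -[RHS]v2; congr (v _ _); apply/val_inj.
Qed.

(** [la1] is any member of [s], and [la2] is chosen not to vanish where the line [a0] meets the
    others. Then [a0], [a], [la2] are independent for every [a] in [s], so [a] has a nonzero
    coefficient on [la1]. *)
Lemma normal_form (R : realType) (a0 : 'rV[R]_3) (s : seq 'rV[R]_3) :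
  a0 != 0 -> s != [::] -> (forall a, a \in s -> forall c, a != c *: a0) ->
  exists la1 la2 : 'rV[R]_3,
    (forall u0 u1 u2, u0 *: a0 + u1 *: la1 + u2 *: la2 = 0 ->
       [/\ u0 = 0, u1 = 0 & u2 = 0]) /\
    (forall a, a \in s ->
      exists m n c, m != 0 /\ a = m *: (la1 + n *: la2 - c *: a0)).
Proof.
move=> a00 s0 sa; have [la1 la1s] : exists la1, la1 \in s.
  by case: s s0 {sa} => // a s _; exists a; rewrite mem_head.
pose cov a := projT1 (cid (annihilator a0 a)).
have covP a : [/\ cov a != 0, a0 *m cov a = 0 & a *m cov a = 0].
  exact: projT2 (cid (annihilator a0 a)).
have [la2 la2P] := @generic_row R 3 [seq cov a | a <- s] (fun c =>
  ltac:(by move=> /mapP[a _ ->]; have [] := covP a)).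
have indep a u0 u1 u2 : a \in s -> u0 *: a0 + u1 *: a + u2 *: la2 = 0 ->
    [/\ u0 = 0, u1 = 0 & u2 = 0].
  move=> as_ E; have [_ a0c ac] := covP a.
  have u20 : u2 = 0.
    have := congr1 (mulmx^~ (cov a)) E;
      rewrite !mulmxDl -!scalemxAl a0c ac !scaler0 !add0r.
    rewrite mul0mx => /eqP; rewrite scaler_eq0 => /orP[/eqP //|].
    by rewrite (negbTE (la2P _ (map_f _ as_))).
  move: E; rewrite u20 scale0r addr0 => E.
  have [u10|u10] := eqVneq u1 0.
    move: E; rewrite u10 scale0r addr0 => /eqP;
      rewrite scaler_eq0 (negbTE a00) orbF.
    by move=> /eqP.
  have := sa a as_ (- (u1^-1 * u0));
    suff -> : a = - (u1^-1 * u0) *: a0 by rewrite eqxx.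
  apply: (scalerI u10); rewrite scalerA mulrN mulVKf // scaleNr.
  by apply/eqP; rewrite -addr_eq0 addrC E.
exists la1, la2; split; first by move=> u0 u1 u2; exact: indep.
have [B Bu [B0 B1 B2]] :=
  indep_unitmx (fun u0 u1 u2 => indep la1 u0 u1 u2 la1s).
move=> a as_; pose u := a *m invmx B.
have aE : a = u 0 0 *: a0 + u 0 1 *: la1 + u 0 2%:R *: la2.
  by have := mulmx_sum_row u B; rewrite sum_ord3 B0 B1 B2 => <-;
    rewrite mulmxKV.
have u1 : u 0 1 != 0.
  apply/eqP => u10; have [|_ /eqP + _] := indep a (- u 0 0) 1 (- u 0 2%:R) as_;
    last first.
    by rewrite oner_eq0.
  by rewrite scale1r [X in _ + X + _]aE u10 scale0r addr0 !scaleNr addrA addNr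
    add0r subrr.
exists (u 0 1), (u 0 2%:R / u 0 1), (- (u 0 0 / u 0 1)); split=> //.
rewrite [LHS]aE scaleNr opprK !scalerDr !scalerA ![u 0 1 * _]mulrC !divfK //.
by rewrite [RHS]addrC addrA.
Qed.

Lemma dual_basis (R : realType) (la0 la1 la2 : 'rV[R]_3) :
  (forall u0 u1 u2, u0 *: la0 + u1 *: la1 + u2 *: la2 = 0 ->
     [/\ u0 = 0, u1 = 0 & u2 = 0]) ->
  exists b0 b1 b2 : 'rV[(R[i] : numFieldType)]_3,
  [/\ forall v, v = ev la0 v *: b0 + ev la1 v *: b1 + ev la2 v *: b2,
      forall z1 z2, ev la0 (mkv b0 b1 b2 z1 z2) = 1,
      forall z1 z2, ev la1 (mkv b0 b1 b2 z1 z2) = z1 &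
      forall z1 z2, ev la2 (mkv b0 b1 b2 z1 z2) = z2].
Proof.
move=> /indep_unitmx[B Bu [B0 B1 B2]].
pose M : 'M[(R[i] : numFieldType)]_3 := (map_mx (real_complex R) B)^T.
have Mu : M \in unitmx by rewrite unitmx_tr map_unitmx.
have evE (i : 'I_3) v : ev (row i B) v = (v *m M) 0 i.
  by rewrite /ev mxE; apply: eq_bigr => j _; rewrite !mxE mulrC.
pose b i := row i (invmx M).
have combE (z : 'rV_3) : z *m invmx M = z 0 0 *: b 0 + z 0 1 *: b 1 + z 0 2%:R
  *: b 2%:R.
  by rewrite mulmx_sum_row sum_ord3.
have mkE z1 z2 : mkv (b 0) (b 1) (b 2%:R) z1 z2 =
    (\row_(i < 3) nth 0 [:: 1; z1; z2] i) *m invmx M.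
  by rewrite combE !mxE /= scale1r.
exists (b 0), (b 1), (b 2%:R); split=> [v|z1 z2|z1 z2|z1 z2].
- by rewrite -B0 -B1 -B2 !evE -combE mulmxK.
- by rewrite -B0 evE mkE mulmxKV // mxE.
- by rewrite -B1 evE mkE mulmxKV // mxE.
- by rewrite -B2 evE mkE mulmxKV // mxE.
Qed.

Lemma group_isomorphic_sym (G H : groupType) :
  group_isomorphic G H -> group_isomorphic H G.
Proof.
move=> [f [g fK gK]]; apply: (@group_isomorphicP _ _ g); last by exists f.
exact: can2_gmulfM fK gK.
Qed.

Lemma strictly_sorting (R : realType) (t : nat) (f : 'I_t -> R) : injective f ->
  exists2 s : 'I_t -> 'I_t, injective s &
    forall i j : 'I_t, (i < j)%N -> f (s i) < f (s j).
Proof.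
move=> f_inj; pose q := sort (fun i j => f i <= f j) (enum 'I_t).
have sq : size q = t by rewrite size_sort size_enum_ord.
have uq : uniq q by rewrite sort_uniq enum_uniq.
have fq : sorted <%R [seq f i | i <- q].
  rewrite lt_sorted_uniq_le map_inj_uniq // uq sorted_map.
  by apply: sort_sorted => i j; exact: le_total.
exists (fun i => nth i q i).
  move=> i j; rewrite (set_nth_default i) ?sq // => /eqP.
  by rewrite nth_uniq ?sq // => /eqP/val_inj.
move=> i j ij; have jq : (j < size q)%N by rewrite sq.
have iq : (i < size q)%N by rewrite sq.
have /(_ (i : nat) (j : nat)) := sorted_ltn_nth lt_trans 0 fq.
rewrite !inE !size_map => /(_ iq jq ij).
by rewrite (nth_map i) // (nth_map j).
Qed.

(** * Lines of the arrangement seen in the chart *)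

Section Arrangement.
Variables (R : realType) (a0 la1 la2 : 'rV[R]_3).
Local Notation C := (R[i] : numFieldType).
Variables b0 b1 b2 : 'rV[C]_3.
Hypothesis expand : forall v,
  v = ev a0 v *: b0 + ev la1 v *: b1 + ev la2 v *: b2.
Hypothesis ev_mkv0 : forall z1 z2, ev a0 (mkv b0 b1 b2 z1 z2) = 1.
Hypothesis ev_mkv1 : forall z1 z2, ev la1 (mkv b0 b1 b2 z1 z2) = z1.
Hypothesis ev_mkv2 : forall z1 z2, ev la2 (mkv b0 b1 b2 z1 z2) = z2.
Local Notation prm := (param ev_mkv0).

Definition line (n c : R) : set (CP2 R) :=
  real_hyperplane (la1 + n *: la2 - c *: a0).

Lemma ev_line n c v : ev (la1 + n *: la2 - c *: a0) v =
  ev la1 v + (real_complex R n) * ev la2 v - (real_complex R c) * ev a0 v.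
Proof. by rewrite !evDl -scaleNr !evZl rmorphN mulNr. Qed.

Lemma param_line n c z : line n c (prm z) <->
  z.1.1 + n * z.1.2 = c /\ z.2.1 + n * z.2.2 = 0.
Proof.
rewrite /line /param; split=> [/real_hyperplaneP|[E1 E2]]; last first.
  apply/real_hyperplaneP;
    rewrite ev_line val_intoE /param_vec ev_mkv0 ev_mkv1 ev_mkv2.
  by apply/eqP; rewrite eq_complex /=; apply/andP; split; apply/eqP;
    [move: E1|move: E2]; lra.
rewrite ev_line val_intoE /param_vec ev_mkv0 ev_mkv1 ev_mkv2.
move=> /eqP; rewrite eq_complex /= => /andP[/eqP E1 /eqP E2].
by split; [move: E1|move: E2]; lra.
Qed.

Lemma param_infty z : ~ real_hyperplane a0 (prm z).
Proof.
move=> /real_hyperplaneP; rewrite val_intoE ev_mkv0 => /eqP.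
by rewrite oner_eq0.
Qed.

Lemma line_inj n : injective (line n).
Proof.
move=> c d E; have : line n c (prm ((c, 0), (0, 0))) by apply/param_line => /=;
  split; ring.
by rewrite E => /param_line /= [<- _]; ring.
Qed.

Lemma line_neq n c : line n c != real_hyperplane a0.
Proof.
apply/eqP => E; have : line n c (prm ((c, 0), (0, 0))).
  by apply/param_line => /=; split; ring.
by rewrite E; exact: param_infty.
Qed.

(** Where [a0] vanishes the equation reads [la1 + n * la2 = 0], and [la2] is nonzero there, so the
    point determines [n]. *)
Lemma infty_line_slope n n' c c' p : real_hyperplane a0 p -> line n c p ->
  (line n' c' p <-> n' = n).
Proof.
rewrite -[p](@reprK _ (projective_space R[i] 2)); set w := repr p.
move=> /real_hyperplaneP w0 /real_hyperplaneP;
  rewrite ev_line w0 mulr0 subr0 => w1.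
have w2 : ev la2 (set_val w) != 0.
  apply/eqP => w2; move: w1; rewrite w2 mulr0 addr0 => w1.
  have := set_valP w; rewrite /nonzero_vec /= => /negP; apply; apply/eqP.
  by rewrite -set_valE [LHS]expand w0 w1 w2 !scale0r !addr0.
split=> [/real_hyperplaneP|->]; last first.
  by apply/real_hyperplaneP; rewrite ev_line w0 mulr0 subr0.
rewrite ev_line w0 mulr0 subr0 => w1'.
have : (real_complex R n' - real_complex R n) * ev la2 (set_val w) = 0.
  rewrite mulrBl -[X in X - _](addKr (ev la1 (set_val w))) w1' addr0.
  by rewrite -opprD w1 oppr0.
move=> /eqP; rewrite mulf_eq0 (negbTE w2) orbF subr_eq0 => /eqP.
exact: complexI.
Qed.

(** The point at infinity of slope [n] is spanned by [b2 - n b1], whatever [c] is. *)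
Lemma infty_line_point n c c' p p' : real_hyperplane a0 p -> line n c p ->
  real_hyperplane a0 p' -> line n c' p' -> p = p'.
Proof.
rewrite -[p](@reprK _ (projective_space R[i] 2)) -[p'](@reprK _
  (projective_space R[i] 2)).
set w := repr p; set w' := repr p'.
move=> /real_hyperplaneP w0 /real_hyperplaneP;
  rewrite ev_line w0 mulr0 subr0 => w1.
move=> /real_hyperplaneP w0' /real_hyperplaneP;
  rewrite ev_line w0' mulr0 subr0 => w1'.
have wE (u : nonzero_vec R[i] 2) : ev a0 (set_val u) = 0 ->
    ev la1 (set_val u) + real_complex R n * ev la2 (set_val u) = 0 ->
    set_val u = ev la2 (set_val u) *: (b2 - real_complex R n *: b1) /\
    ev la2 (set_val u) != 0.
  move=> u0 /eqP; rewrite addr_eq0 => /eqP u1.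
  have uE : set_val u = ev la2 (set_val u) *: (b2 - real_complex R n *: b1).
    rewrite [LHS]expand u0 u1 scale0r add0r scalerBr scalerA addrC scaleNr.
    by rewrite [_ * real_complex R n]mulrC.
  split=> //; apply/eqP => u2; have := set_valP u;
    rewrite /nonzero_vec /= => /negP.
  by apply; apply/eqP; rewrite -set_valE uE u2 scale0r.
have [E N] := wE w w0 w1; have [E' N'] := wE w' w0' w1'.
apply/pi_vecP; exists (ev la2 (set_val w') / ev la2 (set_val w)).
  by rewrite mulf_neq0 // invr_eq0.
rewrite [LHS]E' -[X in X *: _ = _](divfK N) -scalerA; congr (_ *: _).
exact: esym E.
Qed.

End Arrangement.

Lemma real_hyperplaneZ (R : realType) (c : R) (a : 'rV[R]_3) : c != 0 ->
  real_hyperplane (c *: a) = real_hyperplane a.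
Proof.
move=> c0; apply/seteqP; split=> p;
  rewrite -[p](@reprK _ (projective_space R[i] 2));
  move=> /real_hyperplaneP E; apply/real_hyperplaneP; move: E; rewrite evZl.
  move=> /eqP; rewrite mulf_eq0 => /orP[|/eqP //].
  by rewrite -(rmorph0 (real_complex R)) => /eqP/complexI/eqP;
    rewrite (negbTE c0).
by move=> ->; rewrite mulr0.
Qed.

Lemma fset_set_size_le (T : choiceType) (A : set T) (s : seq T) :
  finite_set A -> uniq s -> (forall x, x \in s -> A x) ->
  (size s <= #|` fset_set A|)%N.
Proof.
move=> fA us sA; apply: uniq_leq_size => // x /sA Ax.
by rewrite in_fset_set // inE.
Qed.

Lemma other_line (R : realType) (L : set (set (CP2 R))) (l0 : set (CP2 R)) p :
  finite_set L -> (2 < multiplicity L p)%N -> exists l, [/\ L l, l p & l != l0].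
Proof.
rewrite /multiplicity => finL; set F := fset_set _ => F2.
have /fset0Pn[l] : (F `\ l0)%fset != fset0.
  rewrite -cardfs_gt0; have := cardfsD1 l0 F.
  by case: (l0 \in F) => /= E; move: F2; rewrite E; lia.
rewrite !inE => /andP[ll0]; rewrite /F.
have fA : finite_set [set l | L l /\ l p] by apply: sub_finite_set finL =>
  l' [].
by rewrite in_fset_set // inE => -[Ll lp]; exists l.
Qed.

Theorem theorem4p5p1 (R : realType) (L : set (set (CP2 R)))
    (L0 : set (CP2 R)) (t : nat) (P : 'I_t -> CP2 R) (k : 'I_t -> nat)
    (L_arr : real_line_arrangement L)
    (t_ge1 : (1 <= t)%N)
    (P_inj : injective P)
    (P_mult : multiple_points L = range P)
    (L0_in : L L0)
    (P_on_L0 : forall i, L0 (P i))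
    (P_cover : forall l, L l -> exists i, l (P i))
    (k_mult : forall i, multiplicity L (P i) = (k i).+1)
    (x : ~` arrangement_union L) :
  group_isomorphic (fundamental_group R x)
    (group_prod (fun i : 'I_t => free_group 'I_(k i))).
Proof.
have [finL Lreal] := L_arr.
have [a0 a00 L0E] := Lreal _ L0_in.
have Pmult i : (2 < multiplicity L (P i))%N.
  by have : multiple_points L (P i) by rewrite P_mult; exists i.
pose coef l : 'rV[R]_3 := xget 0 [set a | a != 0 /\ l = real_hyperplane a].
have coefP l : L l -> coef l != 0 /\ l = real_hyperplane (coef l).
  move=> /Lreal[a an lE]; rewrite /coef; case: xgetP => [b _ //|/(_ a)[]].
  by split.
pose s := [seq coef l | l <- enum_fset (fset_set L) & l != L0].
have sP a : a \in s -> exists l, [/\ L l, l != L0 & a = coef l].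
  move=> /mapP[l]; rewrite mem_filter => /andP[lL0].
  by rewrite in_fset_set // inE => Ll ->; exists l.
have [la1 [la2 [indep form]]] : exists la1 la2 : 'rV[R]_3,
    (forall u0 u1 u2, u0 *: a0 + u1 *: la1 + u2 *: la2 = 0 ->
       [/\ u0 = 0, u1 = 0 & u2 = 0]) /\
    (forall a, a \in s ->
      exists m n c, m != 0 /\ a = m *: (la1 + n *: la2 - c *: a0)).
  apply: normal_form => //.
    have [l [Ll _ ll0]] := other_line L0 finL (Pmult (Ordinal t_ge1)).
    have : coef l \in s by apply: map_f;
      rewrite mem_filter ll0 in_fset_set // inE.
    by apply: contraTneq => ->.
  move=> a /sP[l [Ll ll0 ->]] c; have [l0 lE] := coefP l Ll.
  apply: contraNneq ll0 => E; rewrite lE E L0E real_hyperplaneZ //.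
  by apply: contraNneq l0 => c0; rewrite E c0 scale0r.
have lineP l : L l -> l != L0 -> exists n c, l = line a0 la1 la2 n c.
  move=> Ll ll0; have [_ lE] := coefP l Ll.
  have [|m [n [c [m0 E]]]] := form (coef l).
    by apply: map_f; rewrite mem_filter ll0 in_fset_set // inE.
  by exists n, c; rewrite [LHS]lE E real_hyperplaneZ.
have [b0 [b1 [b2 [expand ev0 ev1 ev2]]]] := dual_basis indep.
pose ln := line a0 la1 la2.
pose prm := param ev0.
have PL0 i : real_hyperplane a0 (P i) by rewrite -[real_hyperplane a0]L0E.
(* A multiple point lies on a line other than [L0], whose slope is then the only one possible at
   that point. *)
have slope_ex i : exists n, forall n' c, ln n' c (P i) <-> n' = n.
  have [l [Ll lPi ll0]] := other_line L0 finL (Pmult i).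
  have [n [c lE]] := lineP l Ll ll0; exists n => n' c'.
  have lnP : line a0 la1 la2 n c (P i) by rewrite -lE.
  exact: (infty_line_slope expand _ _ (PL0 i) lnP).
pose slope i := projT1 (cid (slope_ex i)).
have slopeP i n c : ln n c (P i) <-> n = slope i.
  exact: (projT2 (cid (slope_ex i))).
have slope_inj : injective slope.
  move=> i j E; apply: P_inj.
  have Pi : ln (slope i) 0 (P i) by apply/slopeP.
  have Pj : ln (slope i) 0 (P j) by apply/slopeP.
  exact: (infty_line_point expand (PL0 i) Pi (PL0 j) Pj).
have lnL0 n c : ln n c != L0.
  by rewrite L0E; exact: (line_neq ev0 ev1 ev2).
have ln_inj n : injective (ln n) by exact: (line_inj ev0 ev1 ev2).
pose root_set i := [set c : R | L (ln (slope i) c)].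
have root_fin i : finite_set (root_set i).
  by apply: (finite_preimage (f := ln (slope i))) => // c d _ _; exact: ln_inj.
(* The lines through [P i] are those of its class together with [L0], which accounts for the 1 in
   [(k i).+1]. *)
have root_card i : #|` fset_set (root_set i)| = k i.
  have finP : finite_set [set l | L l /\ l (P i)].
    by apply: sub_finite_set finL => l [].
  apply/eqP; rewrite -eqSS -(k_mult i) /multiplicity; apply/eqP.
  have -> : fset_set [set l | L l /\ l (P i)] =
      (L0 |` [fset ln (slope i) c | c in fset_set (root_set i)])%fset.
    apply/fsetP => l; rewrite in_fset_set // !inE; apply/idP/idP.
      rewrite inE => -[Ll lP]; have [//|ll0 /=] := eqVneq l L0.
      have [n [c lE]] := lineP l Ll ll0.
      have nE : n = slope i by apply/(slopeP i n c); rewrite /ln -lE.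
      apply/imfsetP; exists c => /=; last by rewrite lE nE.
      by rewrite in_fset_set // inE; move: Ll; rewrite lE nE.
    move=> /orP[/eqP ->|/imfsetP[c /= + ->]]; rewrite inE; first by split.
    by rewrite in_fset_set // inE => Lc; split=> //; apply/slopeP.
  rewrite cardfsU1 card_imfset; last exact: ln_inj.
  suff -> : L0 \notin [fset ln (slope i) c | c in fset_set (root_set i)]%fset by
    [].
  by apply/imfsetP => -[c _ E]; have := lnL0 (slope i) c; rewrite -E eqxx.
pose roots i := sort <=%R (enum_fset (fset_set (root_set i))).
have rootsP i c : (c \in roots i) = (c \in root_set i).
  by rewrite mem_sort in_fset_set.
(* The sectors require increasing slopes; the renumbering [sg] is undone at the end by permuting the
   factors. *)
have [sg sg_inj sg_inc] := strictly_sorting slope_inj.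
pose s' (j : nat) := if insub j is Some o then slope (sg o) else 0.
pose r' (j : nat) := if insub j is Some o then roots (sg o) else [::].
have s'E (o : 'I_t) : s' o = slope (sg o) by rewrite /s' valK.
have r'E (o : 'I_t) : r' o = roots (sg o) by rewrite /r' valK.
have s_inc i j : (i < j)%N -> (j < t)%N -> s' i < s' j.
  move=> ij jt; have it := ltn_trans ij jt.
  by rewrite (s'E (Ordinal it)) (s'E (Ordinal jt)); apply: sg_inc.
have r_sorted j : (j < t)%N -> sorted <%R (r' j).
  move=> jt; rewrite (r'E (Ordinal jt)) lt_sorted_uniq_le sort_uniq fset_uniq.
  by apply: sort_sorted; exact: le_total.
have in_line (v : R * R) (o : 'I_t) : lin s' o v \in r' o ->
    L (ln (slope (sg o)) (lin s' o v)) /\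
    ln (slope (sg o)) (lin s' o v) (prm (v, (0, 0))).
  rewrite r'E rootsP inE => Lv; split=> //.
  by apply/(param_line ev0 ev1 ev2); rewrite /= /lin s'E; split; ring.
have general_position (v : R * R) i j l : (i < j)%N -> (j < l)%N -> (l < t)%N ->
    lin s' i v \in r' i -> lin s' j v \in r' j -> lin s' l v \in r' l -> False.
  move=> ij jl lt; have jt := ltn_trans jl lt; have it := ltn_trans ij jt.
  move=> /(in_line v (Ordinal it))[Li vi] /(in_line v (Ordinal jt))[Lj vj].
  move=> /(in_line v (Ordinal lt))[Ll vl].
  set li := ln _ _ in Li vi; set lj := ln _ _ in Lj vj;
    set ll := ln _ _ in Ll vl.
  have ne (o o' : 'I_t) c c' : o != o' ->
    ln (slope (sg o)) c != ln (slope (sg o')) c'.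
    move=> oo'; apply: contraNneq oo' => E; apply/eqP/sg_inj/slope_inj.
    by apply/(slopeP (sg o') _ c); rewrite E; apply/slopeP.
  (* Three lines of distinct slopes would make this affine point multiple, but all multiple points
     are on the line at infinity. *)
  suff : multiple_points L (prm (v, (0, 0))).
    rewrite P_mult => -[o _ oE]; have := PL0 o; rewrite oE.
    exact: param_infty.
  rewrite /multiple_points /= /multiplicity.
  apply: (@fset_set_size_le _ _ [:: li; lj; ll]).
  - by apply: sub_finite_set finL => l' [].
  - rewrite /= !inE negb_or !ne //.
    + by rewrite -val_eqE /= ltn_eqF.
    + by rewrite -val_eqE /= ltn_eqF // (ltn_trans ij).
    + by rewrite -val_eqE /= ltn_eqF.
  - by move=> l'; rewrite !inE => /or3P[] /eqP ->.
apply: (@group_isomorphic_trans _ (group_prod (fun j : 'I_t =>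
  free_group 'I_(size (r' j))))); last first.
  apply: group_isomorphic_sym.
  have -> : (fun j : 'I_t => free_group 'I_(size (r' j)) : groupType) =
      (fun i : 'I_t => free_group 'I_(k i) : groupType) \o sg.
    apply/funext => j /=; congr (free_group 'I_(_) : groupType).
    by rewrite r'E size_sort root_card.
  exact: group_prod_perm.
apply: (chart_pi1 expand ev1 ev2 (A := affine_complement t s' r')).
- by move=> p Mp ph; apply: Mp; exists L0 => //; rewrite L0E.
- move=> z; split=> [Az [l Ll lz]|Mz j jt zr].
    have [E|ll0] := eqVneq l L0.
      by move: lz; rewrite E L0E; exact: param_infty.
    have [n [c lE]] := lineP l Ll ll0.
    (* The point of the line at some [P i] fixes its slope, and so places the line in a class. *)
    have [i lPi] := P_cover l Ll.
    have nE : n = slope i by apply/(slopeP i n c); rewrite /ln -lE.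
    have [sg' sgK sgK'] := injF_bij sg_inj.
    move: lz; rewrite lE => /(param_line ev0 ev1 ev2)[z1 z2].
    have := Az (sg' i) (ltn_ord _); rewrite /lin s'E r'E sgK' -nE z1 z2 eqxx.
    have croot : c \in roots i by rewrite rootsP inE; move: Ll; rewrite lE nE.
    by move=> /(_ croot).
  apply/eqP => z2; apply: Mz; have [] := in_line z.1 (Ordinal jt) zr => Ll _.
  exists (ln (slope (sg (Ordinal jt))) (lin s' j z.1)) => //.
  apply/(param_line ev0 ev1 ev2).
  by move: z2; rewrite /lin (s'E (Ordinal jt)).
- by move=> y; apply: affine_pi1.
Qed.
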